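(* For any solution of the finite volume scheme described in the context, the following holds. For any $\varepsilon>0$ there is a constant $c_{\varepsilon,\Omega,\xi}>0$ such that for every time step $m\ge1$ $$\frac{\mathbb E_{\mathcal T}^m-\mathbb E_{\mathcal T}^{m-1}}{\tau^m}+\mathbb D_{\mathcal T}^m\le c_{\varepsilon,\Omega,\xi}+\varepsilon\,\mathbb E_{\mathcal T}^m,$$ where $$\mathbb{E}_{\mathcal T}^m=\frac{\lambda^2}{2}\sum_{\sigma\in\mathcal E}\tau_\sigma\bigl(D_\sigma(\boldsymbol\psi^m-\boldsymbol\psi^D)\bigr)^2+\sum_{K\in\mathcal T_{\mathrm{intr}}}m_K\Phi_a(n_{a,K}^m)+\delta\sum_{\alpha\in\{n,p\}}\sum_{K\in\mathcal T}m_KH_\alpha(n_{\alpha,K}^m,n_{\alpha,K}^D),$$ $$\mathbb D_{\mathcal T}^m=\frac{z_a^2}{2}\sum_{\sigma\in\mathcal E_{\mathrm{intr}}^{\mathrm{int}}}\tau_\sigma\overline n_{a,\sigma}^m(D_\sigma\boldsymbol\varphi_a^m)^2+\frac{\delta}{2\nu}\sum_{\alpha\in\{n,p\}}\sum_{\sigma\in\mathcal E}\tau_\sigma\overline n_{\alpha,\sigma}^m(D_\sigma\boldsymbol\varphi_\alpha^m)^2+\frac{\delta}{\nu}\sum_{K\in\mathcal T}m_KR(n_{n,K}^m,n_{p,K}^m)(\varphi_{p,K}^m-\varphi_{n,K}^m).$$ For fixed statistics functions, the constant $c_{\varepsilon,\Omega,\xi}$ depends solely on $\varepsilon$, the measure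 of $\Omega$, the mesh regularity $\xi$, the boundary data and the photogeneration term via the norms $\|G\|_{L^\infty}$, $\|\varphi^D\|_{W^{1,\infty}}$, $\|\psi^D\|_{W^{1,\infty}}$, on $z_a$, and on the dimensionless parameters $\delta,\gamma,\nu$. If $G=0$ and $\nabla\varphi^D=\nabla\psi^D=\mathbf 0$, then the right-hand side of the inequality vanishes, i.e. $\frac{\mathbb E_{\mathcal T}^m-\mathbb E_{\mathcal T}^{m-1}}{\tau^m}+\mathbb D_{\mathcal T}^m\le0$.
   Context: **Domain and data.** $\Omega\subset\mathbb R^d$, $d\le3$, is open, connected, bounded (polyhedral, so that it can be meshed as below), partitioned into pairwise disjoint open subdomains $\Omega_{\mathrm{intr}},\Omega_{\mathrm{HTL}},\Omega_{\mathrm{ETL}}$, with $\partial\Omega_{\mathrm{HTL}}\cap\partial\Omega_{\mathrm{ETL}}=\emptyset$. The boundary $\partial\Omega$ is decomposed into $\Gamma^D$ (two ohmic contacts) and $\Gamma^N$, with $\Gamma^D\cap\overline\Omega_{\mathrm{intr}}=\emptyset$. $\lambda,\nu,\delta,\gamma>0$; $z_n=-1$, $z_p=1$, $z_a>0$; $C\in L^\infty(\Omega)$; $0\le G\in L^\infty(\Omega)$; $\psi^D,\varphi^D\in W^{1,\infty}(\Omega)$; $\varphi_n^0,\varphi_p^0\in L^\infty(\Omega)$, $\varphi_a^0\in L^\infty(\Omega_{\mathrm{intr}})$. **Statistics functions.** $\mathcal F_n,\mathcal F_p:\mathbb R\to(0,\infty)$ and $\mathcal F_a:\mathbb R\to(0,1)$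 are $C^1$-diffeomorphisms with $0<\mathcal F_\alpha'(\eta)\le\mathcal F_\alpha(\eta)\le e^\eta$ for all $\eta\in\mathbb R$. $\Phi_\alpha$ is an antiderivative of $\mathcal F_\alpha^{-1}$; for $\alpha=a$ the constant is chosen so that $\Phi_a\ge0$ vanishes at exactly one point. $H_\alpha(x,y)=\Phi_\alpha(x)-\Phi_\alpha(y)-\Phi_\alpha'(y)(x-y)\ge0$. For $\alpha\in\{n,p\}$, $\lim_{x\to+\infty}H_\alpha(x,y_0)/\mathcal F_\alpha^{-1}(x)=+\infty$ for every $y_0\ge0$ (convention $H_\alpha(x,0)=+\infty$ for $x>0$). **Mesh.** $(\mathcal T,\mathcal E,\{x_K\}_{K\in\mathcal T})$ is an admissible mesh: $\mathcal T$ is a finite family of non-empty, convex, open, polygonal (polyhedral), pairwise disjoint control volumes $K$ of Lebesgue measure $m_K$, with $\overline\Omega=\bigcup_{K\in\mathcal T}\overline K$; a subset $\mathcal T_{\mathrm{intr}}\subset\mathcal T$ satisfies $\overline\Omega_{\mathrm{intr}}=\bigcup_{K\in\mathcal T_{\mathrm{intr}}}\overline K$. $\mathcal E$ is a finite family of faces $\sigma$, closed subsets of $\overline\Omega$ contained in hyperplanes with $(d-1)$-dimensional measure $m_\sigma>0$; $\partial K=\bigcup_{\sigma\in\mathcal E_K}\sigma$ with $\mathcal E_K\subset\mathcal E$, $\mathcal E=\bigcup_K\mathcal E_K$; for $K\ne L$, $\partial K\cap\partial L$ either has zero $(d-1)$-measure or is a face denoted $K|L\in\mathcal E$. $\mathcal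 E_{\mathrm{intr}}=\{\sigma\in\mathcal E:\sigma\subset\overline\Omega_{\mathrm{intr}}\}$, $\mathcal E^D=\{\sigma\subset\Gamma^D\}$ and $\mathcal E^N=\{\sigma\subset\Gamma^N\}$ (partitions of $\Gamma^D$, $\Gamma^N$), $\mathcal E^{\mathrm{int}}=\{\sigma\in\mathcal E:\sigma\not\subset\partial\Omega\}$, $\mathcal E^{\mathrm{int}}_{\mathrm{intr}}=\{\sigma\in\mathcal E_{\mathrm{intr}}:\sigma\not\subset\partial\Omega_{\mathrm{intr}}\}$. Cell centers $x_K\in K$ are such that $x_L-x_K$ is orthogonal to $\sigma=K|L$. $d_\sigma$ is the distance between $x_K$ and $x_L$ if $\sigma=K|L$, or between $x_K$ and the affine hyperplane spanned by $\sigma$ if $\sigma\subset\partial\Omega$; $\tau_\sigma=m_\sigma/d_\sigma$. Regularity: $\xi>0$ is such that for all $K\in\mathcal T$, $\sigma\in\mathcal E_K$: $d_\sigma\ge\xi\,\mathrm{diam}(K)$ and $m_K\ge\xi\sum_{\sigma\in\mathcal E_K}m_\sigma d_\sigma$. **Time.** $0=t^0<t^1<\dots<t^M=t_F$, $\tau^m=t^m-t^{m-1}$; superscript $m$ refers to time $t^m$, $m=0$ to the initial time. **Discrete data.** $\chi_K=\frac1{m_K}\int_K\chi$ for $\chi\in\{C,G,\psi^D,\varphi^D\}$, $\chi_\sigma=\frac1{m_\sigma}\int_\sigma\chi$ for $\sigma\in\mathcal E^D$, $\chi\in\{\psi^D,\varphi^D\}$; $\varphi^0_{\alpha,K}$ is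 the cell average of $\varphi_\alpha^0$. Vectors $\mathbf u=(u_K)_K$ carry Dirichlet values $u^D_\sigma$, $\sigma\in\mathcal E^D$ ($\psi^D_\sigma$ for $\boldsymbol\psi^m,\boldsymbol\psi^D$; $\varphi^D_\sigma$ for $\boldsymbol\varphi_n^m,\boldsymbol\varphi_p^m,\boldsymbol\varphi^D$; $n_{\alpha,\sigma}^D$ for $\mathbf n_\alpha^m$; combinations inherit the corresponding combination). $D_{K,\sigma}\mathbf u=u_L-u_K$ if $\sigma=K|L$, $u_\sigma^D-u_K$ if $\sigma\in\mathcal E^D$, $0$ otherwise; $D_\sigma\mathbf u=|D_{K,\sigma}\mathbf u|$. **Scheme.** Unknowns $\varphi_{n,K}^m,\varphi_{p,K}^m,\psi_K^m$ ($K\in\mathcal T$), $\varphi_{a,K}^m$ ($K\in\mathcal T_{\mathrm{intr}}$). Densities: $n_{\alpha,K}^m=\mathcal F_\alpha(z_\alpha(\varphi_{\alpha,K}^m-\psi_K^m))$ ($\alpha\in\{n,p,a\}$); $n_{\alpha,K}^D=\mathcal F_\alpha(z_\alpha(\varphi_K^D-\psi_K^D))$, $n_{\alpha,\sigma}^D=\mathcal F_\alpha(z_\alpha(\varphi_\sigma^D-\psi_\sigma^D))$ ($\alpha\in\{n,p\}$). For $m\ge1$: $$\nu z_\alpha m_K\frac{n_{\alpha,K}^m-n_{\alpha,K}^{m-1}}{\tau^m}+\sum_{\sigma\in\mathcal E_K}J_{\alpha,K,\sigma}^m=z_\alpha m_K(\gamma G_K-R(n_{n,K}^m,n_{p,K}^m)),\quad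 K\in\mathcal T,\ \alpha\in\{n,p\},$$ $$z_am_K\frac{n_{a,K}^m-n_{a,K}^{m-1}}{\tau^m}+\sum_{\sigma\in\mathcal E_K}J_{a,K,\sigma}^m=0,\quad K\in\mathcal T_{\mathrm{intr}},$$ and for $m\ge0$: $-\lambda^2\sum_{\sigma\in\mathcal E_K}\tau_\sigma D_{K,\sigma}\boldsymbol\psi^m=\delta m_K(z_nn_{n,K}^m+z_pn_{p,K}^m+C_K)$ if $K\in\mathcal T\setminus\mathcal T_{\mathrm{intr}}$, with the additional term $m_Kz_an_{a,K}^m$ on the right if $K\in\mathcal T_{\mathrm{intr}}$. Here $R(n_n,n_p)=r(n_n,n_p)n_nn_p(1-\exp(\varphi_n-\varphi_p))$ evaluated cellwise, with $r(n_n,n_p)=r_0+\frac1{\tau_p(n_n+n_{n,\tau})+\tau_n(n_p+n_{p,\tau})}$, $r_0\ge0$ and $\tau_n,\tau_p,n_{n,\tau},n_{p,\tau}>0$ constants. Fluxes: with $B(x)=x/(e^x-1)$, $B(0)=1$, and $Q_{\alpha,K,\sigma}^m=D_{K,\sigma}(z_\alpha\boldsymbol\varphi_\alpha^m-\log\mathbf n_\alpha^m)$, for $\alpha\in\{n,p\}$: $J_{\alpha,K,\sigma}^m=-z_\alpha\tau_\sigma\bigl(B(-Q_{\alpha,K,\sigma}^m)n_{\alpha,L}^m-B(Q_{\alpha,K,\sigma}^m)n_{\alpha,K}^m\bigr)$ if $\sigma=K|L$, the same with $n_{\alpha,L}^m$ replaced by $n_{\alpha,\sigma}^D$ if $\sigma\in\mathcal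 E^D$, and $0$ otherwise; for $\alpha=a$ the first formula if $\sigma=K|L\in\mathcal E_{\mathrm{intr}}^{\mathrm{int}}$ and $0$ otherwise. **Interface densities.** $\overline n_{\alpha,\sigma}^m=\dfrac{B(-Q_{\alpha,K,\sigma}^m)n_{\alpha,L}^m-B(Q_{\alpha,K,\sigma}^m)n_{\alpha,K}^m}{z_\alpha(\varphi_{\alpha,L}^m-\varphi_{\alpha,K}^m)}$ for $\sigma=K|L$ (interior faces if $\alpha\in\{n,p\}$; $\sigma\in\mathcal E_{\mathrm{intr}}^{\mathrm{int}}$ if $\alpha=a$), and with $n_{\alpha,L}^m,\varphi_{\alpha,L}^m$ replaced by $n_{\alpha,\sigma}^D,\varphi_\sigma^D$ for $\sigma\in\mathcal E^D$, $\alpha\in\{n,p\}$ (by continuous extension when the denominator vanishes). Thus $J_{\alpha,K,\sigma}^m=-\tau_\sigma z_\alpha^2\overline n_{\alpha,\sigma}^mD_{K,\sigma}\boldsymbol\varphi_\alpha^m$. Faces in $\mathcal E^N$ contribute $0$ to the sums in $\mathbb E_{\mathcal T}^m$, $\mathbb D_{\mathcal T}^m$. *)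

(* Defs.v *)
From HB Require Import structures.
From mathcomp Require Import all_boot all_order all_algebra.
From mathcomp Require Import all_classical all_reals all_analysis.
Set Implicit Arguments. Unset Strict Implicit. Unset Printing Implicit Defensive.
Import Order.TTheory GRing.Theory Num.Theory.
Import numFieldNormedType.Exports.
Local Open Scope classical_set_scope.
Local Open Scope ring_scope.

(* The sigma-algebra on 'rV[R]_n generated by the coordinates, that is, the
   Borel sigma-algebra; the measure is the iterated product of the
   one-dimensional one, R^0 being a point of mass 1 (so that the surface
   measure below is the counting measure when the space is R^1). *)
Definition rV_display : measure_display.
Proof. exact: default_measure_display. Qed.

Section rV_measurable.
Variables (R : realType) (n : nat).

Definition coordinate (i : 'I_n) (v : 'rV[R]_n) : measurableTypeR R := v ord0 i.

Let rV_set0 : g_sigma_preimage coordinate set0.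
Proof. exact: sigma_algebra0. Qed.

Let rV_setC A : g_sigma_preimage coordinate A -> g_sigma_preimage coordinate (~` A).
Proof. exact: sigma_algebraC. Qed.

Let rV_bigcup (F : _^nat) : (forall i, g_sigma_preimage coordinate (F i)) ->
  g_sigma_preimage coordinate (\bigcup_i (F i)).
Proof. exact: sigma_algebra_bigcup. Qed.

HB.instance Definition _ := @isMeasurable.Build rV_display
  'rV[R]_n (g_sigma_preimage coordinate) rV_set0 rV_setC rV_bigcup.

Lemma measurable_coordinate i : measurable_fun [set: 'rV[R]_n] (coordinate i).
Proof.
move=> _ Y mY; rewrite setTI; apply: sub_sigma_algebra => /=.
rewrite -bigcup_seq/=; exists i => /=; first by rewrite mem_index_enum.
by exists Y => //; rewrite setTI.
Qed.

End rV_measurable.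

Lemma measurable_fun_coordinate (R : realType) n d (T : measurableType d) (f : T -> 'rV[R]_n) :
  (forall i, measurable_fun [set: T] (coordinate i \o f)) ->
  measurable_fun [set: T] f.
Proof.
move=> mf; suff : g_sigma_preimage (fun i => coordinate i \o f) `<=` measurable.
  by rewrite g_sigma_preimage_comp => h _ A mA; apply: h; exists A.
apply: smallest_sub; first exact: sigma_algebra_measurable.
case: n => [|m] in f mf *; first by rewrite big_ord0.
rewrite -bigcup_mkord_ord; apply: bigcup_sub => i Ii.
by move=> A [B mB <-]; exact: mf.
Qed.



Section rV_cons.
Variables (R : realType) (n : nat).

Definition rVcons (p : measurableTypeR R * 'rV[R]_n) : 'rV[R]_n.+1 :=
  \row_i (if unlift ord0 i is Some j then p.2 ord0 j else p.1).

Lemma measurable_rVcons : measurable_fun setT rVcons.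
Proof.
apply: measurable_fun_coordinate => i.
case: (unliftP ord0 i) => [j|] ->.
  rewrite (_ : _ \o _ = coordinate j \o snd); last first.
    by apply/funext => p; rewrite /coordinate /= mxE liftK.
  by apply: measurableT_comp => //; exact: measurable_coordinate.
rewrite (_ : _ \o _ = fst) //.
by apply/funext => p; rewrite /coordinate /= mxE unlift_none.
Qed.

Definition rVuncons (v : 'rV[R]_n.+1) : measurableTypeR R * 'rV[R]_n :=
  (v ord0 ord0, \row_j v ord0 (lift ord0 j)).

Lemma measurable_rVuncons : measurable_fun setT rVuncons.
Proof.
apply: measurable_fun_pair; first exact: (measurable_coordinate ord0).
apply: measurable_fun_coordinate => i.
rewrite (_ : _ \o _ = coordinate (lift ord0 i)).
  exact: measurable_coordinate.
by apply/funext => v; rewrite /coordinate /= mxE.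
Qed.

Lemma rVconsK : cancel rVcons rVuncons.
Proof.
move=> [x v]; rewrite /rVuncons /rVcons /= mxE unlift_none; congr pair.
by apply/rowP => j; rewrite !mxE liftK.
Qed.

Variable mu : {sigma_finite_measure set 'rV[R]_n -> \bar R}.


Definition lebesgue_step : set 'rV[R]_n.+1 -> \bar R :=
  pushforward (product_measure1 lebesgue_measure mu) rVcons.

HB.instance Definition _ := Measure.copy lebesgue_step
  (measure_function_pushforward__canonical__measure_function_Measure
    (product_measure1 lebesgue_measure mu) measurable_rVcons).

Let lebesgue_step_sigma_finite : sigma_finite setT lebesgue_step.
Proof.
have /sigma_finiteP[F' [F'T ndF F'oo]] := sigma_finiteT (@lebesgue_measure R).
have /sigma_finiteP[G [GT ndG Goo]] := sigma_finiteT mu.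
exists (fun k => rVuncons @^-1` (F' k `*` G k)).
  rewrite -preimage_bigcup (_ : \bigcup_i _ = setT) ?preimage_setT//.
  rewrite -subTset => -[x v] _.
  have : [set: measurableTypeR R] x by []; rewrite F'T => -[i _ Fix].
  have : [set: 'rV[R]_n] v by []; rewrite GT => -[j _ Gjv].
  exists (maxn i j) => //; split.
  - by move: Fix; exact/subsetPset/ndF/leq_maxl.
  - by move: Gjv; exact/subsetPset/ndG/leq_maxr.
move=> k; have [mF Fk] := F'oo k; have [mG Gk] := Goo k.
have mFG : measurable (F' k `*` G k) by exact: measurableX.
split; first by rewrite -[X in measurable X]setTI; exact: measurable_rVuncons.
rewrite /lebesgue_step /pushforward -comp_preimage.
rewrite (_ : _ \o _ = id); last by apply/funext => p /=; rewrite rVconsK.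
by rewrite preimage_id product_measure1E// lte_mul_pinfty// ge0_fin_numE.
Qed.

HB.instance Definition _ := @Measure_isSigmaFinite.Build _ _ _ lebesgue_step
  lebesgue_step_sigma_finite.

End rV_cons.

Fixpoint lebesgue_rV (R : realType) (n : nat) :
    {sigma_finite_measure set 'rV[R]_n -> \bar R} :=
  match n with
  | 0 => \d_(0 : 'rV[R]_0)
  | m.+1 => lebesgue_step (lebesgue_rV R m)
  end.

Section box.
Variable R : realType.

Lemma measurable_box n (I : 'I_n -> set (measurableTypeR R)) :
  (forall i, measurable (I i)) ->
  measurable [set v : 'rV[R]_n | forall i, I i (v ord0 i)].
Proof.
move=> mI; rewrite (_ : [set _ | _] =
    \big[setI/setT]_(i < n) (coordinate i @^-1` I i)); last first.
  rewrite -bigcap_seq.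
  by apply/seteqP; split => v vI i; [move=> _|]; apply: vI; rewrite /= mem_index_enum.
apply: bigsetI_measurable => i _.
by rewrite -[X in measurable X]setTI; exact: measurable_coordinate.
Qed.

Lemma lebesgue_rV_box n (I : 'I_n -> set (measurableTypeR R)) :
  (forall i, measurable (I i)) ->
  lebesgue_rV R n [set v | forall i, I i (v ord0 i)] =
    (\prod_(i < n) lebesgue_measure (I i))%E.
Proof.
elim: n I => [|n IHn] I mI.
  by rewrite big_ord0 /= diracE mem_set// => -[].
rewrite big_ord_recl -IHn//= /lebesgue_step /pushforward.
have mB := measurable_box (fun i => mI (lift ord0 i)).
rewrite -product_measure1E//.
congr (product_measure1 _ _ _); apply/seteqP; split => -[x v] /=.
  move=> xv; split; first by have := xv ord0; rewrite mxE unlift_none.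
  by move=> i; have := xv (lift ord0 i); rewrite mxE liftK.
move=> [Ix Iv] i; rewrite mxE; case: (unliftP ord0 i) => [j ->|->] //.
Qed.

End box.

Section euclidean.
Variables (R : realType) (d : nat).
Implicit Types (x y : 'rV[R]_d) (S : set 'rV[R]_d).

Definition dot x y : R := \sum_i x ord0 i * y ord0 i.

(* the norm `|x| of the library on 'rV[R]_d is the sup norm *)
Definition enorm x : R := Num.sqrt (dot x x).

Definition diam S : R := sup [set enorm (x - y) | x in S & y in S].

Definition dist_to x S : R := inf [set enorm (x - y) | y in S].

Definition boundary S : set 'rV[R]_d := closure S `\` S°.

(* open convex polyhedra are the finite intersections of open half-spaces *)
Definition open_convex_polyhedron S : Prop :=
  exists (k : nat) (a : 'I_k -> 'rV[R]_d) (b : 'I_k -> R),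
    S = [set x | forall i, dot (a i) x < b i].

End euclidean.

(* A hyperplane of R^(n+1) is given by a point o and an orthonormal basis of
   its direction, the rows of Q; [chart o Q] is then an isometry from R^n onto
   it, along which the n-dimensional Lebesgue measure is transported. *)
Section surface_measure.
Variables (R : realType) (n : nat).
Implicit Types (o : 'rV[R]_n.+1) (Q : 'M[R]_(n, n.+1)) (S : set 'rV[R]_n.+1).

Definition orthonormal_rows Q : Prop := Q *m Q^T = 1%:M.

Definition chart o Q (v : 'rV[R]_n) : 'rV[R]_n.+1 := o + v *m Q.

Definition surface_measure o Q S : \bar R :=
  lebesgue_rV R n (chart o Q @^-1` S).

(* Only used for subsets of finite unions of hyperplanes, for which it means
   that the n-dimensional measure vanishes. *)
Definition surface_null S : Prop :=
  forall o Q, orthonormal_rows Q -> surface_measure o Q S = 0%E.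

End surface_measure.

Section function_spaces.
Variables (R : realType) (d : nat).
Let mu := lebesgue_rV R d.
Implicit Types (D : set 'rV[R]_d) (f phi : 'rV[R]_d -> R)
  (g : 'rV[R]_d -> 'rV[R]_d).

Definition Linf_norm D f : \bar R :=
  ('N[mu]_+oo [EFin \o patch (fun=> 0%R) D f])%E.

Definition Linf D f : Prop := measurable_fun D f /\ (Linf_norm D f < +oo)%E.

Definition basis_rV (i : 'I_d) : 'rV[R]_d := delta_mx ord0 i.

Definition iterated_partial f (s : seq 'I_d) : 'rV[R]_d -> R :=
  foldr (fun i h => 'D_(basis_rV i) h) f s.

Definition smooth f : Prop := forall s : seq 'I_d,
  continuous (iterated_partial f s) /\
  forall x i, derivable (iterated_partial f s) x (basis_rV i).

Definition support_of f : set 'rV[R]_d := closure [set x | f x != 0].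

Definition test_function D phi : Prop :=
  [/\ smooth phi, compact (support_of phi) & support_of phi `<=` D].

Definition weak_gradient D f g : Prop :=
  forall (i : 'I_d) phi, test_function D phi ->
    \int[mu]_(x in D) (f x * 'D_(basis_rV i) phi x) =
    - \int[mu]_(x in D) (g x ord0 i * phi x).

(* An element of W^(1,oo)(D), through its representative that is continuous
   up to the boundary; its values on boundary faces are the traces. *)
Record W1inf D := {
  wfun :> 'rV[R]_d -> R;
  wgrad : 'rV[R]_d -> 'rV[R]_d;
  wfun_continuous : {within closure D, continuous wfun};
  wfun_Linf : Linf D wfun;
  wgrad_measurable : forall i, measurable_fun D (fun x => wgrad x ord0 i);
  wgrad_bounded : (Linf_norm D (fun x => enorm (wgrad x)) < +oo)%E;
  wgradP : weak_gradient D wfun wgrad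
}.

Definition W1inf_norm D (w : W1inf D) : \bar R :=
  maxe (Linf_norm D w) (Linf_norm D (fun x => enorm (wgrad w x))).

End function_spaces.

Definition pos_axis (R : realType) : set R := `]0, +oo[%classic.
Definition open_unit (R : realType) : set R := `]0, 1[%classic.

Section statistics_functions.
Variable R : realType.

(* A C^1-diffeomorphism [stat] from R onto the interval [I] with
   0 < stat' <= stat <= exp, its inverse and an antiderivative of the inverse. *)
Record statistics (I : set R) := {
  stat :> R -> R;
  stat_inv : R -> R;
  stat_antider : R -> R;
  stat_range : forall x, I (stat x);
  statK : cancel stat stat_inv;
  stat_invK : forall y, I y -> stat (stat_inv y) = y;
  stat_derivable : forall x : R, derivable stat x 1;
  stat_derive_continuous : continuous (derive1 stat : R -> R);
  stat_inv_derivable : forall y, I y -> derivable stat_inv y 1;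
  stat_inv_derive_continuous : forall y, I y -> {for y, continuous (derive1 stat_inv : R -> R)};
  stat_derive_gt0 : forall x : R, 0 < derive1 stat x;
  stat_derive_le : forall x : R, derive1 stat x <= stat x;
  stat_le_exp : forall x, stat x <= expR x;
  stat_antiderP : forall y, I y -> is_derive y (1 : R) stat_antider (stat_inv y)
}.

Definition rel_entropy I (F : statistics I) (x y : R) : R :=
  stat_antider F x - stat_antider F y - derive1 (stat_antider F) y * (x - y).

(* For y0 = 0 the convention rel_entropy x 0 = +oo makes the condition void. *)
Definition superlinear_entropy I (F : statistics I) : Prop :=
  forall y0, 0 < y0 ->
    rel_entropy F x y0 / stat_inv F x @[x --> +oo] --> +oo.

Definition normalized_antider I (F : statistics I) : Prop :=
  (forall y, I y -> 0 <= stat_antider F y) /\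
  exists! y, I y /\ stat_antider F y = 0.

Definition bernoulli (x : R) : R := if x == 0 then 1 else x / (expR x - 1).

End statistics_functions.

Inductive carrier := electron | hole.

Definition charge_number (R : realType) (al : carrier) : R :=
  if al is electron then -1 else 1.

Record params (R : realType) := {
  lambda : R; nu : R; delta : R; gamma : R;
  z_a : R;
  r0 : R; tau_n : R; tau_p : R; n_ntau : R; n_ptau : R;
  lambda_gt0 : 0 < lambda; nu_gt0 : 0 < nu;
  delta_gt0 : 0 < delta; gamma_gt0 : 0 < gamma;
  z_a_gt0 : 0 < z_a;
  r0_ge0 : 0 <= r0;
  tau_n_gt0 : 0 < tau_n; tau_p_gt0 : 0 < tau_p;
  n_ntau_gt0 : 0 < n_ntau; n_ptau_gt0 : 0 < n_ptau
}.

Record timegrid (R : realType) := {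
  nsteps : nat;
  final_time : R;
  time : nat -> R;
  time0 : time 0%N = 0;
  time_lt : forall m, (m < nsteps)%N -> time m < time m.+1;
  time_end : time nsteps = final_time
}.

(* The space dimension is n.+1. *)
Record device (R : realType) (n : nat) := {
  Omega : set 'rV[R]_n.+1;
  Omega_intr : set 'rV[R]_n.+1;
  Omega_HTL : set 'rV[R]_n.+1;
  Omega_ETL : set 'rV[R]_n.+1;
  contact1 : set 'rV[R]_n.+1;
  contact2 : set 'rV[R]_n.+1;
  Gamma_N : set 'rV[R]_n.+1;
  Gamma_D := contact1 `|` contact2;
  Omega_open : open Omega;
  Omega_connected : connected Omega;
  Omega_bounded : bounded_set Omega;
  intr_open : open Omega_intr;
  HTL_open : open Omega_HTL;
  ETL_open : open Omega_ETL;
  intr_HTL : Omega_intr `&` Omega_HTL = set0;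
  intr_ETL : Omega_intr `&` Omega_ETL = set0;
  HTL_ETL : Omega_HTL `&` Omega_ETL = set0;
  layers_sub : Omega_intr `|` Omega_HTL `|` Omega_ETL `<=` Omega;
  layers_cover :
    closure Omega = closure Omega_intr `|` closure Omega_HTL `|` closure Omega_ETL;
  HTL_ETL_apart : boundary Omega_HTL `&` boundary Omega_ETL = set0;
  contact1_neq0 : contact1 !=set0;
  contact2_neq0 : contact2 !=set0;
  contacts_disjoint : contact1 `&` contact2 = set0;
  boundary_split : boundary Omega = Gamma_D `|` Gamma_N;
  boundary_split_null : surface_null (Gamma_D `&` Gamma_N);
  Gamma_D_intr : Gamma_D `&` closure Omega_intr = set0
}.

(* Each face carries an orientation: [own s] is a cell having s as a face and
   [opp s] is the cell on the other side, if any; the orientation is arbitrary.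
   Thus s = K|L when {own s, opp s} = {K, L}, and the faces of K are the s with
   K in {own s, opp s}.  [origin] and [frame] describe the hyperplane
   spanned by the face. *)
Record mesh (R : realType) (n : nat) (V : device R n) := {
  cell : finType;
  face : finType;
  cset : cell -> set 'rV[R]_n.+1;
  fset : face -> set 'rV[R]_n.+1;
  own : face -> cell;
  opp : face -> option cell;
  center : cell -> 'rV[R]_n.+1;
  intr_cells : {set cell};
  origin : face -> 'rV[R]_n.+1;
  frame : face -> 'M[R]_(n, n.+1);
  is_face_of (s : face) (K : cell) := (own s == K) || (opp s == Some K);
  cset_neq0 : forall K, cset K !=set0;
  cset_polyhedron : forall K, open_convex_polyhedron (cset K);
  cset_sub : forall K, cset K `<=` Omega V;
  cset_disjoint : forall K L, K != L -> cset K `&` cset L = set0;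
  cset_cover : closure (Omega V) = \bigcup_K closure (cset K);
  intr_cover : closure (Omega_intr V) =
    \bigcup_(K in [set K | K \in intr_cells]) closure (cset K);
  fset_inj : injective fset;
  fset_closed : forall s, closed (fset s);
  fset_sub : forall s, fset s `<=` closure (Omega V);
  frame_orthonormal : forall s, orthonormal_rows (frame s);
  fset_hyperplane : forall s, fset s `<=` range (chart (origin s) (frame s));
  fset_measure_gt0 :
    forall s, (0 < surface_measure (origin s) (frame s) (fset s))%E;
  cset_boundary : forall K,
    boundary (cset K) = \bigcup_(s in [set s | is_face_of s K]) fset s;
  cset_common : forall K L, K != L ->
    let S := boundary (cset K) `&` boundary (cset L) in
    surface_null S \/
    exists s, [/\ is_face_of s K, is_face_of s L & fset s = S];
  opp_some : forall s L, opp s = Some L ->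
    [/\ own s != L,
        fset s = boundary (cset (own s)) `&` boundary (cset L) &
        ~ fset s `<=` boundary (Omega V)];
  opp_none : forall s, opp s = None -> fset s `<=` boundary (Omega V);
  center_in : forall K, cset K (center K);
  center_orthogonal : forall s L, opp s = Some L ->
    forall x y, fset s x -> fset s y ->
    dot (center L - center (own s)) (x - y) = 0;
  Gamma_D_faces : Gamma_D V = \bigcup_(s in [set s | fset s `<=` Gamma_D V]) fset s;
  Gamma_N_faces : Gamma_N V = \bigcup_(s in [set s | fset s `<=` Gamma_N V]) fset s;
  boundary_faces_overlap : forall s t, s != t ->
    (fset s `<=` Gamma_D V /\ fset t `<=` Gamma_D V) \/
    (fset s `<=` Gamma_N V /\ fset t `<=` Gamma_N V) ->
    surface_null (fset s `&` fset t)
}.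

Section mesh_quantities.
Variables (R : realType) (n : nat) (V : device R n) (M : mesh V).
Implicit Types (K L : cell M) (s : face M).

Definition m_cell K : R := fine (lebesgue_rV R n.+1 (cset K)).

Definition m_face s : R := fine (surface_measure (origin s) (frame s) (fset s)).

Definition d_face s : R :=
  if opp s is Some L then enorm (center L - center (own s))
  else dist_to (center (own s)) (range (chart (origin s) (frame s))).

Definition tau_face s : R := m_face s / d_face s.

Definition regular_mesh (xi : R) : Prop :=
  (forall K s, is_face_of s K -> xi * diam (cset K) <= d_face s) /\
  (forall K, xi * (\sum_(s | is_face_of s K) m_face s * d_face s) <= m_cell K).

Definition dirichlet_face s : bool := `[< fset s `<=` Gamma_D V >].

Definition interior_intr_face s : bool :=
  `[< fset s `<=` closure (Omega_intr V) /\
      ~ fset s `<=` boundary (Omega_intr V) >].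

Definition cell_average (f : 'rV[R]_n.+1 -> R) K : R :=
  (\int[lebesgue_rV R n.+1]_(x in cset K) f x) / m_cell K.

Definition face_average (f : 'rV[R]_n.+1 -> R) s : R :=
  (\int[lebesgue_rV R n]_(v in chart (origin s) (frame s) @^-1` fset s)
     f (chart (origin s) (frame s) v)) / m_face s.

(* A vector of cell values together with its values on the Dirichlet faces
   (those on other faces are never used). *)
Record gridfun := { at_cell : cell M -> R; at_face : face M -> R }.

Implicit Types u v : gridfun.

Definition neighbour K s : option (cell M) :=
  if own s == K then opp s else Some (own s).

(* the value of u on the other side of s, seen from K *)
Definition across u K s : R :=
  if neighbour K s is Some L then at_cell u L else at_face u s.

Definition jump u K s : R :=
  if (opp s != None) || dirichlet_face s then across u K s - at_cell u K else 0.

Definition abs_jump u s : R := `|jump u (own s) s|.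

Definition grid_sub u v : gridfun :=
  {| at_cell := fun K => at_cell u K - at_cell v K;
     at_face := fun s => at_face u s - at_face v s |}.

Definition zphi_sub_ln (z : R) (phi dens : gridfun) : gridfun :=
  {| at_cell := fun K => z * at_cell phi K - ln (at_cell dens K);
     at_face := fun s => z * at_face phi s - ln (at_face dens s) |}.

Definition Sch_Gum_flux (z : R) (phi dens : gridfun) K s : R :=
  let q := jump (zphi_sub_ln z phi dens) K s in
  - z * tau_face s *
    (bernoulli (- q) * across dens K s - bernoulli q * at_cell dens K).

(* The interface density as a function of w = z * (phi_L - phi_K), where
   Q = w - (log n_L - log n_K), extended by continuity to w = 0. *)
Definition interface_density (z : R) (phi dens : gridfun) s : R :=
  let K := own s in
  let nK := at_cell dens K in
  let nL := across dens K s in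
  let nbar w :=
    let q := w - (ln nL - ln nK) in
    (bernoulli (- q) * nL - bernoulli q * nK) / w in
  let w := z * (across phi K s - at_cell phi K) in
  if w == 0 then lim (nbar x @[x --> 0^']) else nbar w.

End mesh_quantities.

Record problem_data (R : realType) (n : nat) (V : device R n) := {
  doping : 'rV[R]_n.+1 -> R;
  photogen : 'rV[R]_n.+1 -> R;
  psiD : W1inf (Omega V);
  phiD : W1inf (Omega V);
  phi0 : carrier -> 'rV[R]_n.+1 -> R;
  phi0_a : 'rV[R]_n.+1 -> R;
  doping_Linf : Linf (Omega V) doping;
  photogen_Linf : Linf (Omega V) photogen;
  photogen_ge0 :
    {ae lebesgue_rV R n.+1, forall x, Omega V x -> 0 <= photogen x};
  phi0_Linf : forall al, Linf (Omega V) (phi0 al);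
  phi0_a_Linf : Linf (Omega_intr V) phi0_a
}.

Section scheme.
Variables (R : realType) (F : carrier -> statistics (@pos_axis R))
  (Fa : statistics (@open_unit R)) (n : nat) (V : device R n)
  (M : mesh V) (T : timegrid R) (P : params R) (A : problem_data V).
Implicit Types (m : nat) (al : carrier) (K : cell M) (s : face M).

Local Notation z := (charge_number R).

(* [phi_a] only matters on the cells of the intrinsic layer. *)
Record unknowns := {
  phi : nat -> carrier -> cell M -> R;
  phi_a : nat -> cell M -> R;
  psi : nat -> cell M -> R
}.

Definition timestep m : R := time T m - time T m.-1.

Definition psiD_grid : gridfun M :=
  {| at_cell := cell_average (psiD A); at_face := face_average (psiD A) |}.

Definition phiD_grid : gridfun M :=
  {| at_cell := cell_average (phiD A); at_face := face_average (phiD A) |}.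

Definition densD_grid al : gridfun M :=
  {| at_cell := fun K => F al (z al * (at_cell phiD_grid K - at_cell psiD_grid K));
     at_face := fun s => F al (z al * (at_face phiD_grid s - at_face psiD_grid s)) |}.

Variable U : unknowns.

Definition psi_grid m : gridfun M :=
  {| at_cell := psi U m; at_face := at_face psiD_grid |}.

Definition phi_grid m al : gridfun M :=
  {| at_cell := phi U m al; at_face := at_face phiD_grid |}.

Definition dens_grid m al : gridfun M :=
  {| at_cell := fun K => F al (z al * (phi U m al K - psi U m K));
     at_face := at_face (densD_grid al) |}.

(* The face values are dummies: vacancies have no Dirichlet condition. *)
Definition phi_a_grid m : gridfun M :=
  {| at_cell := phi_a U m; at_face := fun=> 0 |}.

Definition dens_a_grid m : gridfun M :=
  {| at_cell := fun K => Fa (z_a P * (phi_a U m K - psi U m K));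
     at_face := fun=> 0 |}.

Definition dens m al K : R := at_cell (dens_grid m al) K.

Definition dens_a m K : R := at_cell (dens_a_grid m) K.

Definition recombination m K : R :=
  let nn := dens m electron K in
  let np := dens m hole K in
  (r0 P + 1 / (tau_p P * (nn + n_ntau P) + tau_n P * (np + n_ptau P)))
    * nn * np * (1 - expR (phi U m electron K - phi U m hole K)).

Definition flux m al K s : R :=
  if (opp s != None) || dirichlet_face s
  then Sch_Gum_flux (z al) (phi_grid m al) (dens_grid m al) K s else 0.

Definition flux_a m K s : R :=
  if interior_intr_face s
  then Sch_Gum_flux (z_a P) (phi_a_grid m) (dens_a_grid m) K s else 0.

Definition continuity_eq m al K : Prop :=
  nu P * z al * m_cell K * ((dens m al K - dens m.-1 al K) / timestep m)
    + \sum_(s | is_face_of s K) flux m al K s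
  = z al * m_cell K *
    (gamma P * cell_average (photogen A) K - recombination m K).

Definition continuity_a_eq m K : Prop :=
  z_a P * m_cell K * ((dens_a m K - dens_a m.-1 K) / timestep m)
    + \sum_(s | is_face_of s K) flux_a m K s = 0.

Definition poisson_eq m K : Prop :=
  - lambda P ^+ 2 *
    (\sum_(s | is_face_of s K) tau_face s * jump (psi_grid m) K s)
  = delta P * m_cell K *
      ((\sum_(al <- [:: electron; hole]) z al * dens m al K)
        + cell_average (doping A) K)
    + (if K \in intr_cells M then m_cell K * z_a P * dens_a m K else 0).

Definition scheme_solution : Prop :=
  [/\ (forall al K, phi U 0 al K = cell_average (phi0 A al) K),
      (forall K, K \in intr_cells M -> phi_a U 0 K = cell_average (phi0_a A) K),
      (forall m al K, (0 < m <= nsteps T)%N -> continuity_eq m al K),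
      (forall m K, (0 < m <= nsteps T)%N -> K \in intr_cells M ->
         continuity_a_eq m K) &
      (forall m K, (m <= nsteps T)%N -> poisson_eq m K)].

Definition energy m : R :=
  lambda P ^+ 2 / 2 *
    (\sum_s tau_face s * abs_jump (grid_sub (psi_grid m) psiD_grid) s ^+ 2)
  + \sum_(K in intr_cells M) m_cell K * stat_antider Fa (dens_a m K)
  + delta P * (\sum_(al <- [:: electron; hole]) \sum_K
      m_cell K * rel_entropy (F al) (dens m al K) (at_cell (densD_grid al) K)).

Definition dissipation m : R :=
  z_a P ^+ 2 / 2 * (\sum_(s | interior_intr_face s)
    tau_face s * interface_density (z_a P) (phi_a_grid m) (dens_a_grid m) s
      * abs_jump (phi_a_grid m) s ^+ 2)
  + delta P / (2 * nu P) * (\sum_(al <- [:: electron; hole]) \sum_s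
      tau_face s * interface_density (z al) (phi_grid m al) (dens_grid m al) s
        * abs_jump (phi_grid m al) s ^+ 2)
  + delta P / nu P * (\sum_K
      m_cell K * recombination m K * (phi U m hole K - phi U m electron K)).

End scheme.

(* Main.v *)
Require Import Defs.
From mathcomp Require Import all_boot all_order all_algebra.
From mathcomp Require Import all_classical all_reals all_analysis.
From mathcomp Require Import measurable_realfun ess_sup_inf ring lra.
Set Implicit Arguments.
Unset Strict Implicit.
Unset Printing Implicit Defensive.
Import Order.TTheory GRing.Theory Num.Theory.
Import numFieldNormedType.Exports.
Local Open Scope classical_set_scope.
Local Open Scope ring_scope.

(** The increment of the energy in one time step is bounded by convexity: the
  square of the gradient of the potential, the function [stat_antider Fa] and
  the relative entropies all lie above their tangents at the new time, and the
  Poisson equation at two consecutive times turns the electrostatic part into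
  charges times psi - psi^D (lemma [energy_diff]).  The potential psi cancels, and
  what remains are increments of densities tested with phi_a - psi^D and
  phi - phi^D.  The continuity equations and summation by parts replace them by
  fluxes times jumps, and Young's inequality on each face ([face_inequality])
  yields the flux part of the dissipation.  The recombination terms are those of
  the dissipation.  There remain only ([discrete_energy_inequality]) the squares of
  the jumps of psi^D and phi^D, weighted by densities, and photogeneration times
  phi_p - phi_n.  They vanish when G, grad psi^D and grad phi^D do.

  Three facts bound the remainder.
  - The interface density is at most the larger of the densities a and b on both
    sides of the face, since it equals a B(q) / B(w) = b B(-q) / B(-w) with B
    nonincreasing and q = w - ln (b / a) ([Sch_Gum_bounds]); vacancy densities are
    at most 1.
  - A function of W^(1,oo) is Lipschitz on each convex cell, so that its jump
    across a face is at most a multiple of d_face / xi ([W1inf_jump]), and the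
    volumes m_face * d_face sum up to at most |Omega| / xi.
  - The densities and, because phi_p - phi_n is the sum of the values of the
    inverse statistics, the photogeneration term are sublinear in the relative
    entropies, uniformly with respect to bounded boundary densities
    ([entropy_dominates]); so they are absorbed by eps times the energy.

  The Lipschitz continuity is derived from the weak gradient with explicit test
  functions ([weak_lipschitz_dir]): products of narrow smooth bumps in all
  coordinates but one, and of a smooth plateau in the remaining one.  The
  derivative of such a product is the difference of two bumps, so that its
  integral against the function is nearly a difference of two values. *)

(** * Lebesgue measure on row vectors *)

Section rV_borel.
Variable R : realType.

Lemma ball_rVP n (x y : 'rV[R]_n) (e : R) : 0 < e ->
  ball x e y <-> forall i, `|x ord0 i - y ord0 i| < e.
Proof.
move=> e0; split=> [[_ xy] i|xy]; first exact: xy.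
by split => // i j; rewrite (ord1 i); exact: xy.
Qed.

Lemma nbhs_rVP n (x : 'rV[R]_n) (A : set 'rV[R]_n) :
  nbhs x A <-> exists2 e : R, 0 < e &
    forall y : 'rV[R]_n, (forall i, `|x ord0 i - y ord0 i| < e) -> A y.
Proof.
split=> [/nbhs_ballP[e /= e0 xA]|[e e0 xA]].
  by exists e => // y xy; apply/xA/ball_rVP.
by apply/nbhs_ballP; exists e => //= y /(ball_rVP _ _ e0); exact: xA.
Qed.

Lemma measurable_cube n (x : 'rV[R]_n) (e : R) :
  measurable [set y : 'rV[R]_n | forall i, `|x ord0 i - y ord0 i| < e].
Proof.
pose I i : set (measurableTypeR R) := [set` `](x ord0 i - e), (x ord0 i + e)[%R].
rewrite (_ : [set _ | _] = [set y : 'rV[R]_n | forall i, I i (y ord0 i)]).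
  by apply: measurable_box => i; exact: measurable_itv.
apply/seteqP; split => y /= + i => /(_ i); rewrite /I /= in_itv /= ltr_norml; lra.
Qed.

(** Cubes with rational centres and inverse integer radii form a countable base. *)
Lemma open_measurable_rV n (A : set 'rV[R]_n) : open A -> measurable A.
Proof.
move=> oA.
pose rr (r : rat) : R := ratr r.
pose cube (q : 'rV[rat]_n * nat) : set 'rV[R]_n :=
  [set y | forall i, `|rr (q.1 ord0 i) - y ord0 i| < q.2.+1%:R^-1].
rewrite (_ : A = \bigcup_(q in [set q | cube q `<=` A]) cube q); last first.
  apply/seteqP; split => [x Ax|x [q /= qA qx]]; last exact: qA.
  have [e e0 xA] : exists2 e : R, 0 < e &
      forall y : 'rV[R]_n, (forall i, `|x ord0 i - y ord0 i| < e) -> A y.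
    by apply/nbhs_rVP; exact: open_nbhs_nbhs.
  have [k ke] : exists k, 2 * k.+1%:R^-1 < e :> R.
    exists (Num.trunc (2 / e)).
    by rewrite ltr_pdivrMr// mulrC -ltr_pdivrMr// truncnS_gt.
  have k0 : 0 < k.+1%:R^-1 :> R by rewrite invr_gt0.
  have /choice[q xq] : forall i, exists r : rat,
      `|rr r - x ord0 i| < k.+1%:R^-1.
    move=> i; have [|r] := @rat_in_itvoo R (x ord0 i) (x ord0 i + k.+1%:R^-1).
      by rewrite ltrDl.
    rewrite in_itv /= => /andP[xr rx]; exists r; rewrite /rr ltr_distl rx andbT.
    by rewrite (lt_trans _ xr)// ltrBlDr ltrDl.
  exists (\row_i q i, k); last by move=> i /=; rewrite mxE; exact: xq.
  move=> y /= qy; apply: xA => i.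
  have := qy i; have := xq i; rewrite mxE /= !ltr_norml => /andP[h1 h2] /andP[h3 h4].
  move: (k.+1%:R^-1) ke k0 h1 h2 h3 h4 => d ke k0 h1 h2 h3 h4. apply/andP; split; lra.
rewrite bigcup_mkcond; apply: countable_bigcupT_measurable.
  exact: countableP.
move=> q; case: ifPn => // _.
rewrite (_ : cube q = [set y | forall i,
  `|(\row_j rr (q.1 ord0 j) : 'rV[R]_n) ord0 i - y ord0 i| < q.2.+1%:R^-1]).
  exact: measurable_cube.
by apply/seteqP; split => y qy i; move: (qy i); rewrite /= mxE.
Qed.

Lemma closed_measurable_rV n (A : set 'rV[R]_n) : closed A -> measurable A.
Proof.
move=> cA; rewrite -[A]setCK; apply: measurableC; apply: open_measurable_rV.
by rewrite openC.
Qed.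

Lemma measurable_fun_within n (A : set 'rV[R]_n) (f : 'rV[R]_n -> R) :
  measurable A -> {within A, continuous f} -> measurable_fun A f.
Proof.
move=> mA cf; apply: (measurability _ (RGenOpens.measurableE R)).
move=> _ [_ [a [b ->] <-]].
have : open (f @^-1` `]a, b[ : set (subspace A)).
  by move/continuousP : cf; apply; exact: interval_open.
move=> /open_subspaceP[V oV VA].
by rewrite setIC -VA; apply: measurableI => //; exact: open_measurable_rV.
Qed.

Lemma coord_le_norm n (y : 'rV[R]_n) i : `|y ord0 i| <= `|y|.
Proof.
rewrite [leRHS]/Num.norm /= mx_normrE.
exact: (le_bigmax 0 (fun ij : 'I_1 * 'I_n => `|y ij.1 ij.2|) (ord0, i)).
Qed.

Lemma bounded_rV_box n (A : set 'rV[R]_n) : bounded_set A ->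
  exists2 r, 0 < r & A `<=` [set y | forall i, `|y ord0 i| <= r].
Proof.
move=> [r [rr Ar]]; exists (`|r| + 1); first by rewrite ltr_wpDl.
move=> y Ay i; have : `|y| <= `|r| + 1.
  by apply: Ar => //; rewrite (le_lt_trans (ler_norm r))// ltrDl.
by apply: le_trans; exact: coord_le_norm.
Qed.

Lemma lebesgue_rV_lty n (A : set 'rV[R]_n) : bounded_set A -> measurable A ->
  (lebesgue_rV R n A < +oo)%E.
Proof.
move=> /bounded_rV_box[r r0 Ar] mA.
pose I (i : 'I_n) : set (measurableTypeR R) := [set` `[-r, r]%R].
have mI i : measurable (I i) by exact: measurable_itv.
apply: (@le_lt_trans _ _ (lebesgue_rV R n [set v | forall i, I i (v ord0 i)])).
  apply: le_measure; rewrite ?inE//; first exact: measurable_box.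
  by move=> y Ay i; have := Ar _ Ay i; rewrite /I /= in_itv /= ler_norml.
rewrite lebesgue_rV_box// (eq_bigr (fun=> (r + r)%:E)); last first.
  move=> i _; rewrite /I lebesgue_measure_itv /= lte_fin gtrN// -EFinD opprK//.
by rewrite prodEFin ltry.
Qed.

Lemma lebesgue_rV_open_gt0 n (A : set 'rV[R]_n) : open A -> A !=set0 ->
  (0 < lebesgue_rV R n A)%E.
Proof.
move=> oA [x Ax].
have /nbhs_rVP[e e0 xA] : nbhs x A by exact: open_nbhs_nbhs.
pose I (i : 'I_n) : set (measurableTypeR R) :=
  [set` `](x ord0 i - e), (x ord0 i + e)[%R].
have mI i : measurable (I i) by exact: measurable_itv.
apply: (@lt_le_trans _ _ (lebesgue_rV R n [set v | forall i, I i (v ord0 i)])).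
  rewrite lebesgue_rV_box// (eq_bigr (fun=> (e + e)%:E)); last first.
    move=> i _; rewrite /I lebesgue_measure_itv /= lte_fin ifT; last by lra.
    by rewrite -EFinD; congr EFin; lra.
  by rewrite prodEFin lte_fin; apply: prodr_gt0 => i _; lra.
apply: le_measure; rewrite ?inE//.
- exact: measurable_box.
- exact: open_measurable_rV.
- move=> y Iy; apply: xA => i; have := Iy i.
  by rewrite /I /= in_itv /= => /andP[? ?]; rewrite ltr_norml; apply/andP; split; lra.
Qed.

(** Tonelli's theorem for a product of functions of one coordinate each. *)
Lemma integral_rV_prod n (f : 'I_n -> R -> R) :
  (forall i, measurable_fun setT (f i)) -> (forall i x, 0 <= f i x) ->
  (\int[lebesgue_rV R n]_x (\prod_(i < n) f i (x ord0 i))%:E =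
   \prod_(i < n) \int[lebesgue_measure]_x (f i x)%:E)%E.
Proof.
elim: n f => [|n IHn] f mf f0.
  rewrite big_ord0 /=.
  under eq_integral do rewrite big_ord0.
  rewrite integral_cst//= mul1e diracE mem_set//.
pose F (x : 'rV[R]_n.+1) : \bar R := (\prod_(i < n.+1) f i (x ord0 i))%:E.
have mF : measurable_fun [set: 'rV[R]_n.+1] F.
  apply/measurable_EFinP; apply: measurable_prod => i _.
  by apply: (measurableT_comp (mf i)); exact: measurable_coordinate.
rewrite -/F /= (@ge0_integral_pushforward _ _ _ _ R (@rVcons R n) (@measurable_rVcons R n)
  (product_measure1 lebesgue_measure (lebesgue_rV R n)) setT F)//; last first.
  by move=> x _; rewrite lee_fin; apply: prodr_ge0.
rewrite preimage_setT fubini_tonelli1; last 2 first.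
  by apply: measurableT_comp => //; exact: measurable_rVcons.
  by move=> x; rewrite lee_fin; apply: prodr_ge0.
rewrite big_ord_recl -IHn//.
have mG : measurable_fun [set: 'rV[R]_n]
    (fun y : 'rV[R]_n => (\prod_(i < n) f (lift ord0 i) (y ord0 i))%:E).
  apply/measurable_EFinP; apply: measurable_prod => i _.
  by apply: (measurableT_comp (mf _)); exact: measurable_coordinate.
rewrite -ge0_integralZr//; last 3 first.
- by apply/measurable_EFinP; exact: mf.
- by move=> x _; rewrite lee_fin.
- by apply: integral_ge0 => x _; rewrite lee_fin; apply: prodr_ge0.
apply: eq_integral => x _; rewrite /fubini_F.
rewrite -ge0_integralZl//; last 2 first.
- by move=> y _; rewrite lee_fin; apply: prodr_ge0.
- by rewrite lee_fin.
apply: eq_integral => y _; rewrite /F /= big_ord_recl !mxE unlift_none EFinM.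
by congr (_ * _)%E; congr EFin; apply: eq_bigr => i _; rewrite mxE liftK.
Qed.

End rV_borel.

(** Translation invariance of the Lebesgue integral on the line. *)
Section lebesgue_shift.
Variables (R : realType) (a : R).
Let mR := measurableTypeR R.
Let shift_by (x : mR) : mR := x + a.

Let measurable_shift_by : measurable_fun [set: mR] shift_by.
Proof. exact: measurable_funD. Qed.

Let nu : {measure set mR -> \bar R} :=
  measure_function_pushforward__canonical__measure_function_Measure
    lebesgue_measure measurable_shift_by.

Let lebesgue_measure_shift (A : set mR) : measurable A ->
  lebesgue_measure A = nu A.
Proof.
apply: lebesgue_measure_unique => _ [[b c]] _ <-.
rewrite /nu /= /pushforward.
rewrite (_ : shift_by @^-1` _ = [set` `](b - a), (c - a)]%R]); last first.
  by apply/seteqP; split => x /=; rewrite !in_itv /= /shift_by ltrBlDr lerBrDr.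
rewrite !lebesgue_measure_itv /= !lte_fin ltrD2r -!EFinB.
by congr (if _ then _ else _); congr EFin; ring.
Qed.

Lemma integral_shift (f : R -> R) :
  measurable_fun [set: mR] f -> (forall x, 0 <= f x) ->
  (\int[lebesgue_measure]_(x in [set: mR]) (f (x + a)%R)%:E =
   \int[lebesgue_measure]_(x in [set: mR]) (f x)%:E)%E.
Proof.
move=> mf f0.
have mEf : measurable_fun [set: mR] (EFin \o f) by exact/measurable_EFinP.
have f0' : {in [set: mR], forall y, (0 <= (EFin \o f) y)%E}.
  by move=> x _; rewrite lee_fin.
have := @ge0_integral_pushforward _ _ _ _ R _ measurable_shift_by lebesgue_measure
  setT _ measurableT mEf f0'.
rewrite preimage_setT => <-; symmetry.
by apply: eq_measure_integral => A mA _; exact: lebesgue_measure_shift.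
Qed.

End lebesgue_shift.

(** * Smooth functions of one variable *)

Section smooth1.
Variable R : realType.
Implicit Types (f g : R -> R) (k : nat).

(** [f] has k successive derivatives on the whole line. *)
Fixpoint diff_times k f : Prop :=
  if k is k'.+1 then
    exists2 g, forall x : R, is_derive x (1 : R) f (g x) & diff_times k' g
  else True.

Definition smooth1 f : Prop := forall k, diff_times k f.

Lemma diff_timesS k f : diff_times k.+1 f -> diff_times k f.
Proof.
elim: k f => [//|k IHk] f [g fg Hg]; exists g => //; exact: IHk.
Qed.

Lemma diff_timesD k f g : diff_times k f -> diff_times k g ->
  diff_times k (fun x => f x + g x).
Proof.
elim: k f g => [//|k IHk] f g [f' ff' Hf'] [g' gg' Hg'].
by exists (fun x => f' x + g' x) => [x|]; [exact: is_deriveD|exact: IHk].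
Qed.

Lemma diff_timesM k f g : diff_times k f -> diff_times k g ->
  diff_times k (fun x => f x * g x).
Proof.
elim: k f g => [//|k IHk] f g Hf Hg.
have [f' ff' Hf'] := Hf; have [g' gg' Hg'] := Hg.
exists (fun x => f x * g' x + g x * f' x) => [x|].
  exact: (@is_deriveM _ _ f g x 1 (f' x) (g' x)).
by apply: diff_timesD; apply: IHk => //; exact: diff_timesS.
Qed.

Lemma diff_times_cst k (c : R) : diff_times k (fun=> c).
Proof.
elim: k c => [//|k IHk] c; exists (fun=> 0) => // x; exact: is_derive_cst.
Qed.

Lemma diff_times_affine k f (a b : R) : diff_times k f ->
  diff_times k (fun x => f (a * x + b)).
Proof.
elim: k f => [//|k IHk] f [g fg Hg].
exists (fun x => g (a * x + b) * a) => [x|].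
  apply: (@is_derive1_comp _ f (fun x => a * x + b)).
  have := @is_deriveD _ _ _ (a \*: (id : R -> R)) (cst b) x 1 _ _
    (@is_deriveZ _ _ _ id a x 1 1 (is_derive_id _ _)) (is_derive_cst _ _ _).
  by rewrite addr0 -[a *: 1]/(a * 1) mulr1.
apply: diff_timesM; [exact: IHk|exact: diff_times_cst].
Qed.

Lemma smooth1B f g : smooth1 f -> smooth1 g -> smooth1 (fun x => f x - g x).
Proof.
move=> sf sg k.
rewrite (_ : (fun x => _) = fun x => f x + (-1) * g x); last first.
  by apply/funext => x; rewrite mulN1r.
by apply: diff_timesD => //; apply: diff_timesM => //; exact: diff_times_cst.
Qed.

Lemma smooth1M f g : smooth1 f -> smooth1 g -> smooth1 (fun x => f x * g x).
Proof. by move=> sf sg k; exact: diff_timesM. Qed.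

Lemma smooth1_affine f (a b : R) : smooth1 f -> smooth1 (fun x => f (a * x + b)).
Proof. by move=> sf k; exact: diff_times_affine. Qed.

Lemma smooth1_primitive f g : (forall x : R, is_derive x (1 : R) f (g x)) ->
  smooth1 g -> smooth1 f.
Proof. by move=> fg sg [//|k]; exists g. Qed.

Lemma smooth1_derive f k (x : R) : smooth1 f ->
  is_derive x (1 : R) (derive1n k f) (derive1n k.+1 f x).
Proof.
move=> sf; rewrite derive1nS.
suff /(_ k)/(_ 1%N)[g fg _] : forall k, smooth1 (derive1n k f).
  by rewrite derive1E; apply: derivableP; exact: ex_derive.
elim=> [|j IHj]; first by rewrite derive1n0.
rewrite derive1nS => i; have [g fg] := IHj i.+1.
rewrite (_ : derive1 _ = g) //; apply/funext => y.
by rewrite derive1E; apply: derive_val.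
Qed.

Lemma smooth1_continuous f : smooth1 f -> continuous f.
Proof.
move=> /(_ 1%N)[g fg _] x; apply: differentiable_continuous.
by apply/derivable1_diffP; exact: ex_derive.
Qed.

End smooth1.

Section bump.
Variable R : realType.
Implicit Type p : {poly R}.

(** By induction on p, each factor 'X costing half of the rate a. *)
Lemma horner_le_expR p (a : R) : 0 < a ->
  exists2 C : R, 0 <= C & forall u, 0 <= u -> `|p.[u]| <= C * expR (a * u).
Proof.
elim/poly_ind: p a => [|p c IHp] a a0.
  by exists 0 => // u _; rewrite horner0 normr0 mul0r.
have a20 : 0 < a / 2 by rewrite divr_gt0.
have [C C0 pC] := IHp _ a20.
exists (C * (2 / a) + `|c|).
  by rewrite addr_ge0// mulr_ge0// divr_ge0// ltW.
move=> u u0; rewrite hornerMXaddC (le_trans (ler_normD _ _))// mulrDl lerD//.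
  have ua : u <= 2 / a * expR (a / 2 * u).
    have : a / 2 * u <= expR (a / 2 * u).
      by apply: le_trans (expR_ge1Dx _); rewrite lerDr.
    rewrite -(ler_pM2l (_ : 0 < 2 / a)) ?divr_gt0// mulrA.
    by rewrite (_ : 2 / a * (a / 2) = 1) ?mul1r//; field; rewrite gt_eqF.
  rewrite normrM (ger0_norm u0).
  apply: (@le_trans _ _ (C * expR (a / 2 * u) * (2 / a * expR (a / 2 * u)))).
    by apply: ler_pM => //; exact: pC.
  rewrite (_ : a * u = a / 2 * u + a / 2 * u); last by field.
  by rewrite expRD le_eqVlt; apply/orP; left; apply/eqP; ring.
by rewrite ler_peMr// (le_trans _ (expR_ge1Dx _))// lerDl mulr_ge0// ltW.
Qed.

(** The function p(1/x) exp(-1/x) for x > 0, extended by 0.  The derivative of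
  such a function is again one of them, so all of them are smooth. *)
Definition flat p (x : R) : R := if 0 < x then p.[x^-1] * expR (- x^-1) else 0.

(* Yields the derivative 0 at the origin. *)
Let flat_sq_le p : exists C : R, forall x, `|flat p x| <= C * x ^+ 2.
Proof.
have [C C0 pC] := @horner_le_expR ('X^2 * p) 1 ltr01.
exists C => x; rewrite /flat; case: ifPn => x0; last first.
  by rewrite normr0 mulr_ge0// sqr_ge0.
have /pC : 0 <= x^-1 by rewrite invr_ge0 ltW.
rewrite hornerM hornerXn normrM ger0_norm; last by rewrite exprn_ge0// invr_ge0 ltW.
rewrite mul1r exprVn ler_pdivrMl ?exprn_gt0// => H.
rewrite normrM (gtr0_norm (expR_gt0 _)) expRN ler_pdivrMr ?expR_gt0//.
by rewrite (mulrC C) -mulrA.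
Qed.

Lemma is_derive_flat p (x : R) :
  is_derive x (1 : R) (flat p) (flat ('X^2 * (p - p^`())) x).
Proof.
have [x0|x0|->] := ltgtP x 0.
- rewrite [X in is_derive _ _ _ X]/flat ltNge ltW//=.
  apply: (@near_eq_is_derive _ _ _ (cst 0)).
  near=> y; rewrite /flat ltNge ltW//.
  by near: y; exact: lt_nbhsl.
- have xn0 : x != 0 by rewrite gt_eqF.
  have dV : is_derive x (1 : R) (fun y : R => y^-1) (- x ^- 2).
    apply: is_derive_eq; first exact: is_deriveV.
    by rewrite -[_%:A]/(_ * 1) mulr1.
  have dp : is_derive x (1 : R) (fun y => p.[y^-1]) (p^`().[x^-1] * - x ^- 2).
    exact: (@is_derive1_comp _ (horner p) (fun y => y^-1)).
  have de : is_derive x (1 : R) (fun y => expR (- y^-1)) (expR (- x^-1) * (x ^- 2)).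
    apply: (@is_derive1_comp _ expR (fun y => - y^-1)).
    by rewrite -[x ^- 2]opprK; exact: (@is_deriveN _ _ _ (fun y : R => y^-1)).
  apply: (is_derive_eq (near_eq_is_derive _ (@is_deriveM _ _ _ _ x 1 _ _ dp de))).
    near=> y; rewrite /flat ifT//.
    by near: y; exact: lt_nbhsr.
  rewrite /flat x0 hornerM hornerXn hornerD hornerN.
  rewrite -![_ *: _]/(_ * _) exprVn; ring.
rewrite [X in is_derive _ _ _ X]/flat ltxx.
have [C flatC] := flat_sq_le p.
suff cvg0 : h^-1 *: (flat p (h *: 1 + 0) - flat p 0) @[h --> 0^'] --> (0 : R).
  apply: DeriveDef; first by apply/cvg_ex; exists 0.
  exact/cvg_lim.
apply/cvgrPdist_le => e e0; near=> h.
have h0 : h != 0 by near: h; exact: nbhs_dnbhs_neq.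
rewrite sub0r normrN addr0 {2}/flat ltxx subr0 -![_ *: _]/(_ * _) mulr1.
rewrite normrM normfV ler_pdivrMl ?normr_gt0//.
apply: (le_trans (flatC h)).
rewrite -real_normK ?num_real// expr2 mulrA mulrC ler_pM2l ?normr_gt0//.
apply: (@le_trans _ _ ((`|C| + 1) * `|h|)).
  rewrite ler_wpM2r// (le_trans (ler_norm _))// lerDl//.
rewrite -ler_pdivlMl ?ltr_wpDl//.
near: h; apply: dnbhs0_le; rewrite mulr_gt0// invr_gt0 ltr_wpDl//.
Unshelve. all: by end_near. Qed.

Lemma smooth1_flat p : smooth1 (flat p).
Proof.
move=> k; elim: k p => [//|k IHk] p.
exists (flat ('X^2 * (p - p^`()))) => [x|]; [exact: is_derive_flat|exact: IHk].
Qed.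

Lemma flat1_gt0 (x : R) : 0 < x -> 0 < flat 1 x.
Proof. by move=> x0; rewrite /flat x0 hornerC mul1r expR_gt0. Qed.

Lemma flat_le0 p (x : R) : x <= 0 -> flat p x = 0.
Proof. by move=> x0; rewrite /flat ltNge x0. Qed.

Lemma flat1_ge0 (x : R) : 0 <= flat 1 x.
Proof. by have [/flat1_gt0/ltW|/flat_le0->] := ltP 0 x. Qed.

End bump.

(** A smooth bump b supported in [0, e], with integral c, and its primitive B, a
  smooth step from 0 to c. *)
Lemma exists_bump (R : realType) (e : R) : 0 < e ->
  exists b B : R -> R, exists c : R,
  [/\ smooth1 b, smooth1 B & forall x : R, is_derive x (1 : R) B (b x)] /\
  [/\ forall x : R, 0 <= b x, forall x : R, ~~ (0 < x < e) -> b x = 0, 0 < c &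
      (\int[lebesgue_measure]_x (b x)%:E = c%:E)%E] /\
  [/\ {homo B : x y / x <= y}, forall x : R, x <= 0 -> B x = 0 &
      forall x, e <= x -> B x = c].
Proof.
move=> e0; pose b (x : R) := flat 1 x * flat 1 (- 1 * x + e).
have sb : smooth1 b by apply: smooth1M; [|apply: smooth1_affine]; exact: smooth1_flat.
have b0 x : 0 <= b x by rewrite mulr_ge0// flat1_ge0.
have b_supp x : ~~ (0 < x < e) -> b x = 0.
  rewrite negb_and -!leNgt /b => /orP[x0|ex]; first by rewrite flat_le0// mul0r.
  by rewrite [X in _ * X]flat_le0 ?mulr0// mulN1r addrC subr_le0.
have b_gt0 x : 0 < x < e -> 0 < b x.
  by move=> /andP[x0 xe]; rewrite mulr_gt0// flat1_gt0// mulN1r addrC subr_gt0.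
have cb := smooth1_continuous sb.
have ib : lebesgue_measure.-integrable setT (EFin \o b).
  rewrite (_ : EFin \o b = (EFin \o b) \_ `[0, e]%classic); last first.
    apply/funext => x; rewrite patchE; case: ifPn => //.
    rewrite notin_setE /= in_itv /= => x0e; rewrite b_supp//.
    by apply/negP => /andP[x0 xe]; apply: x0e; rewrite !ltW.
  apply: (iffLR (integrable_mkcond _ _)) => //.
  apply: continuous_compact_integrable; first exact: segment_compact.
  exact: continuous_subspaceT.
pose B (x : R) := (\int[lebesgue_measure]_(t in `]-oo, x]%classic) b t)%R.
pose c := (\int[lebesgue_measure]_t b t)%R.
have dB x : is_derive x (1 : R) B (b x).
  have [] := @continuous_FTC1 R b -oo%O x (x + 1).
  - by rewrite ltrDl.
  - exact: integrableS ib.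
  - exact: ltNyr.
  - exact: cb.
  by move=> dBx <-; rewrite derive1E; apply/derivableP.
have dB' x : derivable B x 1 by exact: ex_derive.
have B'b x : derive1 B x = b x by rewrite derive1E; apply: derive_val.
have cB : continuous B by move=> x; apply: differentiable_continuous; apply/derivable1_diffP.
have B_homo : {homo B : x y / x <= y}.
  move=> x y xy; apply: (@ger0_derive1_ndecr _ B x y) => //.
  - by move=> z _; rewrite B'b.
  - exact: continuous_subspaceT.
have B0 x : x <= 0 -> B x = 0.
  move=> x0; rewrite /B (@eq_Rintegral _ _ _ _ _ (cst 0)) ?Rintegral_cst ?mul0r//.
  move=> t; rewrite inE /= in_itv /= => tx.
  by rewrite b_supp//= negb_and -!leNgt (le_trans tx).
have Be x : e <= x -> B x = c.
  move=> ex; rewrite /B /c Rintegral_mkcond; apply: eq_Rintegral => t _.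
  rewrite patchE; case: ifPn => //; rewrite notin_setE /= in_itv /= => /negP.
  by rewrite -ltNge => xt; rewrite b_supp// negb_and -!leNgt (le_trans ex (ltW xt)) orbT.
exists b, B, c; split; [|split]; split => //.
- exact: smooth1_primitive dB sb.
- have <- : B e - B 0 = c by rewrite (Be e)// (B0 0)// subr0.
  rewrite subr_gt0; apply: (@gtr0_derive1_incr _ B 0 e) => //.
  + by move=> t; rewrite in_itv /= B'b; exact: b_gt0.
  + exact: continuous_subspaceT.
- by rewrite /c /Rintegral fineK//; exact: integrable_fin_num.
Qed.

(** * Test functions *)

Lemma is_derive_cvgP (R : numFieldType) (V W : normedModType R) (f : V -> W) a v df :
  is_derive a v f df <->
  h^-1 *: ((f \o shift a) (h *: v) - f a) @[h --> (0 : R)^'] --> df.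
Proof.
split=> [[df1 <-]|fdf]; first exact: df1.
apply: DeriveDef; first by apply/cvg_ex; exists df.
by apply/cvg_lim => //; exact: norm_hausdorff.
Qed.

Section tensor.
Variables (R : realType) (n : nat).
Implicit Types (f : 'I_n -> R -> R) (x : 'rV[R]_n).

(** The tensor product of functions of one variable. *)
Definition tensor f x : R := \prod_(i < n) f i (x ord0 i).

Lemma is_derive_tensor f x i df : is_derive (x ord0 i) (1 : R) (f i) df ->
  is_derive x (basis_rV R i) (tensor f)
    ((\prod_(j < n | j != i) f j (x ord0 j)) * df).
Proof.
move=> /is_derive_cvgP fi; apply/is_derive_cvgP.
set c := \prod_(j < n | _) _.
rewrite (_ : (fun h => _) =
    fun h => c *: (h^-1 *: ((f i \o shift (x ord0 i)) (h *: 1) - f i (x ord0 i)))).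
  exact: cvgZr.
apply/funext => h /=; rewrite /tensor (bigD1 i)//= [in X in _ - X](bigD1 i)//=.
rewrite (eq_bigr (fun j => f j (x ord0 j))) => [|j ji]; last first.
  by rewrite !mxE (negbTE ji) andbF mulr0 add0r.
rewrite -/c !mxE !eqxx /= -![_ *: _]/(_ * _); ring.
Qed.

Lemma derive_tensor f i : (forall i, smooth1 (f i)) ->
  'D_(basis_rV R i) (tensor f) =
  tensor (fun j => derive1n (i == j) (f j)).
Proof.
move=> sf; apply/funext => x.
have := smooth1_derive 0 (x ord0 i) (sf i); rewrite derive1n0 => fi.
have := is_derive_tensor fi => tf.
rewrite derive_val /tensor [RHS](bigD1 i)//= eqxx mulrC; congr (_ * _).
by apply: eq_bigr => j /negbTE ji; rewrite eq_sym ji derive1n0.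
Qed.

Lemma smooth1_derive1n g k : smooth1 g -> smooth1 (derive1n k g : R -> R).
Proof.
move=> sg j; elim: j k => [//|j IHj] k.
by exists (derive1n k.+1 g) => // y; exact: smooth1_derive.
Qed.

Lemma iterated_partial_tensor f s : (forall i, smooth1 (f i)) ->
  iterated_partial (tensor f) s =
  tensor (fun j => derive1n (count_mem j s) (f j)).
Proof.
move=> sf; elim: s => [|i s IHs] //=.
rewrite IHs derive_tensor; last by move=> j; exact: smooth1_derive1n.
congr tensor; apply/funext => j.
by case: (i == j); rewrite ?derive1n0 ?add0n// add1n derive1n1 -derive1nS.
Qed.

Lemma continuous_tensor f : (forall i, smooth1 (f i)) -> continuous (tensor f).
Proof.
move=> sf.
suff prod_continuous s :
    continuous (fun y : 'rV[R]_n => \prod_(i <- s) f i (y ord0 i)).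
  exact: prod_continuous.
elim: s => [|i s IHs].
  rewrite (_ : (fun y : 'rV[R]_n => _) = cst 1); last first.
    by apply/funext => y; rewrite big_nil.
  exact: cst_continuous.
rewrite (_ : (fun y : 'rV[R]_n => _) =
  (fun y => f i (y ord0 i) * \prod_(j <- s) f j (y ord0 j))); last first.
  by apply/funext => y; rewrite big_cons.
move=> x; apply: (@continuousM _ _ (f i \o (fun y : 'rV[R]_n => y ord0 i))).
  by apply: continuous_comp; [exact: coord_continuous|exact: smooth1_continuous].
exact: IHs.
Qed.

Lemma smooth_tensor f : (forall i, smooth1 (f i)) -> smooth (tensor f).
Proof.
move=> sf s; rewrite iterated_partial_tensor//; split.
  by apply: continuous_tensor => i; exact: smooth1_derive1n.
move=> x i; apply: ex_derive; apply: is_derive_tensor.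
exact: smooth1_derive.
Qed.

Lemma test_function_tensor (D : set 'rV[R]_n) f (lo hi : 'I_n -> R) :
  (forall i, smooth1 (f i)) ->
  (forall i s, ~~ (lo i <= s <= hi i) -> f i s = 0) ->
  [set x : 'rV[R]_n | forall i, lo i <= x ord0 i <= hi i] `<=` D ->
  test_function D (tensor f).
Proof.
move=> sf f0 boxD; set box := [set x | _] in boxD.
have cbox : compact box.
  pose I i : set R := [set` `[lo i, hi i]%R].
  have := @rV_compact R n I; rewrite (_ : [set v | _] = box).
    by apply => i; exact: segment_compact.
  by apply/seteqP; split => y /= + i => /(_ i); rewrite /I /= in_itv.
have clbox : closed box by apply: compact_closed => //; exact: norm_hausdorff.
have suppbox : support_of (tensor f) `<=` box.
  rewrite /support_of closureE; apply: smallest_sub => // x /= tx0 i.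
  apply: contraNT tx0 => xi.
  by rewrite /tensor (bigD1 i)//= f0// mul0r eqxx.
split; first exact: smooth_tensor.
- by apply: (subclosed_compact _ cbox) => //; exact: closed_closure.
- exact: subset_trans suppbox boxD.
Qed.

End tensor.

Section tensor_integral.
Variables (R : realType) (n : nat).
Let mu := lebesgue_rV R n.
Implicit Types (F : 'I_n -> R -> R) (D : set 'rV[R]_n).

Lemma measurable_tensor F D : (forall j, smooth1 (F j)) -> measurable D ->
  measurable_fun D (tensor F).
Proof.
move=> sF mD; apply: measurable_fun_within => //.
by apply: continuous_subspaceT; exact: continuous_tensor.
Qed.

Lemma tensor_integral F (c : 'I_n -> R) D : measurable D ->
  (forall j, smooth1 (F j)) -> (forall j s, 0 <= F j s) ->
  (forall j, (\int[lebesgue_measure]_s (F j s)%:E = (c j)%:E)%E) ->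
  (forall x, ~ D x -> tensor F x = 0) ->
  mu.-integrable D (EFin \o tensor F) /\
  \int[mu]_(x in D) tensor F x = \prod_j c j.
Proof.
move=> mD sF F0 Fc FD.
have tF0 x : 0 <= tensor F x by rewrite /tensor prodr_ge0.
have mtF E : measurable E -> measurable_fun E (tensor F) by exact: measurable_tensor.
have intF : (\int[mu]_(x in D) (tensor F x)%:E = (\prod_j c j)%:E)%E.
  rewrite integral_mkcond (_ : _ \_ D = EFin \o tensor F); last first.
    apply/funext => x; rewrite patchE; case: ifPn => //.
    by rewrite notin_setE => /FD /= ->.
  have mF j : measurable_fun setT (F j).
    apply: continuous_measurable_fun; exact: smooth1_continuous.
  rewrite integral_rV_prod//.
  by rewrite -prodEFin; apply: eq_bigr.
split; last by rewrite /Rintegral intF.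
apply/integrableP; split; first by apply/measurable_EFinP; exact: mtF.
under eq_integral do rewrite /= ger0_norm//.
by rewrite intF ltry.
Qed.

End tensor_integral.

Lemma Rintegral_le_ae d (T : measurableType d) (R : realType)
    (mu : {measure set T -> \bar R}) (D : set T) (g phi : T -> R) (L : R) :
  measurable D -> measurable_fun D g -> measurable_fun D phi ->
  0 <= L -> {ae mu, forall x, D x -> `|g x| <= L} ->
  (forall x, 0 <= phi x) -> mu.-integrable D (EFin \o phi) ->
  `|\int[mu]_(x in D) (g x * phi x)| <= L * \int[mu]_(x in D) phi x.
Proof.
move=> mD mg mphi L0 gL phi0 iphi.
have le_int : (\int[mu]_(x in D) `|(g x * phi x)%:E| <=
    \int[mu]_(x in D) (L * phi x)%:E)%E.
  apply: ae_ge0_le_integral => //.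
  - by apply: measurableT_comp => //; apply/measurable_EFinP; exact: measurable_funM.
  - by move=> x _; rewrite lee_fin mulr_ge0.
  - by apply/measurable_EFinP; exact: measurable_funM.
  - apply: filterS gL => x + Dx => /(_ Dx) gxL.
    by rewrite /= lee_fin normrM (ger0_norm (phi0 x)) ler_wpM2r.
have iLphi : mu.-integrable D (EFin \o (fun x => L * phi x)).
  have := integrableZl mD L iphi; apply: eq_integrable => // x _.
have igphi : mu.-integrable D (EFin \o (fun x => g x * phi x)).
  apply/integrableP; split; first by apply/measurable_EFinP; exact: measurable_funM.
  apply: (le_lt_trans le_int).
  by have /fin_numPlt/andP[] := integrable_fin_num mD iLphi.
apply: (le_trans (le_normr_Rintegral mD igphi)).
rewrite -RintegralZl//.
rewrite /Rintegral fine_le//.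
  have := integrable_fin_num mD (integrable_abse igphi); exact.
exact: integrable_fin_num.
Qed.

(** * Bounded weak derivatives and Lipschitz continuity *)

Section weak_lipschitz.
Variables (R : realType) (n : nat) (D : set 'rV[R]_n) (f g : 'rV[R]_n -> R).
Variables (i : 'I_n) (L Mf : R).
Let mu := lebesgue_rV R n.
Hypotheses (oD : open D) (mf : measurable_fun D f)
  (cf : forall y, D y -> {for y, continuous f})
  (fM : forall y, D y -> `|f y| <= Mf)
  (mg : measurable_fun D g) (L0 : 0 <= L)
  (gL : {ae mu, forall y, D y -> `|g y| <= L})
  (fg : forall phi, test_function D phi ->
    \int[mu]_(x in D) (f x * 'D_(basis_rV R i) phi x) =
    - \int[mu]_(x in D) (g x * phi x)).

(** Here g is the weak i-th derivative of f.  An average of f near x minus an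
  average of f near x + t e_i is the integral of f against the i-th derivative
  of a test function, the product of narrow bumps in the coordinates j <> i and
  of a plateau of length about t in the i-th one.  The width eta of the bumps
  tends to 0. *)
Lemma weak_lipschitz_dir (x : 'rV[R]_n) (t eta0 : R) : 0 < t -> 0 < eta0 ->
  [set y : 'rV[R]_n | forall j,
     x ord0 j <= y ord0 j <= x ord0 j + (if j == i then t else 0) + eta0] `<=` D ->
  `|f (x + t *: basis_rV R i) - f x| <= L * t.
Proof.
move=> t0 eta00 boxD; set x' := x + t *: basis_rV R i.
have mD : measurable D by exact: open_measurable_rV.
have x'E j : x' ord0 j = x ord0 j + (if j == i then t else 0).
  by rewrite !mxE eqxx /=; case: (j == i); rewrite ?mulr1 ?mulr0.
have Dx : D x.
  by apply: boxD => j; rewrite lexx /=; case: (j == i); lra.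
have Dx' : D x'.
  by apply: boxD => j; rewrite x'E; case: (j == i); apply/andP; split; lra.
apply/ler_addgt0Pl => w w0.
have near_f y : D y -> exists2 e : R, 0 < e & forall z : 'rV[R]_n,
    (forall j, `|y ord0 j - z ord0 j| < e) -> `|f y - f z| <= w / 3.
  move=> Dy; have /cvgrPdist_le/(_ (w / 3)) := cf Dy.
  rewrite divr_gt0// => /(_ isT) /nbhs_rVP[e e0 H]; exists e => //.
have [e1 e10 fe1] := near_f _ Dx.
have [e2 e20 fe2] := near_f _ Dx'.
pose L1 := L + 1; have L10 : 0 < L1 by rewrite ltr_wpDl.
have [eta [eta_gt0 eta_lt0 eta_lt1 eta_lt2 eta_ltw]] : exists eta : R,
    [/\ 0 < eta, eta <= eta0, eta < e1, eta < e2 & L * eta <= w / 3].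
  pose m := Num.min (Num.min eta0 e1) (Num.min e2 (w / 3 / L1)).
  have m0 : 0 < m by rewrite !lt_min eta00 e10 e20 /= !divr_gt0.
  have mle : [/\ m <= eta0, m <= e1, m <= e2 & m <= w / 3 / L1].
    by rewrite /m; split; rewrite !ge_min lexx ?orbT.
  case: mle => m1 m2 m3 m4.
  exists (m / 2); split; [lra|lra|lra|lra|].
  have : L * m <= w / 3.
    rewrite (le_trans (ler_wpM2l L0 m4))// mulrA ler_pdivrMr//.
    by rewrite mulrC ler_wpM2l ?divr_ge0 ?ltW// /L1; lra.
  by have := mulr_ge0 L0 (ltW m0); lra.
have [b [B [c [[sb sB dB] [[b0 bsupp c0 intb] [B_homo B0 Be]]]]]] := exists_bump eta_gt0.
pose c_ (j : 'I_n) := c.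
pose C := \prod_j c_ j.
have C0 : 0 < C by rewrite prodr_gt0.
have s1shift h a : smooth1 h -> smooth1 (fun s : R => h (s - a)).
  move=> sh; have := smooth1_affine 1 (- a) sh.
  by congr smooth1; apply/funext => s; rewrite mul1r.
pose Psi (z : 'rV[R]_n) : 'I_n -> R -> R := fun j s => b (s - z ord0 j).
have sPsi z j : smooth1 (Psi z j) by exact: s1shift.
have Psi0 z j s : 0 <= Psi z j s by exact: b0.
have mb : measurable_fun setT b.
  by apply: continuous_measurable_fun; exact: smooth1_continuous.
have intPsi z j : (\int[lebesgue_measure]_s (Psi z j s)%:E = (c_ j)%:E)%E.
  by rewrite -intb; exact: (integral_shift (- z ord0 j)).
have Psi_supp z (y : 'rV[R]_n) : tensor (Psi z) y != 0 ->
    forall j, 0 < y ord0 j - z ord0 j < eta.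
  move=> + j; apply: contraNT => yj.
  by rewrite /tensor (bigD1 j)//= /Psi bsupp// mul0r.
have boxD' z y : z = x \/ z = x' -> tensor (Psi z) y != 0 -> D y.
  move=> zx /Psi_supp yz; apply: boxD => j; have /andP[] := yz j.
  by case: zx => ->; rewrite ?x'E; case: (j == i) => h1 h2; apply/andP; split; lra.
have PsiD z : z = x \/ z = x' -> forall y, ~ D y -> tensor (Psi z) y = 0.
  move=> zx y nDy; apply/eqP; apply: contra_notT nDy; exact: boxD'.
have tPsi z : z = x \/ z = x' -> mu.-integrable D (EFin \o tensor (Psi z)) /\
    \int[mu]_(y in D) tensor (Psi z) y = C.
  by move=> zx; apply: tensor_integral => //; exact: PsiD.
(* the factors of the test function: a plateau for j = i, bumps otherwise *)
pose rho (j : 'I_n) (s : R) : R :=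
  if j == i then B (s - x ord0 i) - B (s - x' ord0 i) else b (s - x ord0 j).
have srho j : smooth1 (rho j).
  by rewrite /rho; case: (j == i); [apply: smooth1B|]; exact: s1shift.
have rho0 j s : 0 <= rho j s.
  by rewrite /rho; case: (j == i) => //; rewrite subr_ge0 B_homo// x'E eqxx; lra.
have rho_supp j s :
    ~~ (x ord0 j <= s <= x ord0 j + (if j == i then t else 0) + eta) -> rho j s = 0.
  rewrite negb_and -!ltNge /rho; case: eqP => [->|_].
    rewrite x'E eqxx => /orP[sx|sx]; first by rewrite !B0 ?subr0//; lra.
    by rewrite !Be ?subrr//; lra.
  rewrite addr0 => sx; rewrite bsupp// negb_and -!leNgt.
  by case/orP: sx => sx; apply/orP; [left|right]; lra.
have t_rho : test_function D (tensor rho).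
  apply: (test_function_tensor srho rho_supp).
  by apply: subset_trans boxD => y yb j; have /andP[] := yb j => h1 h2; apply/andP; split; lra.
have Brange s : 0 <= B s <= c.
  apply/andP; split; first by rewrite -(B0 (Num.min s 0)) ?B_homo ?ge_min ?lexx ?orbT.
  by rewrite -(Be (Num.max s eta)) ?B_homo ?le_max ?lexx ?orbT.
(* 0 <= rho i <= c, with support in an interval of length t + eta *)
have [ci [intrho ci_le]] : exists ci : R,
    (\int[lebesgue_measure]_s (rho i s)%:E = ci%:E)%E /\ ci <= c * (t + eta).
  have le_rho : (\int[lebesgue_measure]_s (rho i s)%:E <= (c * (t + eta))%:E)%E.
    pose I : set (measurableTypeR R) := [set` `[x ord0 i, x ord0 i + t + eta]%R].
    have mI : measurable I by exact: measurable_itv.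
    apply: (@le_trans _ _ (\int[lebesgue_measure]_(s in I) c%:E)%E).
      rewrite [leRHS]integral_mkcond; apply: ge0_le_integral => //.
      - by move=> s _; rewrite lee_fin.
      - apply/measurable_EFinP; apply: continuous_measurable_fun.
        exact: smooth1_continuous.
      - by apply/(measurable_restrictT _ mI).
      - move=> s _; rewrite patchE; case: ifPn => sI; rewrite lee_fin.
          rewrite /rho eqxx; have /andP[_ h1] := Brange (s - x ord0 i).
          have /andP[h2 _] := Brange (s - x' ord0 i); lra.
        rewrite rho_supp// eqxx; move: sI; rewrite notin_setE /I /= in_itv /=.
        by move=> /negP.
    have muI : (lebesgue_measure I <= (t + eta)%:E)%E.
      rewrite /I lebesgue_measure_itv /= lte_fin; case: ifPn => _.
        by rewrite -EFinB lee_fin; lra.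
      by rewrite lee_fin; lra.
    rewrite integral_cst// EFinM; apply: lee_wpmul2l => //.
    by rewrite lee_fin ltW.
  have ge0_rho : (0 <= \int[lebesgue_measure]_s (rho i s)%:E)%E.
    by apply: integral_ge0 => s _; rewrite lee_fin.
  move: le_rho ge0_rho; case: (integral _ _ _) => // r; rewrite !lee_fin => h1 h2.
  by exists r.
pose d_ (j : 'I_n) := if j == i then ci else c.
have [irho rhoE] : mu.-integrable D (EFin \o tensor rho) /\
    \int[mu]_(y in D) tensor rho y = \prod_j d_ j.
  apply: tensor_integral => //.
    move=> j; rewrite /d_; case: (eqVneq j i) => [->//|ji].
    rewrite -intb -(integral_shift (- x ord0 j) mb b0).
    by apply: eq_integral => s _; rewrite /rho (negbTE ji).
  move=> y nDy; apply/eqP; apply: contra_notT nDy => rhoy.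
  apply: boxD => j; apply: contraNT rhoy => yj.
  rewrite /tensor (bigD1 j)//= rho_supp ?mul0r//; apply: contraNN yj.
  by move=> /andP[h1 h2]; apply/andP; split; lra.
have le_rhoC : \int[mu]_(y in D) tensor rho y <= C * (t + eta).
  rewrite rhoE /C [X in _ <= X * _](bigD1 i)//= (bigD1 i)//= /d_ eqxx.
  rewrite (eq_bigr c_); last by move=> j /negbTE ->.
  rewrite mulrAC ler_wpM2r// ?prodr_ge0// => j _; exact: ltW.
have D_rho y : 'D_(basis_rV R i) (tensor rho) y = tensor (Psi x) y - tensor (Psi x') y.
  have di : is_derive (y ord0 i) (1 : R) (rho i)
      (b (y ord0 i - x ord0 i) - b (y ord0 i - x' ord0 i)).
    have dBa a : is_derive (y ord0 i) (1 : R) (fun s => B (s - a)) (b (y ord0 i - a)).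
      rewrite -[X in is_derive _ _ _ X]mulr1.
      apply: (@is_derive1_comp _ B (fun s => s - a)).
      have := @is_deriveB _ _ _ (id : R -> R) (cst a) (y ord0 i) 1 _ _
        (is_derive_id _ _) (is_derive_cst _ _ _).
      by rewrite subr0.
    have := @is_deriveB _ _ _ _ _ (y ord0 i) 1 _ _ (dBa (x ord0 i)) (dBa (x' ord0 i)).
    congr (is_derive _ _ _ _).
    by apply/funext => s; rewrite /rho eqxx.
  have := is_derive_tensor di => dt; rewrite derive_val.
  rewrite /tensor [in RHS](bigD1 i)//= [X in _ = _ - X](bigD1 i)//= /Psi.
  rewrite mulrBr; congr (_ - _); rewrite mulrC; congr (_ * _).
    by apply: eq_bigr => j /negbTE ji; rewrite /rho ji.
  by apply: eq_bigr => j ji; rewrite /rho (negbTE ji) x'E (negbTE ji) addr0.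
(* averaging f against Psi z yields f z up to w / 3 *)
have avg z : z = x \/ z = x' ->
    mu.-integrable D (EFin \o (fun y => f y * tensor (Psi z) y)) /\
    `|\int[mu]_(y in D) (f y * tensor (Psi z) y) - C * f z| <= C * (w / 3).
  move=> zx; have [iPz Pz] := tPsi _ zx.
  have mPz : measurable_fun D (tensor (Psi z)) by exact: measurable_tensor.
  have if_ : mu.-integrable D (EFin \o (fun y => f y * tensor (Psi z) y)).
    apply: (@le_integrable _ _ _ mu D mD _ (fun y => (Mf * tensor (Psi z) y)%:E)).
    - by apply/measurable_EFinP; exact: measurable_funM.
    - move=> y Dy /=; rewrite lee_fin !normrM ler_wpM2r//.
      by rewrite (le_trans (fM Dy))// ler_norm.
    - have := integrableZl mD Mf iPz; exact: eq_integrable.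
  split=> //.
  have ifz : mu.-integrable D (EFin \o (fun y => f z * tensor (Psi z) y)).
    by have := integrableZl mD (f z) iPz; exact: eq_integrable.
  have iwz : mu.-integrable D (EFin \o (fun y => w / 3 * tensor (Psi z) y)).
    by have := integrableZl mD (w / 3) iPz; exact: eq_integrable.
  rewrite -Pz mulrC -RintegralZl// -RintegralB//.
  rewrite mulrC -RintegralZl//.
  have ifB : mu.-integrable D (EFin \o
      (fun y => f y * tensor (Psi z) y - f z * tensor (Psi z) y)).
    by have := integrableB mD if_ ifz; exact: eq_integrable.
  apply: (le_trans (le_normr_Rintegral mD ifB)).
  apply: le_Rintegral => //.
    by have := integrable_norm ifB; exact: eq_integrable.
  move=> y Dy /=; rewrite -mulrBl normrM (ger0_norm (_ : 0 <= tensor (Psi z) y)); last first.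
    by rewrite /tensor prodr_ge0.
  have [->|Py] := eqVneq (tensor (Psi z) y) 0; first by rewrite !mulr0.
  rewrite ler_wpM2r//; first by rewrite /tensor prodr_ge0.
  have yz := Psi_supp _ _ Py; rewrite distrC.
  case: zx => zE; rewrite zE in yz *; [apply: fe1|apply: fe2] => j;
    by have /andP[h1 h2] := yz j; rewrite ltr_norml; apply/andP; split; lra.
have [i1 a1] := avg x (or_introl erefl).
have [i2 a2] := avg x' (or_intror erefl).
have := fg t_rho.
rewrite (@eq_Rintegral _ _ _ _ _
  (fun y => f y * tensor (Psi x) y - f y * tensor (Psi x') y)); last first.
  by move=> y _; rewrite D_rho mulrBr.
rewrite RintegralB// => fgE.
have mrho : measurable_fun D (tensor rho) by exact: measurable_tensor.
have trho0 y : 0 <= tensor rho y by rewrite /tensor prodr_ge0.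
have := Rintegral_le_ae mD mg mrho L0 gL trho0 irho.
rewrite -normrN -fgE => a3.
have {a3} a3 := le_trans a3 (ler_wpM2l L0 le_rhoC).
set I1 := (\int[mu]_(x0 in D) (f x0 * tensor (Psi x) x0))%R in a1 a3.
set I2 := (\int[mu]_(x0 in D) (f x0 * tensor (Psi x') x0))%R in a2 a3.
rewrite -(ler_pM2l C0) -[C * `|_|]ger0_norm; last by rewrite mulr_ge0// ltW.
rewrite normrM normr_id -normrM.
have -> : C * (f x' - f x) = (I1 - C * f x) - (I2 - C * f x') - (I1 - I2) by ring.
apply: (le_trans (ler_normB _ _)); apply: (le_trans (lerD (ler_normB _ _) (lexx _))).
apply: (le_trans (lerD (lerD a1 a2) a3)).
have h : L * eta * C <= w / 3 * C by rewrite ler_wpM2r// ltW.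
have -> : L * (C * (t + eta)) = C * (L * t) + L * eta * C by ring.
rewrite mulrDr; lra.
Qed.

End weak_lipschitz.

(** * Pointwise consequences of essential bounds *)

Section essential_bounds.
Variables (R : realType) (n : nat).
Let mu := lebesgue_rV R n.
Implicit Types (D S O : set 'rV[R]_n) (h : 'rV[R]_n -> R).

Lemma ae_open_ex (P : set 'rV[R]_n) O : {ae mu, forall x, P x} -> open O ->
  O !=set0 -> exists2 x, O x & P x.
Proof.
move=> [N [mN N0 PN]] oO O0; apply: contrapT => noP.
have ON : O `<=` N.
  by move=> x Ox; apply: PN => /= Px; apply: noP; exists x.
have := lebesgue_rV_open_gt0 oO O0.
rewrite ltNge => /negP; apply; rewrite -N0; apply: le_measure => //; rewrite ?inE//.
exact: open_measurable_rV.
Qed.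

Lemma Linf_norm_ge0 D h : (0 <= Linf_norm D h)%E.
Proof. exact: Lnorm_ge0. Qed.

Lemma Linf_norm_ae D h : (Linf_norm D h < +oo)%E ->
  {ae mu, forall x, D x -> `|h x| <= fine (Linf_norm D h)}.
Proof.
move=> hoo; have hfin : Linf_norm D h \is a fin_num.
  by rewrite ge0_fin_numE// Linf_norm_ge0.
have mu0 : (0 < mu [set: 'rV[R]_n])%E.
  by apply: lebesgue_rV_open_gt0; [exact: openT|exists 0].
have := ess_sup_ge mu (abse \o (EFin \o patch (fun=> 0%R) D h)).
have -> : ess_sup mu (abse \o (EFin \o patch (fun=> 0%R) D h)) = Linf_norm D h.
  by rewrite /Linf_norm unlock mu0.
apply: filterS => x + Dx; rewrite /= patchE mem_set// -{1}(fineK hfin).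
by rewrite lee_fin.
Qed.

Lemma closure_approx (A S : set 'rV[R]_n) h x (e : R) :
  {within A, continuous h} -> S `<=` A -> A x -> closure S x -> 0 < e ->
  exists2 y, S y & `|h x - h y| <= e.
Proof.
move=> /subspace_continuousP ch SA Ax Sx e0.
have /cvgrPdist_le/(_ _ e0) := ch _ Ax.
by move=> /Sx[y [Sy hy]]; exists y => //; apply: hy; exact: SA.
Qed.

(** A bound that holds almost everywhere on an open set holds everywhere on its
  closure for a function that is continuous there. *)
Lemma ae_le_closure D h (N : R) : open D -> {within closure D, continuous h} ->
  {ae mu, forall x, D x -> `|h x| <= N} -> forall x, closure D x -> `|h x| <= N.
Proof.
move=> oD ch hN x Dx; apply/ler_addgt0Pl => e e0.
have e20 : 0 < e / 2 by rewrite divr_gt0.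
have [y Dy xy] := closure_approx ch (@subset_closure _ D) Dx Dx e20.
have chy : {for y, continuous h}.
  have := continuous_subspaceW (@subset_closure _ D) ch.
  by rewrite continuous_open_subspace// => /(_ y); rewrite inE; exact.
pose O := [set z | `|h y - h z| <= e / 2] `&` D.
have O_y : nbhs y O.
  apply: filterI; last exact: open_nbhs_nbhs.
  by move/cvgrPdist_le : chy; apply.
have [|z Oz hzN] := ae_open_ex hN (open_interior O).
  by exists y; exact: O_y.
have [/= hz Dz] : O z by exact: interior_subset Oz.
have hxz : h x = (h x - h y) + (h y - h z) + h z by ring.
rewrite hxz (le_trans (ler_normD _ _))// (le_trans (lerD (ler_normD _ _) (lexx _)))//.
have := hzN Dz; move: xy hz => /=; lra.
Qed.

End essential_bounds.

(** * Euclidean norm, diameters, polyhedra *)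

Section euclidean_lemmas.
Variables (R : realType) (n : nat).
Implicit Types (x y : 'rV[R]_n) (S : set 'rV[R]_n).

Lemma coord_le_enorm x i : `|x ord0 i| <= enorm x.
Proof.
rewrite /enorm /dot -sqrtr_sqr ler_wsqrtr// (bigD1 i)//= expr2 lerDl.
by apply: sumr_ge0 => j _; rewrite -expr2 sqr_ge0.
Qed.

Lemma enorm_ge0 x : 0 <= enorm x. Proof. exact: sqrtr_ge0. Qed.

Lemma bounded_has_ubound_diam S : bounded_set S ->
  has_ubound [set enorm (x - y) | x in S & y in S].
Proof.
move=> /bounded_rV_box[r r0 Sr].
exists (Num.sqrt (\sum_(i < n) (r + r) ^+ 2)) => _ [x Sx [y Sy <-]].
rewrite /enorm /dot ler_wsqrtr//; apply: ler_sum => i _.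
have := Sr _ Sx i; have := Sr _ Sy i; rewrite !mxE -expr2 !ler_norml.
move=> /andP[h1 h2] /andP[h3 h4].
by rewrite -ler_sqrt ?sqr_ge0// !sqrtr_sqr [leRHS]ger0_norm ?ler_norml; [apply/andP; split|]; lra.
Qed.

Lemma enorm_le_diam S x y : bounded_set S -> S x -> S y -> enorm (x - y) <= diam S.
Proof.
move=> bS Sx Sy; apply: (ub_le_sup (bounded_has_ubound_diam bS)).
by exists x => //; exists y.
Qed.

Lemma diam_ge0 S : bounded_set S -> S !=set0 -> 0 <= diam S.
Proof. by move=> bS [x Sx]; rewrite (le_trans (enorm_ge0 _) (enorm_le_diam bS Sx Sx)). Qed.

Lemma open_polyhedron S : open_convex_polyhedron S -> open S.
Proof.
move=> [k [a [b ->]]].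
have cdot i : continuous (dot (a i)).
  rewrite /dot; elim: (index_enum _) => [|j s IHs].
    rewrite (_ : (fun y : 'rV[R]_n => _) = cst 0); first exact: cst_continuous.
    by apply/funext => y; rewrite big_nil.
  rewrite (_ : (fun y : 'rV[R]_n => _) =
      ((fun y => a i ord0 j * y ord0 j) \+ (fun y => \sum_(j <- s) a i ord0 j * y ord0 j))).
    move=> x; apply: continuousD; last exact: IHs.
    apply: (@continuousM _ _ (cst (a i ord0 j)) (fun y : 'rV[R]_n => y ord0 j)).
      exact: cst_continuous.
    exact: coord_continuous.
  by apply/funext => y; rewrite big_cons.
rewrite openE => x Sx.
have near_lt i : \forall y \near x, dot (a i) y < b i.
  have : nbhs (dot (a i) x) [set r | r < b i] by apply: lt_nbhsl; exact: Sx.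
  exact: cdot.
have := @filter_forall _ 'I_k (fun i y => dot (a i) y < b i) (nbhs x) _ near_lt.
exact.
Qed.

Lemma polyhedron_segment S x y (s : R) : open_convex_polyhedron S -> S x -> S y ->
  0 <= s <= 1 -> S (x + s *: (y - x)).
Proof.
move=> [k [a [b ->]]] /= Sx Sy /andP[s0 s1] i.
have -> : dot (a i) (x + s *: (y - x)) = (1 - s) * dot (a i) x + s * dot (a i) y.
  rewrite /dot !mulr_sumr -big_split /=; apply: eq_bigr => j _.
  by rewrite !mxE; ring.
have := Sx i; have := Sy i.
have [->|sn0] := eqVneq s 0; first by rewrite subr0 mul1r mul0r addr0.
have s_gt0 : 0 < s by rewrite lt_neqAle eq_sym sn0.
nra.
Qed.

End euclidean_lemmas.

(** * Lipschitz continuity of W^(1,oo) functions on convex cells *)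

(** A function on the unit interval that is Lipschitz at each point with a
  common constant is Lipschitz between the end points: consider the supremum
  of the points where the inequality with 0 holds. *)
Lemma pointwise_lipschitz (R : realType) (G : R -> R) (N : R) : 0 <= N ->
  (forall s, 0 <= s <= 1 -> exists2 e : R, 0 < e & forall s', 0 <= s' <= 1 ->
     `|s' - s| < e -> `|G s' - G s| <= N * `|s' - s|) ->
  `|G 1 - G 0| <= N.
Proof.
move=> N0 lipG.
pose S := [set s | 0 <= s <= 1 /\ `|G s - G 0| <= N * s].
have S0 : S 0 by rewrite /S /= lexx ler01 subrr normr0 mulr0.
have S1 : has_ubound S by exists 1 => s [/andP[]].
have supS : has_sup S by split => //; exists 0.
set m := sup S.
have m0 : 0 <= m by exact: ub_le_sup.
have m1 : m <= 1 by apply: ge_sup; [exists 0|move=> s [/andP[]]].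
have m01 : 0 <= m <= 1 by rewrite m0.
have [e e0 lip] := lipG _ m01.
have Sm : `|G m - G 0| <= N * m.
  have [s [s01 sS] ms] := sup_adherent e0 supS.
  have sm : s <= m by apply: ub_le_sup.
  have sme : `|s - m| < e by rewrite ler0_norm ?subr_le0// opprB; rewrite -/m in ms; lra.
  have := lip _ s01 sme; rewrite (ler0_norm (_ : s - m <= 0)) ?subr_le0// => H.
  have -> : G m - G 0 = (G s - G 0) - (G s - G m) by ring.
  rewrite (le_trans (ler_normB _ _))//; lra.
have [m_lt1|] := ltP m 1; last first.
  by move=> m1'; rewrite (_ : 1 = m) 1?(le_trans Sm) ?ler_piMr//; apply/eqP; rewrite eq_le m1 m1'.
have [s [ms s1 sme]] : exists s, [/\ m < s, s <= 1 & s - m < e].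
  exists (Num.min 1 (m + e / 2)); split.
  - by rewrite lt_min m_lt1; lra.
  - by rewrite ge_min lexx.
  - by rewrite ltrBlDr gt_min; apply/orP; right; lra.
suff /(ub_le_sup S1) : S s by rewrite -/m; lra.
have s01 : 0 <= s <= 1 by apply/andP; split; lra.
split => //.
have sm0 : 0 <= s - m by lra.
have sme' : `|s - m| < e by rewrite ger0_norm.
have := lip _ s01 sme'; rewrite (ger0_norm sm0) => H.
have -> : G s - G 0 = (G s - G m) + (G m - G 0) by ring.
rewrite (le_trans (ler_normD _ _))//; lra.
Qed.

Section directional_to_lipschitz.
Variables (R : realType) (n : nat) (D : set 'rV[R]_n) (f : 'rV[R]_n -> R) (L : R).
Hypotheses (oD : open D) (L0 : 0 <= L).
Hypothesis dirf : forall i (x : 'rV[R]_n) (t e : R), 0 < t -> 0 < e ->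
  [set y : 'rV[R]_n | forall j,
     x ord0 j <= y ord0 j <= x ord0 j + (if j == i then t else 0) + e] `<=` D ->
  `|f (x + t *: basis_rV R i) - f x| <= L * t.

Let coord_shift (x : 'rV[R]_n) t i j :
  (x + t *: basis_rV R i) ord0 j = x ord0 j + (if j == i then t else 0).
Proof. by rewrite !mxE eqxx /=; case: (j == i); rewrite ?mulr1 ?mulr0. Qed.

Let lip_coord (p : 'rV[R]_n) (r : R) (x : 'rV[R]_n) i (s : R) : 0 < r ->
  [set y : 'rV[R]_n | forall j, `|p ord0 j - y ord0 j| < r] `<=` D ->
  (forall j, `|p ord0 j - x ord0 j| < r / 2) ->
  `|p ord0 i - (x ord0 i + s)| < r / 2 ->
  `|f (x + s *: basis_rV R i) - f x| <= L * `|s|.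
Proof.
move=> r0 pD px pxs.
have r40 : 0 < r / 4 by lra.
have [s0|s0|->] := ltgtP s 0.
- have H : `|f (x + s *: basis_rV R i + - s *: basis_rV R i) -
      f (x + s *: basis_rV R i)| <= L * - s.
    apply: (dirf (e := r / 4)) => //; first by rewrite oppr_gt0.
    move=> y /= yx; apply: pD => j /=.
    have := yx j; rewrite coord_shift; have := px j.
    case: eqVneq => [->|_]; move: pxs; rewrite !ltr_norml.
      by move=> /andP[? ?] /andP[? ?] /andP[? ?]; apply/andP; split; lra.
    by move=> _ /andP[? ?] /andP[? ?]; apply/andP; split; lra.
  by rewrite distrC (ltr0_norm s0); move: H; rewrite scaleNr addrK.
- rewrite (gtr0_norm s0); apply: (dirf (e := r / 4)) => //.
  move=> y /= yx; apply: pD => j /=.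
  have := yx j; have := px j.
  case: eqVneq => [->|_]; move: pxs; rewrite !ltr_norml.
    by move=> /andP[? ?] /andP[? ?] /andP[? ?]; apply/andP; split; lra.
  by move=> _ /andP[? ?] /andP[? ?]; apply/andP; split; lra.
- by rewrite scale0r addr0 subrr normr0 mulr0.
Qed.

(* The coordinates of p are replaced by those of q one at a time. *)
Let lip_cube (p : 'rV[R]_n) (r : R) (q : 'rV[R]_n) : 0 < r ->
  [set y : 'rV[R]_n | forall j, `|p ord0 j - y ord0 j| < r] `<=` D ->
  (forall j, `|p ord0 j - q ord0 j| < r / 2) ->
  `|f q - f p| <= L * \sum_j `|q ord0 j - p ord0 j|.
Proof.
move=> r0 pD pq.
pose h k : 'rV[R]_n := \row_j if (j < k)%N then q ord0 j else p ord0 j.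
suff H k : (k <= n)%N -> `|f (h k) - f p| <=
    L * \sum_(j < n | (j < k)%N) `|q ord0 j - p ord0 j|.
  have := H n (leqnn n); rewrite (eq_bigl predT); last by move=> j; rewrite ltn_ord.
  by congr (`|f _ - _| <= _); apply/rowP => j; rewrite mxE ltn_ord.
elim: k => [_|k IHk kn].
  rewrite (_ : h 0%N = p) ?subrr ?normr0 ?mulr_ge0 ?sumr_ge0//.
  by apply/rowP => j; rewrite mxE.
pose i := Ordinal kn.
have hS : h k.+1 = h k + (q ord0 i - p ord0 i) *: basis_rV R i.
  apply/rowP => j; rewrite coord_shift !mxE ltnS leq_eqVlt -(inj_eq val_inj j i) /=.
  case: eqVneq => [jk|_] /=; last by rewrite addr0.
  have -> : j = i by exact: val_inj.
  by rewrite ltnn addrC subrK.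
have hp j : `|p ord0 j - h k ord0 j| < r / 2.
  by rewrite mxE; case: ifPn => // _; rewrite subrr normr0 divr_gt0.
have step : `|f (h k.+1) - f (h k)| <= L * `|q ord0 i - p ord0 i|.
  rewrite hS; apply: (lip_coord r0 pD hp).
  by rewrite mxE ltnn addrCA subrr addr0.
rewrite (bigD1 i)//= (eq_bigl (fun j : 'I_n => (j < k)%N)); last first.
  move=> j; rewrite ltnS leq_eqVlt -(inj_eq val_inj j i) /=.
  by case: eqVneq => [->|_]; rewrite ?ltnn ?andbT.
have -> : f (h k.+1) - f p = (f (h k.+1) - f (h k)) + (f (h k) - f p) by ring.
by rewrite mulrDr (le_trans (ler_normD _ _))// lerD// IHk// ltnW.
Qed.

Lemma lipschitz_polyhedron (K : set 'rV[R]_n) x y :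
  open_convex_polyhedron K -> K `<=` D -> K x -> K y ->
  `|f y - f x| <= L * \sum_j `|y ord0 j - x ord0 j|.
Proof.
move=> pK KD Kx Ky; set N := \sum_j _.
have N0 : 0 <= N by exact: sumr_ge0.
pose seg (s : R) := x + s *: (y - x).
have := @pointwise_lipschitz R (f \o seg) (L * N) (mulr_ge0 L0 N0).
rewrite /seg /= scale1r scale0r addr0 (addrCA x) subrr addr0; apply => s s01.
have Dp : D (seg s) by apply: KD; exact: polyhedron_segment.
have /nbhs_rVP[r r0 pD] : nbhs (seg s) D by exact: open_nbhs_nbhs.
have N10 : 0 < N + 1 by lra.
exists (r / 2 / (N + 1)); first by rewrite !divr_gt0.
move=> s' s'01 ss'.
have coordE j : seg s' ord0 j - seg s ord0 j = (s' - s) * (y ord0 j - x ord0 j).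
  by rewrite /seg !mxE; ring.
have := @lip_cube (seg s) r (seg s') r0 pD; rewrite /seg => H.
have {H} : `|f (seg s') - f (seg s)| <= L * \sum_j `|seg s' ord0 j - seg s ord0 j|.
  apply: H => j; rewrite distrC coordE normrM.
  have jN : `|y ord0 j - x ord0 j| <= N + 1.
    by rewrite /N (bigD1 j)//= -addrA lerDl addr_ge0// sumr_ge0.
  apply: (@le_lt_trans _ _ (`|s' - s| * (N + 1))); first by rewrite ler_wpM2l.
  by rewrite -ltr_pdivlMr.
rewrite /seg; move/le_trans; apply.
rewrite -mulrA ler_wpM2l// /N mulr_suml; apply: ler_sum => j _.
by rewrite coordE normrM mulrC.
Qed.

End directional_to_lipschitz.

Lemma bounded_setS (R : realType) n (A B : set 'rV[R]_n) :
  A `<=` B -> bounded_set B -> bounded_set A.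
Proof. by move=> AB [r [rr Br]]; exists r; split=> // r' rr' x /AB; exact: Br. Qed.

Lemma bounded_closure (R : realType) n (A : set 'rV[R]_n) :
  bounded_set A -> bounded_set (closure A).
Proof.
move=> [r0 [rr Ar']]; exists r0; split => // r rr0 x Ax; rewrite /= leNgt; apply/negP => rx.
have xr0 : 0 < `|x| - r by rewrite subr_gt0.
have [y [Ay xy]] := Ax _ (nbhsx_ballx x _ xr0).
have := Ar' _ rr0 _ Ay; have := ler_distD y x 0.
move: xy; rewrite -ball_normE /= !subr0; lra.
Qed.

Section W1inf_lemmas.
Variables (R : realType) (n : nat) (D : set 'rV[R]_n) (w : W1inf D).
Hypotheses (oD : open D) (bD : bounded_set D).
Let mu := lebesgue_rV R n.

Lemma W1inf_norm_fin : W1inf_norm w \is a fin_num.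
Proof.
rewrite ge0_fin_numE /W1inf_norm.
  by rewrite gt_max (wfun_Linf w).2 (wgrad_bounded w).
by rewrite le_max Linf_norm_ge0.
Qed.

Lemma W1inf_norm_ge0 : 0 <= fine (W1inf_norm w).
Proof. by apply: fine_ge0; rewrite /W1inf_norm le_max Linf_norm_ge0. Qed.

Lemma W1inf_ae_bound : {ae mu, forall x, D x -> `|w x| <= fine (W1inf_norm w)}.
Proof.
have := Linf_norm_ae (wfun_Linf w).2; apply: filterS => x + Dx => /(_ Dx) H.
apply: (le_trans H); apply: fine_le => //; last by rewrite /W1inf_norm le_max lexx.
- by rewrite ge0_fin_numE ?Linf_norm_ge0//; exact: (wfun_Linf w).2.
- exact: W1inf_norm_fin.
Qed.

Lemma W1inf_bound x : closure D x -> `|w x| <= fine (W1inf_norm w).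
Proof.
move=> Dx; apply: (@ae_le_closure _ _ D w _ oD _ _ x Dx).
  exact: wfun_continuous.
exact: W1inf_ae_bound.
Qed.

Lemma W1inf_grad_ae :
  {ae mu, forall x, D x -> enorm (wgrad w x) <= fine (W1inf_norm w)}.
Proof.
have := Linf_norm_ae (wgrad_bounded w); apply: filterS => x + Dx => /(_ Dx) H.
rewrite ger0_norm ?enorm_ge0// in H.
apply: (le_trans H); apply: fine_le => //; last by rewrite /W1inf_norm le_max lexx orbT.
- by rewrite ge0_fin_numE ?Linf_norm_ge0//; exact: wgrad_bounded.
- exact: W1inf_norm_fin.
Qed.

Variable L : R.
Hypotheses (L0 : 0 <= L) (wL : {ae mu, forall x, D x -> enorm (wgrad w x) <= L}).

Lemma W1inf_lipschitz (K : set 'rV[R]_n) x y :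
  open_convex_polyhedron K -> K `<=` D -> K x -> K y ->
  `|w y - w x| <= L * \sum_j `|y ord0 j - x ord0 j|.
Proof.
apply: lipschitz_polyhedron => // i z t e t0 e0 box.
apply: (@weak_lipschitz_dir R n D w (fun z => wgrad w z ord0 i) i L
          (fine (W1inf_norm w))) box => //.
- exact: (wfun_Linf w).1.
- move=> y' Dy'; have := continuous_subspaceW (@subset_closure _ D) (@wfun_continuous _ _ _ w).
  by rewrite continuous_open_subspace// => /(_ y'); rewrite inE; exact.
- by move=> y' Dy'; apply: W1inf_bound; exact: subset_closure.
- exact: wgrad_measurable.
- by apply: filterS wL => y' + Dy' => /(_ Dy'); apply: le_trans; exact: coord_le_enorm.
- exact: wgradP.
Qed.

(** The factor n compares the l1 norm with the Euclidean norm. *)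
Lemma W1inf_osc (K : set 'rV[R]_n) x y :
  open_convex_polyhedron K -> K `<=` D -> closure K x -> closure K y ->
  `|w x - w y| <= L * n%:R * diam K.
Proof.
move=> pK KD cKx cKy.
have bK : bounded_set K by exact: bounded_setS KD bD.
have cKD : K `<=` closure D by move=> z /KD; exact: subset_closure.
have cKcD z : closure K z -> closure D z by exact: closure_subset.
apply/ler_addgt0Pl => e e0.
have e20 : 0 < e / 2 by rewrite divr_gt0.
have [x' Kx' xx'] := closure_approx (@wfun_continuous _ _ _ w) cKD (cKcD _ cKx) cKx e20.
have [y' Ky' yy'] := closure_approx (@wfun_continuous _ _ _ w) cKD (cKcD _ cKy) cKy e20.
have xy' : `|w x' - w y'| <= L * n%:R * diam K.
  apply: (le_trans (W1inf_lipschitz pK KD Ky' Kx')).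
  rewrite -mulrA ler_wpM2l// mulr_natl -[n in _ *+ n]card_ord -sumr_const.
  apply: ler_sum => j _; apply: le_trans (enorm_le_diam bK Kx' Ky').
  by apply: le_trans (coord_le_enorm _ j); rewrite !mxE.
have -> : w x - w y = (w x - w x') + (w x' - w y') - (w y - w y') by ring.
apply: (le_trans (ler_normB _ _)).
apply: (le_trans (lerD (ler_normD _ _) (lexx _))); lra.
Qed.

End W1inf_lemmas.

Section average.
Context d (T : measurableType d) (R : realType) (mu : {measure set T -> \bar R}).

Lemma average_ae (S : set T) (f : T -> R) (c e : R) :
  measurable S -> (0 < mu S)%E -> (mu S < +oo)%E -> measurable_fun S f ->
  0 <= e -> {ae mu, forall x, S x -> `|f x - c| <= e} ->
  `|(\int[mu]_(x in S) f x) / fine (mu S) - c| <= e.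
Proof.
move=> mS S0 Soo mf e0 fce.
have muS : mu S \is a fin_num by rewrite ge0_fin_numE.
have m0 : 0 < fine (mu S) by rewrite fine_gt0// S0.
have ione k : mu.-integrable S (EFin \o (fun=> k)).
  apply/integrableP; split; first exact/measurable_EFinP.
  by rewrite /= integral_cst// lte_mul_pinfty.
have intf : mu.-integrable S (EFin \o f).
  apply/integrableP; split; first exact/measurable_EFinP.
  apply: (@le_lt_trans _ _ (\int[mu]_(x in S) (`|c| + e)%:E)%E).
    apply: ae_ge0_le_integral => //.
    - by apply: measurableT_comp => //; exact/measurable_EFinP.
    - by move=> x _; rewrite lee_fin addr_ge0.
    - apply: filterS fce => x + Sx => /(_ Sx) H; rewrite /= lee_fin.
      by rewrite -[f x](subrK c) (le_trans (ler_normD _ _))// addrC lerD2l.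
  by have /fin_numPlt/andP[] := integrable_fin_num mS (ione (`|c| + e)).
have -> : (\int[mu]_(x in S) f x) / fine (mu S) - c =
    (\int[mu]_(x in S) ((f x - c) * 1)) / fine (mu S).
  rewrite [in RHS](@eq_Rintegral _ _ _ _ _ (fun x => f x - c)); last first.
    by move=> x _; rewrite mulr1.
  rewrite RintegralB// Rintegral_cst// mulrBl mulfK// gt_eqF//.
rewrite normrM normfV (gtr0_norm m0) ler_pdivrMr//.
have := @Rintegral_le_ae _ _ _ mu S (fun x => f x - c) (fun=> 1) e mS.
rewrite Rintegral_cst// mul1r; apply => //.
by apply: measurable_funB.
Qed.

End average.

(** * Statistics functions and relative entropies *)

Section statistics_lemmas.
Variables (R : realType) (I : set R) (F : statistics I).
Hypothesis I_itv : forall x y z, I x -> I y -> x <= z <= y -> I z.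
Implicit Types x y : R.

Lemma stat_lt x y : x < y -> F x < F y.
Proof.
move=> xy; apply: (@gtr0_derive1_incr _ F x y) => //.
- by move=> z _; exact: stat_derivable.
- by move=> z _; exact: stat_derive_gt0.
- apply: derivable_within_continuous => z _; exact: stat_derivable.
Qed.

Lemma stat_inv_le x y : I x -> I y -> x <= y -> stat_inv F x <= stat_inv F y.
Proof.
move=> Ix Iy xy; rewrite leNgt; apply/negP => /stat_lt.
by rewrite !stat_invK// ltNge xy.
Qed.

(** Convexity: the derivative [stat_inv F] of [stat_antider F] is nondecreasing. *)
Lemma antider_tangent x y : I x -> I y ->
  stat_antider F x + stat_inv F x * (y - x) <= stat_antider F y.
Proof.
move=> Ix Iy.
have dA z : I z -> is_derive z (1 : R) (stat_antider F) (stat_inv F z).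
  exact: stat_antiderP.
have cA a b : I a -> I b -> {within `[a, b], continuous (stat_antider F)}.
  move=> Ia Ib; apply: derivable_within_continuous => z.
  by rewrite in_itv /= => ab; apply: ex_derive; apply: dA; exact: I_itv ab.
have IA a b z : I a -> I b -> z \in `]a, b[ -> I z.
  by move=> Ia Ib; rewrite in_itv /= => /andP[/ltW az /ltW zb]; apply: (I_itv Ia Ib); rewrite az.
have [xy|yx|->] := ltgtP x y.
- have [||c /[dup] cxy] := @MVT _ (stat_antider F) (stat_inv F) x y xy.
  + by move=> z /(IA _ _ _ Ix Iy); exact: dA.
  + exact: cA.
  rewrite in_itv /= => /andP[xc cy] E.
  rewrite -lerBrDl E; apply: ler_wpM2r; first by rewrite subr_ge0 ltW.
  by apply: stat_inv_le; rewrite ?ltW//; exact: IA cxy.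
- have [||c /[dup] cxy] := @MVT _ (stat_antider F) (stat_inv F) y x yx.
  + by move=> z /(IA _ _ _ Iy Ix); exact: dA.
  + exact: cA.
  rewrite in_itv /= => /andP[yc cx] E.
  have H : stat_inv F c * (x - y) <= stat_inv F x * (x - y).
    apply: ler_wpM2r; first by rewrite subr_ge0 ltW.
    by apply: stat_inv_le; rewrite ?ltW//; exact: IA cxy.
  lra.
- by rewrite subrr mulr0 addr0.
Qed.

Lemma rel_entropyE x y : I y -> rel_entropy F x y =
  stat_antider F x - stat_antider F y - stat_inv F y * (x - y).
Proof.
move=> Iy; rewrite /rel_entropy derive1E; congr (_ - _ * _).
by have H := @stat_antiderP _ _ F y Iy; rewrite derive_val.
Qed.

Lemma rel_entropy_ge0 x y : I x -> I y -> 0 <= rel_entropy F x y.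
Proof.
by move=> Ix Iy; rewrite rel_entropyE//; have := antider_tangent Iy Ix; lra.
Qed.

Lemma rel_entropy_diff x x' y : I x -> I x' -> I y ->
  rel_entropy F x y - rel_entropy F x' y <=
  (stat_inv F x - stat_inv F y) * (x - x').
Proof.
by move=> Ix Ix' Iy; rewrite !rel_entropyE//; have := antider_tangent Ix Ix'; lra.
Qed.

Lemma rel_entropy_anti x y b : I x -> I y -> I b -> y <= b -> b <= x ->
  rel_entropy F x b <= rel_entropy F x y.
Proof.
move=> Ix Iy Ib yb bx; rewrite !rel_entropyE//.
have h1 := antider_tangent Iy Ib.
have h2 : 0 <= (stat_inv F b - stat_inv F y) * (x - b).
  by rewrite mulr_ge0 ?subr_ge0// stat_inv_le.
lra.
Qed.

End statistics_lemmas.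

Lemma pos_axis_itv (R : realType) (x y z : R) :
  @pos_axis R x -> @pos_axis R y -> x <= z <= y -> @pos_axis R z.
Proof.
rewrite /pos_axis /= !in_itv /= !andbT => x0 _ /andP[xz _]; exact: lt_le_trans xz.
Qed.

Lemma open_unit_itv (R : realType) (x y z : R) :
  @open_unit R x -> @open_unit R y -> x <= z <= y -> @open_unit R z.
Proof.
rewrite /open_unit /= !in_itv /= => /andP[x0 _] /andP[_ y1] /andP[xz zy].
by rewrite (lt_le_trans x0 xz) (le_lt_trans zy y1).
Qed.

Lemma pos_axisE (R : realType) (x : R) : @pos_axis R x = (0 < x).
Proof. by rewrite /pos_axis /= in_itv /= andbT. Qed.

(** Superlinearity of the entropy, uniformly in the reference density y <= b:
  the entropy decreases in y as long as y <= x, so y = b is the worst case. *)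
Lemma entropy_dominates (R : realType) (F : statistics (@pos_axis R)) (b e : R) :
  superlinear_entropy F -> 0 < b -> 0 < e ->
  exists2 C : R, 0 <= C & forall x y, 0 < x -> 0 < y -> y <= b ->
    x <= C + e * rel_entropy F x y /\ stat_inv F x <= C + e * rel_entropy F x y.
Proof.
move=> supF b0 e0.
have Ib : @pos_axis R b by rewrite pos_axisE.
have tang x y : 0 < x -> 0 < y ->
    stat_antider F x + stat_inv F x * (y - x) <= stat_antider F y.
  by move=> x0 y0; apply: antider_tangent; rewrite ?pos_axisE//; exact: pos_axis_itv.
have H0 x y : 0 < x -> 0 < y -> 0 <= rel_entropy F x y.
  by move=> x0 y0; apply: rel_entropy_ge0; rewrite ?pos_axisE//; exact: pos_axis_itv.
have Hb x y : 0 < y -> y <= b -> b <= x -> rel_entropy F x b <= rel_entropy F x y.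
  move=> y0 yb bx; apply: rel_entropy_anti => //; rewrite ?pos_axisE//; last first.
    exact: lt_le_trans bx.
  exact: pos_axis_itv.
(* from the density x1 on, the slope of the entropy relative to b is at least 1 / e *)
pose x1 := F (stat_inv F b + e^-1).
have x10 : 0 < x1 by have := stat_range F (stat_inv F b + e^-1); rewrite pos_axisE.
have b1 : b <= x1.
  rewrite -[b](stat_invK F)// ltW// stat_lt// ltrDl invr_gt0//.
have [X [Xr HX]] : \forall x \near +oo, e^-1 <= rel_entropy F x b / stat_inv F x.
  by move/cvgryPge : (supF b b0); apply.
pose X' := `|X| + b.
have X'0 : 0 < X' by rewrite ltr_wpDl.
have b_le x y : 0 < x -> 0 < y -> y <= b -> b <= x -> x1 <= x ->
    x <= x1 + e * rel_entropy F x y.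
  move=> x0 y0 yb bx x1x.
  have h1 := tang x1 x x10 x0.
  have h2 := tang b x1 b0 x10.
  have h3 := Hb _ _ y0 yb bx.
  have invx1 : stat_inv F x1 = stat_inv F b + e^-1 by rewrite /x1 statK.
  have h4 : e^-1 * (x - x1) <= rel_entropy F x b.
    by rewrite rel_entropyE//; rewrite invx1 in h1; lra.
  by rewrite -lerBlDl -ler_pdivrMl// (le_trans h4 h3).
exists (x1 + `|stat_inv F X'|); first by rewrite addr_ge0 ?(ltW x10).
move=> x y x0 y0 yb; have Hxy := mulr_ge0 (ltW e0) (H0 _ _ x0 y0).
have nX' := normr_ge0 (stat_inv F X'); split.
  have [xx1|x1x] := leP x x1; first by lra.
  by have := b_le x y x0 y0 yb (le_trans b1 (ltW x1x)) (ltW x1x); lra.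
have [xX|Xx] := leP x X'.
  have : stat_inv F x <= stat_inv F X' by apply: stat_inv_le => //; rewrite pos_axisE.
  by have := ler_norm (stat_inv F X'); lra.
have [ix0|ix0] := leP (stat_inv F x) 0; first by lra.
have bx : b <= x by have := normr_ge0 X; rewrite /X' in Xx; lra.
have XX : X < x by have := ler_norm X; rewrite /X' in Xx; lra.
have := HX _ XX; rewrite ler_pdivlMr// ler_pdivrMl// => h.
have := ler_wpM2l (ltW e0) (Hb _ _ y0 yb bx); lra.
Qed.

(** * The Bernoulli function and the Scharfetter-Gummel flux *)

Section bernoulli_lemmas.
Variable R : realType.
Implicit Types x y q w : R.

Let expR_neq1 x : x != 0 -> expR x - 1 != 0.
Proof. by move=> x0; rewrite subr_eq0 -expR0 (inj_eq (@expR_inj R)). Qed.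

Let expR_tangent x y : expR x * (1 + y - x) <= expR y.
Proof.
have -> : expR y = expR (y - x) * expR x by rewrite -expRD subrK.
rewrite mulrC ler_wpM2r ?expR_ge0//.
by apply: le_trans (expR_ge1Dx _); rewrite addrA.
Qed.

Lemma bernoulli_gt0 x : 0 < bernoulli x.
Proof.
rewrite /bernoulli; case: eqVneq => // x0.
have [h|h|h] := ltgtP x 0; last by rewrite h eqxx in x0.
  by rewrite nmulr_rgt0// invr_lt0 subr_lt0 expR_lt1.
by rewrite divr_gt0// subr_gt0 expR_gt1.
Qed.

Lemma bernoulliN x : bernoulli (- x) = expR x * bernoulli x.
Proof.
rewrite /bernoulli oppr_eq0; case: eqVneq => [->|x0]; first by rewrite expR0 mulr1.
have := expR_neq1 x0 => h1; have ex := expR_gt0 x.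
rewrite expRN; field.
rewrite h1 (gt_eqF ex) /= ; apply: contra h1 => /eqP h.
by apply/eqP; lra.
Qed.

Let bernoulli_le1 x : 0 <= x -> bernoulli x <= 1.
Proof.
rewrite /bernoulli; case: eqVneq => // xn0 x0.
have x_gt0 : 0 < x by rewrite lt_neqAle eq_sym xn0.
rewrite ler_pdivrMr ?mul1r ?subr_gt0 ?expR_gt1//.
by have := expR_ge1Dx x; lra.
Qed.

Let bernoulli_ge1 x : x <= 0 -> 1 <= bernoulli x.
Proof.
rewrite /bernoulli; case: eqVneq => // xn0 x0.
have x_lt0 : x < 0 by rewrite lt_neqAle xn0.
rewrite ler_ndivlMr ?mul1r ?subr_lt0 ?expR_lt1//.
by have := expR_ge1Dx x; lra.
Qed.

(** The reciprocal of [bernoulli] is the slope of the chord of exp between 0 and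
  x, which is nondecreasing since exp lies above its tangents. *)
Lemma bernoulli_nincr w q : w <= q -> bernoulli q <= bernoulli w.
Proof.
move=> wq; have [w0|w0] := leP w 0.
  have [q0|q0] := leP 0 q.
    exact: le_trans (bernoulli_le1 q0) (bernoulli_ge1 w0).
  have w_lt0 : w < 0 by lra.
  rewrite /bernoulli !lt_eqF//.
  rewrite ler_ndivrMr ?subr_lt0 ?expR_lt1// mulrAC ler_ndivrMr ?subr_lt0 ?expR_lt1//.
  have h1 := expR_tangent q w.
  have h2 := expR_tangent q 0; rewrite expR0 in h2.
  have h3 : q * (expR w - expR q * (1 + w - q)) <= 0.
    by rewrite nmulr_rle0// subr_ge0.
  have h4 : 0 <= (q - w) * (1 - expR q * (1 + 0 - q)).
    by rewrite mulr_ge0// subr_ge0.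
  lra.
have q0 : 0 < q by lra.
rewrite /bernoulli !gt_eqF//.
rewrite ler_pdivrMr ?subr_gt0 ?expR_gt1// mulrAC ler_pdivlMr ?subr_gt0 ?expR_gt1//.
have h1 := expR_tangent w q.
have h2 := expR_tangent w 0; rewrite expR0 in h2.
have h3 : 0 <= w * (expR q - expR w * (1 + q - w)).
  by rewrite mulr_ge0 ?subr_ge0// ltW.
have h4 : 0 <= (q - w) * (1 - expR w * (1 + 0 - w)).
  by rewrite mulr_ge0// subr_ge0.
lra.
Qed.

Let bernoulli_ratio w : w != 0 -> (expR w - 1) / w = (bernoulli w)^-1.
Proof. by move=> w0; rewrite /bernoulli (negbTE w0) invf_div. Qed.

(** The numerator N of the Scharfetter-Gummel flux equals
  a B(q) (exp w - 1) = b B(-q) (1 - exp (-w)).  Hence N / w is both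
  a B(q) / B(w) and b B(-q) / B(-w); the first is used if b < a, that is w < q, and
  the second otherwise. *)
Lemma Sch_Gum_bounds (a b w : R) : 0 < a -> 0 < b ->
  let q := w - (ln b - ln a) in
  let N := bernoulli (- q) * b - bernoulli q * a in
  (w = 0 -> N = 0) /\ (w != 0 -> 0 <= N / w <= Num.max a b).
Proof.
move=> a0 b0 q N.
have eq : expR q * b = expR w * a.
  rewrite /q expRB expRB !lnK ?posrE//; field.
  by rewrite !gt_eqF.
have NE : N = a * bernoulli q * (expR w - 1).
  by rewrite /N bernoulliN mulrAC eq; ring.
have NE' : N = b * bernoulli (- q) * ((expR (- w) - 1) * -1).
  have e1 : expR (- q) * a = expR (- w) * b.
    rewrite !expRN; have := expR_gt0 q => q1; have := expR_gt0 w => w1.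
    apply: (mulfI (lt0r_neq0 q1)); apply: (mulfI (lt0r_neq0 w1)).
    rewrite [LHS](_ : _ = expR w * a); last by field; rewrite gt_eqF.
    by rewrite -eq; field; rewrite gt_eqF.
  have Bq : bernoulli q = expR (- q) * bernoulli (- q) by rewrite -bernoulliN opprK.
  by rewrite /N Bq (mulrAC (expR (- q))) e1; ring.
split=> [w0|w0]; first by rewrite NE w0 expR0 subrr mulr0.
have Bw := bernoulli_gt0 w; have BNw := bernoulli_gt0 (- w).
have Bq := bernoulli_gt0 q; have BNq := bernoulli_gt0 (- q).
have E1 : N / w = a * (bernoulli q / bernoulli w).
  by rewrite NE -mulrA bernoulli_ratio// mulrA.
have E2 : N / w = b * (bernoulli (- q) / bernoulli (- w)).
  rewrite NE' -[in RHS](bernoulli_ratio (_ : - w != 0)) ?oppr_eq0//.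
  by rewrite invrN; ring.
apply/andP; split; first by rewrite E1 mulr_ge0 ?divr_ge0// ltW.
rewrite le_max; have [ab|ba] := leP a b; apply/orP.
  right; rewrite E2 ler_piMr ?(ltW b0)// ler_pdivrMr// mul1r bernoulli_nincr// lerN2.
  by rewrite /q gerBl subr_ge0 ler_ln.
left; rewrite E1 ler_piMr ?(ltW a0)// ler_pdivrMr// mul1r bernoulli_nincr//.
by rewrite /q lerBrDl gerDr subr_le0 ler_ln// ltW.
Qed.

End bernoulli_lemmas.

(** * Geometry of the mesh *)

Lemma sum_measure_le d (T : measurableType d) (R : realType)
    (mu : {measure set T -> \bar R}) (I : finType) (F : I -> set T) (E : set T) :
  (forall i, measurable (F i)) -> (forall i j, i != j -> F i `&` F j = set0) ->
  measurable E -> (forall i, F i `<=` E) -> (\sum_i mu (F i) <= mu E)%E.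
Proof.
move=> mF F0 mE FE.
have H (s : seq I) : uniq s ->
    (\sum_(i <- s) mu (F i) = mu (\big[setU/set0]_(i <- s) F i))%E.
  elim: s => [_|i s IHs /= /andP[is_ us]]; first by rewrite !big_nil measure0.
  rewrite !big_cons IHs// measureU//.
    exact: bigsetU_measurable.
  rewrite -bigcup_seq setI_bigcupr bigcup0// => j /= js; apply: F0.
  by apply: contraNneq is_ => ->.
rewrite H ?index_enum_uniq//; apply: le_measure; rewrite ?inE//.
  exact: bigsetU_measurable.
by rewrite -bigcup_seq; apply: bigcup_sub => i _.
Qed.

Lemma cvg_rVP (R : realType) (T : Type) (G : set_system T) n (h : T -> 'rV[R]_n)
    (x : 'rV[R]_n) : Filter G ->
  (forall i, h y ord0 i @[y --> G] --> x ord0 i) -> h @ G --> x.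
Proof.
move=> FG hx A /nbhs_rVP[e e0 xA].
have near_i i : \forall y \near G, `|x ord0 i - h y ord0 i| < e.
  by have /cvgrPdist_lt := hx i; apply.
have near_all : \forall y \near G, forall i, `|x ord0 i - h y ord0 i| < e.
  exact: filter_forall.
rewrite nbhs_filterE; apply: filterS near_all => y hy; exact: xA.
Qed.

Section chart_lemmas.
Variables (R : realType) (n : nat) (o : 'rV[R]_n.+1) (Q : 'M[R]_(n, n.+1)).

Lemma chart_continuous : continuous (chart o Q).
Proof.
move=> v; apply: (@cvg_rVP R _ (nbhs v)) => j.
have -> : (fun v : 'rV[R]_n => chart o Q v ord0 j) =
    (fun v => o ord0 j + \sum_(k < n) v ord0 k * Q k j).
  by apply/funext => u; rewrite /chart !mxE.
rewrite /chart !mxE.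
have sum_cont : continuous (fun v : 'rV[R]_n => \sum_(k < n) v ord0 k * Q k j).
  elim: (index_enum _) => [|k s IHs].
    rewrite (_ : (fun y : 'rV[R]_n => _) = cst 0); last first.
      by apply/funext => y; rewrite big_nil.
    exact: cst_continuous.
  rewrite (_ : (fun y : 'rV[R]_n => _) =
      (fun y : 'rV[R]_n => y ord0 k * Q k j) \+
      (fun y : 'rV[R]_n => \sum_(k <- s) y ord0 k * Q k j)); last first.
    by apply/funext => y; rewrite big_cons.
  move=> x; apply: continuousD; last exact: IHs.
  apply: (@continuousM _ _ (fun y : 'rV[R]_n => y ord0 k) (cst (Q k j))).
    exact: coord_continuous.
  exact: cst_continuous.
have := @continuousD _ _ _ (cst (o ord0 j)) _ v (@cst_continuous _ _ _ v) (sum_cont v).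
exact.
Qed.

(** The coordinates are recovered from a point x of the hyperplane as (x - o) Q^T. *)
Lemma chart_box (S : set 'rV[R]_n.+1) : orthonormal_rows Q -> bounded_set S ->
  exists2 r : R, 0 < r & chart o Q @^-1` S `<=` [set v | forall i, `|v ord0 i| <= r].
Proof.
move=> QQ /bounded_rV_box[r r0 Sr].
pose r' := 1 + \sum_i \sum_j (r + `|o ord0 j|) * `|Q i j|.
have t0 i j : 0 <= (r + `|o ord0 j|) * `|Q i j|.
  by rewrite mulr_ge0// addr_ge0// ltW.
exists r'; first by rewrite ltr_wpDr// sumr_ge0// => i _; rewrite sumr_ge0.
move=> v Sv i /=.
have vE : v ord0 i = \sum_j (chart o Q v - o) ord0 j * Q i j.
  have : (chart o Q v - o) *m Q^T = v.
    by rewrite /chart addrC addKr -mulmxA QQ mulmx1.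
  move=> {1}<-; rewrite !mxE; apply: eq_bigr => j _; by rewrite !mxE.
rewrite vE (le_trans (ler_norm_sum _ _ _))// /r' (bigD1 i)//=.
have : \sum_j `|(chart o Q v - o) ord0 j * Q i j| <= \sum_j (r + `|o ord0 j|) * `|Q i j|.
  apply: ler_sum => j _; rewrite normrM ler_wpM2r// mxE.
  by rewrite (le_trans (ler_normD _ _))// [X in _ + `|X|]mxE normrN lerD2r; exact: Sr.
have : 0 <= \sum_(k < n | k != i) \sum_j (r + `|o ord0 j|) * `|Q k j|.
  by apply: sumr_ge0 => k _; apply: sumr_ge0.
lra.
Qed.

Lemma chart_preimage_closed (S : set 'rV[R]_n.+1) : closed S -> closed (chart o Q @^-1` S).
Proof. by move=> cS; apply: preimage_closed => // x _; exact: chart_continuous. Qed.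

Lemma surface_measure_lty (S : set 'rV[R]_n.+1) : orthonormal_rows Q ->
  bounded_set S -> closed S -> (surface_measure o Q S < +oo)%E.
Proof.
move=> QQ bS cS; have [r r0 Sr] := chart_box QQ bS.
apply: lebesgue_rV_lty; last by apply: closed_measurable_rV; exact: chart_preimage_closed.
exists r; split; first exact: num_real.
move=> r' rr' v Sv /=.
rewrite [leLHS]/Num.norm /= mx_normrE; apply: bigmax_le; first by rewrite ltW// (lt_trans r0).
by move=> [i j] _ /=; rewrite (ord1 i) (le_trans (Sr _ Sv j))// ltW.
Qed.

End chart_lemmas.

Section mesh_geometry.
Variables (R : realType) (n : nat) (V : device R n) (M : mesh V).
Implicit Types (K : cell M) (s : face M).
Let mu := lebesgue_rV R n.+1.

Lemma cset_open K : open (cset K).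
Proof. exact: open_polyhedron (cset_polyhedron K). Qed.

Lemma cset_bounded K : bounded_set (cset K).
Proof. exact: bounded_setS (@cset_sub _ _ _ _ K) (Omega_bounded V). Qed.

Lemma measurable_cset K : measurable (cset K).
Proof. by apply: open_measurable_rV; exact: cset_open. Qed.

Lemma measure_cset_gt0 K : (0 < mu (cset K))%E.
Proof. by apply: lebesgue_rV_open_gt0; [exact: cset_open|exact: cset_neq0]. Qed.

Lemma measure_cset_lty K : (mu (cset K) < +oo)%E.
Proof. by apply: lebesgue_rV_lty; [exact: cset_bounded|exact: measurable_cset]. Qed.

Lemma m_cell_gt0 K : 0 < m_cell K.
Proof. by apply: fine_gt0; rewrite measure_cset_gt0 measure_cset_lty. Qed.

Lemma measure_Omega_lty : (mu (Omega V) < +oo)%E.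
Proof.
apply: lebesgue_rV_lty; first exact: Omega_bounded.
by apply: open_measurable_rV; exact: Omega_open.
Qed.

Lemma sum_m_cell_le : \sum_(K : cell M) m_cell K <= fine (mu (Omega V)).
Proof.
have fin_cell K : mu (cset K) \is a fin_num.
  by rewrite ge0_fin_numE//; exact: measure_cset_lty.
have mOmega : measurable (Omega V) by apply: open_measurable_rV; exact: Omega_open.
have := @sum_measure_le _ _ _ mu _ _ _ measurable_cset (@cset_disjoint _ _ _ M)
  mOmega (@cset_sub _ _ _ M).
rewrite (eq_bigr (fun K => (m_cell K)%:E)) => [|K _]; last by rewrite /m_cell fineK.
rewrite sumEFin -[X in (_ <= X)%E]fineK ?lee_fin// ge0_fin_numE//.
exact: measure_Omega_lty.
Qed.

Lemma own_face s : is_face_of s (own s).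
Proof. by rewrite /is_face_of eqxx. Qed.

Lemma opp_face s K : Defs.opp s = Some K -> is_face_of s K.
Proof. by rewrite /is_face_of => ->; rewrite eqxx orbT. Qed.

Lemma fset_closure s K : is_face_of s K -> fset s `<=` closure (cset K).
Proof.
move=> sK x sx; have : boundary (cset K) x by rewrite cset_boundary; exists s.
by case.
Qed.

Lemma fset_neq0 s : fset s !=set0.
Proof.
apply/set0P; apply/negP => /eqP s0; have := fset_measure_gt0 s.
by rewrite /surface_measure s0 preimage_set0 measure0 ltxx.
Qed.

Lemma fset_bounded s : bounded_set (fset s).
Proof.
apply: (@bounded_setS _ _ _ (closure (Omega V))); first exact: fset_sub.
by apply: bounded_closure; exact: Omega_bounded.
Qed.

Lemma surface_fset_lty s : (surface_measure (origin s) (frame s) (fset s) < +oo)%E.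
Proof.
by apply: surface_measure_lty; [exact: frame_orthonormal|exact: fset_bounded|exact: fset_closed].
Qed.

Lemma m_face_gt0 s : 0 < m_face s.
Proof. by apply: fine_gt0; rewrite fset_measure_gt0 surface_fset_lty. Qed.

Lemma diam_cset_ge0 K : 0 <= diam (cset K).
Proof. by apply: diam_ge0; [exact: cset_bounded|exact: cset_neq0]. Qed.

Section averages.
Variables (w : W1inf (Omega V)).

Lemma cell_average_near K (c e : R) : 0 <= e ->
  (forall x, cset K x -> `|w x - c| <= e) -> `|cell_average w K - c| <= e.
Proof.
move=> e0 wc; apply: average_ae => //.
- exact: measurable_cset.
- exact: measure_cset_gt0.
- exact: measure_cset_lty.
- apply: measurable_funS (wfun_Linf w).1; last exact: cset_sub.
  by apply: open_measurable_rV; exact: Omega_open.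
- by apply: aeW => x; exact: wc.
Qed.

Lemma face_average_near s (c e : R) : 0 <= e ->
  (forall x, fset s x -> `|w x - c| <= e) -> `|face_average w s - c| <= e.
Proof.
move=> e0 wc.
pose S := chart (origin s) (frame s) @^-1` fset s.
have cS : closed S by apply: chart_preimage_closed; exact: fset_closed.
have mS : measurable S by exact: closed_measurable_rV.
apply: (@average_ae _ _ _ (lebesgue_rV R n) S) => //.
- exact: fset_measure_gt0.
- exact: surface_fset_lty.
- apply: measurable_fun_within => //; apply/subspace_continuousP => v Sv.
  have /subspace_continuousP/(_ _ (@fset_sub _ _ _ M s _ Sv)) wv := @wfun_continuous _ _ _ w.
  move=> A /wv; rewrite /= nbhs_filterE => wA.
  have cA : nbhs v [set u | closure (Omega V) (chart (origin s) (frame s) u) ->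
      A (w (chart (origin s) (frame s) u))].
    exact: (@chart_continuous R n (origin s) (frame s) v _ wA).
  apply: (@filterS _ (nbhs v) _ _ _ _ cA) => u /= uA Su; apply: uA.
  exact: (@fset_sub _ _ _ M s _ Su).
- by apply: aeW => v Sv; exact: wc.
Qed.

Lemma cell_average_bound K : `|cell_average w K| <= fine (W1inf_norm w).
Proof.
rewrite -[cell_average w K]subr0; apply: cell_average_near; first exact: W1inf_norm_ge0.
move=> x Kx; rewrite subr0; apply: W1inf_bound; first exact: Omega_open.
by apply: subset_closure; exact: (@cset_sub _ _ _ M K x Kx).
Qed.

Lemma face_average_bound s : `|face_average w s| <= fine (W1inf_norm w).
Proof.
rewrite -[face_average w s]subr0; apply: face_average_near; first exact: W1inf_norm_ge0.
move=> x sx; rewrite subr0; apply: W1inf_bound; first exact: Omega_open.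
exact: (@fset_sub _ _ _ M s x sx).
Qed.

(** The averages of w over cells and faces.  The grid functions [psiD_grid] and
  [phiD_grid] are of this form. *)
Definition W1inf_grid : gridfun M :=
  {| at_cell := cell_average w; at_face := face_average w |}.

(** The two values that a jump compares are averages of w over sets contained in
  the closure of a cell adjacent to s; they differ from the value of w at a common
  point y of the face by at most the oscillation of w on that closure. *)
Lemma W1inf_jump s (L xi : R) : 0 <= L -> 0 < xi -> regular_mesh M xi ->
  {ae mu, forall x, Omega V x -> enorm (wgrad w x) <= L} ->
  `|jump W1inf_grid (own s) s| <= 2 * (L * n.+1%:R) * (d_face s / xi).
Proof.
move=> L0 xi0 [reg _] wL.
have [y sy] := fset_neq0 s.
set B := _ * _.
have Ln0 : 0 <= L * n.+1%:R by rewrite mulr_ge0.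
have osc K x : is_face_of s K -> closure (cset K) x ->
    `|w x - w y| <= L * n.+1%:R * (d_face s / xi).
  move=> sK Kx; apply: (@le_trans _ _ (L * n.+1%:R * diam (cset K))).
    apply: (W1inf_osc (@Omega_open _ _ V) (Omega_bounded V) L0 wL (cset_polyhedron K)) => //.
      exact: cset_sub.
    exact: fset_closure sy.
  by rewrite ler_wpM2l// ler_pdivlMr// mulrC; exact: reg.
have d0 : 0 <= L * n.+1%:R * (d_face s / xi).
  by apply: le_trans (osc (own s) y (own_face s) (fset_closure (own_face s) sy)).
have cellB K : is_face_of s K ->
    `|cell_average w K - w y| <= L * n.+1%:R * (d_face s / xi).
  move=> sK; apply: cell_average_near => // x Kx; apply: osc sK _.
  exact: subset_closure.
have faceB : `|face_average w s - w y| <= L * n.+1%:R * (d_face s / xi).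
  apply: face_average_near => // x sx; apply: (osc _ _ (own_face s)).
  exact: fset_closure (own_face s) _ sx.
have B0 : 0 <= B by rewrite /B -mulrA mulr_ge0.
have two a : `|a - w y| <= L * n.+1%:R * (d_face s / xi) ->
    `|a - cell_average w (own s)| <= B.
  move=> ay; have -> : a - cell_average w (own s) =
    (a - w y) - (cell_average w (own s) - w y) by ring.
  rewrite (le_trans (ler_normB _ _))// (le_trans (lerD ay (cellB _ (own_face s))))//.
  by rewrite /B; lra.
rewrite /jump; case: ifPn => _; last by rewrite normr0.
apply: two; rewrite /across /neighbour eqxx /=.
by case E : (Defs.opp s) => [K|] //=; apply: cellB; exact: opp_face.
Qed.

End averages.

(** A face that meets the intrinsic layer inside separates two cells of it:
  each adjacent cell meets the open layer, whose closure is covered by the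
  closures of the intrinsic cells, and distinct open cells are disjoint. *)
Lemma interior_intr_faceP s : interior_intr_face s ->
  Defs.opp s != None /\ forall K, is_face_of s K -> K \in intr_cells M.
Proof.
move=> /asboolP[s_intr] /existsNP[x] /not_implyP[sx nbx].
have Ox : Omega_intr V x.
  apply: contrapT => nOx; apply: nbx; split; first exact: s_intr.
  by move=> /interior_subset.
split.
  apply/eqP => /opp_none s_bnd; have [_ nint] := s_bnd _ sx; apply: nint.
  apply: open_nbhs_nbhs; split; first exact: Omega_open.
  by apply: layers_sub; left; left.
move=> K sK.
have [z [Kz Oz]] : (cset K `&` Omega_intr V) !=set0.
  apply: (fset_closure sK sx); apply: open_nbhs_nbhs; split=> //; exact: intr_open.
have : closure (Omega_intr V) z by exact: subset_closure.
rewrite (intr_cover M) => -[L /= Lin Lz].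
have [<-//|KL] := eqVneq L K.
have [z' [Lz' Kz']] : (cset L `&` cset K) !=set0.
  by apply: Lz; apply: open_nbhs_nbhs; split => //; exact: cset_open.
by have : (cset L `&` cset K) z' by []; rewrite (cset_disjoint KL).
Qed.

End mesh_geometry.

Section Linf_average.
Variables (R : realType) (n : nat) (V : device R n) (M : mesh V).
Let mu := lebesgue_rV R n.+1.

Lemma cell_average_ae (g : 'rV[R]_n.+1 -> R) (K : cell M) (c e : R) :
  measurable_fun (Omega V) g -> 0 <= e ->
  {ae mu, forall x, Omega V x -> `|g x - c| <= e} -> `|cell_average g K - c| <= e.
Proof.
move=> mg e0 gc; apply: average_ae => //.
- exact: measurable_cset.
- exact: measure_cset_gt0.
- exact: measure_cset_lty.
- apply: measurable_funS mg; last exact: cset_sub.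
  by apply: open_measurable_rV; exact: Omega_open.
- by apply: filterS gc => x H Kx; apply: H; exact: (@cset_sub _ _ _ M K x Kx).
Qed.

End Linf_average.

(** * Discrete calculus *)

Section discrete_calculus.
Variables (R : realType) (n : nat) (V : device R n) (M : mesh V).
Implicit Types (K : cell M) (s : face M) (u v : gridfun M).

(** Each face is seen once from [own s] and, if it is interior, once from [opp s]. *)
Lemma sum_faces_cells (h : cell M -> face M -> R) :
  \sum_K \sum_(s | is_face_of s K) h K s =
  \sum_s (h (own s) s + if Defs.opp s is Some L then h L s else 0).
Proof.
rewrite (exchange_big_dep predT)//=; apply: eq_bigr => s _.
rewrite (bigD1 (own s)) /= ?own_face//; congr (_ + _).
case E : (Defs.opp s) => [L|].
  have [oL _ _] := opp_some E.
  rewrite (big_pred1 L)// => K; rewrite /is_face_of E /=.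
  rewrite [own s == K]eq_sym; have [->|KL] := eqVneq K L.
    by rewrite eqxx orbT eq_sym oL.
  rewrite (_ : (Some L == Some K) = false) ?orbF ?andbN//.
  by apply/eqP => -[LK]; rewrite LK eqxx in KL.
by rewrite big_pred0// => K; rewrite /is_face_of E /= orbF eq_sym andbN.
Qed.

Lemma across_own u s L : Defs.opp s = Some L -> across u (own s) s = at_cell u L.
Proof. by move=> E; rewrite /across /neighbour eqxx E. Qed.

Lemma across_opp u s L : Defs.opp s = Some L -> across u L s = at_cell u (own s).
Proof.
by move=> E; have [oL _ _] := opp_some E; rewrite /across /neighbour (negbTE oL).
Qed.

Lemma across_face u s : Defs.opp s = None -> across u (own s) s = at_face u s.
Proof. by move=> E; rewrite /across /neighbour eqxx E. Qed.

Lemma jump_opp u s L : Defs.opp s = Some L -> jump u L s = - jump u (own s) s.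
Proof.
by move=> E; rewrite /jump E /= (across_opp _ E) (across_own _ E) opprB.
Qed.

Lemma jump_sub u v K s : jump (grid_sub u v) K s = jump u K s - jump v K s.
Proof.
rewrite /jump; case: ifPn => _; last by rewrite subrr.
by rewrite /across; case: (neighbour K s) => [L|] /=; ring.
Qed.

Lemma Sch_Gum_flux_opp z (phi dens : gridfun M) s L : Defs.opp s = Some L ->
  Sch_Gum_flux z phi dens L s = - Sch_Gum_flux z phi dens (own s) s.
Proof.
move=> E; rewrite /Sch_Gum_flux (jump_opp _ E) opprK (across_opp _ E) (across_own _ E).
ring.
Qed.

(** Summation by parts, for fluxes that are conservative across interior faces and
  vanish on the Neumann boundary, and test functions that vanish on the Dirichlet
  boundary. *)
Lemma summation_by_parts (J : cell M -> face M -> R) u :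
  (forall s L, Defs.opp s = Some L -> J L s = - J (own s) s) ->
  (forall s, Defs.opp s = None -> ~~ dirichlet_face s -> J (own s) s = 0) ->
  (forall s, at_face u s = 0) ->
  \sum_K at_cell u K * (\sum_(s | is_face_of s K) J K s) =
  - \sum_s J (own s) s * jump u (own s) s.
Proof.
move=> J_opp J0 u0.
under eq_bigr do rewrite mulr_sumr.
rewrite sum_faces_cells -sumrN; apply: eq_bigr => s _.
rewrite /jump; case E : (Defs.opp s) => [L|] /=.
  by rewrite (across_own _ E) (J_opp _ _ E); ring.
case: ifPn => sD; first by rewrite across_face// u0; ring.
by rewrite J0//; ring.
Qed.

(** Young's inequality on one face: the flux is - z^2 tau nb D, where nb is the
  interface density and D the jump of the quasi Fermi potential.  If D = 0, the
  flux vanishes and the value of nb does not matter. *)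
Lemma face_inequality z (phi dens : gridfun M) s (g : R) : z != 0 -> 0 <= tau_face s ->
  (Defs.opp s != None) || dirichlet_face s ->
  0 < at_cell dens (own s) -> 0 < across dens (own s) s ->
  Sch_Gum_flux z phi dens (own s) s * (jump phi (own s) s - g)
    + z ^+ 2 / 2 * (tau_face s * interface_density z phi dens s * abs_jump phi s ^+ 2)
  <= z ^+ 2 / 2 * (tau_face s * Num.max (at_cell dens (own s)) (across dens (own s) s)
                   * g ^+ 2).
Proof.
move=> z0 t0 act a0 b0.
rewrite /Sch_Gum_flux /interface_density /abs_jump real_normK ?num_real//.
set a := at_cell dens (own s) in a0 *; set b := across dens (own s) s in b0 *.
have -> : jump (zphi_sub_ln z phi dens) (own s) s =
    z * (across phi (own s) s - at_cell phi (own s)) - (ln b - ln a).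
  rewrite /jump act /b /across; case: (neighbour _ _) => [L|] /=; rewrite /a; ring.
have -> : jump phi (own s) s = across phi (own s) s - at_cell phi (own s).
  by rewrite /jump act.
set D := across phi (own s) s - at_cell phi (own s).
have [] := Sch_Gum_bounds (z * D) a0 b0.
set N := _ * b - _ * a => N0 Nbound.
have z2 : 0 <= z ^+ 2 / 2 by rewrite divr_ge0// sqr_ge0.
have max0 : 0 <= Num.max a b by rewrite le_max ltW.
have [zD0|zD0] := eqVneq (z * D) 0.
  rewrite (N0 zD0) mulr0 mul0r add0r.
  have -> : D = 0 by move/eqP : zD0; rewrite mulf_eq0 (negbTE z0) => /eqP.
  rewrite expr0n mulr0 mulr0; apply: mulr_ge0 => //.
  by apply: mulr_ge0; [exact: mulr_ge0|exact: sqr_ge0].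
have /andP[nb0 nb1] := Nbound zD0.
set nb := N / (z * D) in nb0 nb1 *.
have NE : N = nb * (z * D) by rewrite /nb divfK.
rewrite NE.
have h1 : 0 <= z ^+ 2 / 2 * (tau_face s * nb * (D - g) ^+ 2).
  by rewrite mulr_ge0// mulr_ge0 ?sqr_ge0// mulr_ge0.
have h2 : z ^+ 2 / 2 * (tau_face s * nb * g ^+ 2) <=
    z ^+ 2 / 2 * (tau_face s * Num.max a b * g ^+ 2).
  by rewrite ler_wpM2l// ler_wpM2r ?sqr_ge0// ler_wpM2l.
lra.
Qed.

End discrete_calculus.

Section energy_inequality.
Variables (R : realType) (F : carrier -> statistics (@pos_axis R))
  (Fa : statistics (@open_unit R)) (n : nat) (V : device R n)
  (M : mesh V) (xi : R) (T : timegrid R) (P : params R) (A : problem_data V)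
  (U : unknowns M).
Hypotheses (xi_gt0 : 0 < xi) (M_regular : regular_mesh M xi)
  (U_solution : scheme_solution F Fa T P A U).
Implicit Types (K : cell M) (s : face M) (al : carrier) (m : nat).

Local Notation z := (charge_number R).
Local Notation dens := (dens F A U).
Local Notation dens_a := (dens_a Fa P U).
Local Notation dens_grid := (dens_grid F A U).
Local Notation dens_a_grid := (dens_a_grid Fa P U).
Local Notation psi_grid := (psi_grid A U).
Local Notation phi_grid := (phi_grid A U).
Local Notation phi_a_grid := (phi_a_grid U).
Local Notation psiD_grid := (psiD_grid M A).
Local Notation phiD_grid := (phiD_grid M A).
Local Notation densD_grid := (densD_grid F M A).

Lemma d_face_ge0 s : 0 <= d_face s.
Proof.
have [reg _] := M_regular; apply: le_trans (reg (own s) s (own_face s)).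
by rewrite mulr_ge0 ?diam_cset_ge0// ltW.
Qed.

Lemma tau_face_ge0 s : 0 <= tau_face s.
Proof. by rewrite /tau_face divr_ge0 ?d_face_ge0// ltW// m_face_gt0. Qed.

Lemma z_sq al : z al ^+ 2 = 1. Proof. by case: al; rewrite /charge_number ?sqrrN expr1n. Qed.

Lemma stat_gt0 al (x : R) : 0 < F al x.
Proof. by rewrite -pos_axisE; exact: stat_range. Qed.

Lemma across_dens_gt0 m al K s : 0 < across (dens_grid m al) K s.
Proof. by rewrite /across; case: neighbour => [L|] /=; exact: stat_gt0. Qed.

Lemma dens_a_unit m K : @open_unit R (dens_a m K).
Proof. exact: stat_range. Qed.

Lemma timestep_gt0 m : (0 < m <= nsteps T)%N -> 0 < timestep T m.
Proof. by case: m => //= m mT; rewrite /timestep /= subr_gt0 time_lt. Qed.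

Lemma flux_opp m al s L : Defs.opp s = Some L ->
  flux F A U m al L s = - flux F A U m al (own s) s.
Proof. by move=> E; rewrite /flux E /= Sch_Gum_flux_opp. Qed.

Lemma flux_a_opp m s L : Defs.opp s = Some L ->
  flux_a Fa P U m L s = - flux_a Fa P U m (own s) s.
Proof.
by move=> E; rewrite /flux_a; case: ifPn => _; rewrite ?oppr0// Sch_Gum_flux_opp.
Qed.

Let dpsi m := grid_sub (psi_grid m) psiD_grid.

(** Convexity of the square, then the Poisson equation at two consecutive times,
  tested with psi - psi^D. *)
Lemma electrostatic_diff m : (0 < m <= nsteps T)%N ->
  lambda P ^+ 2 / 2 * (\sum_s tau_face s * abs_jump (dpsi m) s ^+ 2)
  - lambda P ^+ 2 / 2 * (\sum_s tau_face s * abs_jump (dpsi m.-1) s ^+ 2)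
  <= \sum_K at_cell (dpsi m) K *
       (delta P * m_cell K *
          (\sum_(al <- [:: electron; hole]) z al * (dens m al K - dens m.-1 al K))
        + if K \in intr_cells M then m_cell K * z_a P * (dens_a m K - dens_a m.-1 K)
          else 0).
Proof.
move=> /andP[m0 mT]; have [_ _ _ _ poisson] := U_solution.
pose e := grid_sub (psi_grid m) (psi_grid m.-1).
have rhsE K : delta P * m_cell K *
    (\sum_(al <- [:: electron; hole]) z al * (dens m al K - dens m.-1 al K))
    + (if K \in intr_cells M then m_cell K * z_a P * (dens_a m K - dens_a m.-1 K)
       else 0) = - lambda P ^+ 2 * (\sum_(s | is_face_of s K) tau_face s * jump e K s).
  under [in RHS]eq_bigr do rewrite jump_sub mulrBr.
  rewrite [in RHS]sumrB [in RHS]mulrBr poisson// poisson ?(leq_trans (leq_pred _))//.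
  rewrite !big_cons !big_nil; case: ifPn => _; ring.
under [leRHS]eq_bigr do rewrite rhsE mulrCA.
rewrite -mulr_sumr (@summation_by_parts _ _ _ _ (fun K s => tau_face s * jump e K s)); last 3 first.
- by move=> s L E; rewrite (jump_opp _ E) mulrN.
- by move=> s E sD; rewrite /jump E /= (negbTE sD) mulr0.
- by move=> s; rewrite /dpsi /= subrr.
rewrite mulrNN -mulrBr -sumrB !mulr_sumr; apply: ler_sum => s _.
rewrite /abs_jump !real_normK ?num_real//.
have -> : jump e (own s) s = jump (dpsi m) (own s) s - jump (dpsi m.-1) (own s) s.
  by rewrite !jump_sub; ring.
set a := jump (dpsi m) _ _; set b := jump (dpsi m.-1) _ _.
have h : 0 <= lambda P ^+ 2 * (tau_face s * (a - b) ^+ 2).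
  by rewrite mulr_ge0 ?sqr_ge0// mulr_ge0 ?sqr_ge0// tau_face_ge0.
lra.
Qed.

Lemma vacancy_entropy_diff m :
  \sum_(K in intr_cells M) m_cell K * stat_antider Fa (dens_a m K)
  - \sum_(K in intr_cells M) m_cell K * stat_antider Fa (dens_a m.-1 K)
  <= \sum_(K in intr_cells M) m_cell K *
       (z_a P * (phi_a U m K - psi U m K) * (dens_a m K - dens_a m.-1 K)).
Proof.
rewrite -sumrB; apply: ler_sum => K _; rewrite -mulrBr.
apply: ler_wpM2l; first by rewrite ltW// m_cell_gt0.
have := @antider_tangent _ _ Fa (@open_unit_itv R) _ _ (dens_a_unit m K) (dens_a_unit m.-1 K).
have -> : stat_inv Fa (dens_a m K) = z_a P * (phi_a U m K - psi U m K) by exact: statK.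
lra.
Qed.

Lemma carrier_entropy_diff m al :
  \sum_K m_cell K * rel_entropy (F al) (dens m al K) (at_cell (densD_grid al) K)
  - \sum_K m_cell K * rel_entropy (F al) (dens m.-1 al K) (at_cell (densD_grid al) K)
  <= \sum_K m_cell K * (z al * (at_cell (grid_sub (phi_grid m al) phiD_grid) K
        - at_cell (dpsi m) K) * (dens m al K - dens m.-1 al K)).
Proof.
rewrite -sumrB; apply: ler_sum => K _; rewrite -mulrBr.
apply: ler_wpM2l; first by rewrite ltW// m_cell_gt0.
have rng (x : R) : @pos_axis R (F al x) by exact: stat_range.
apply: le_trans (@rel_entropy_diff _ _ (F al) (@pos_axis_itv R) _ _ _ (rng _) (rng _) (rng _)) _.
rewrite /dens /= !statK le_eqVlt; apply/orP; left; apply/eqP; ring.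
Qed.

(** The contributions of psi from the electrostatic energy and from the entropies
  cancel. *)
Lemma energy_diff m : (0 < m <= nsteps T)%N ->
  energy F Fa P A U m - energy F Fa P A U m.-1 <=
  \sum_(K in intr_cells M) (phi_a U m K - at_cell psiD_grid K) *
     (z_a P * m_cell K * (dens_a m K - dens_a m.-1 K))
  + delta P * (\sum_(al <- [:: electron; hole]) \sum_K
      at_cell (grid_sub (phi_grid m al) phiD_grid) K *
        (z al * m_cell K * (dens m al K - dens m.-1 al K))).
Proof.
move=> mT; rewrite /energy.
have h1 := electrostatic_diff mT.
have h2 := vacancy_entropy_diff m.
have h3 al := ler_wpM2l (ltW (delta_gt0 P)) (carrier_entropy_diff m al).
have h3e := h3 electron; have h3h := h3 hole.
have -> : \sum_(K in intr_cells M) (phi_a U m K - at_cell psiD_grid K) *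
     (z_a P * m_cell K * (dens_a m K - dens_a m.-1 K)) =
   \sum_(K in intr_cells M)
     m_cell K * (z_a P * (phi_a U m K - psi U m K) * (dens_a m K - dens_a m.-1 K))
   + \sum_K at_cell (dpsi m) K *
     (if K \in intr_cells M then m_cell K * z_a P * (dens_a m K - dens_a m.-1 K) else 0).
  rewrite [X in _ = _ + X](bigID (fun K => K \in intr_cells M)) /=.
  rewrite [X in _ = _ + (_ + X)]big1 ?addr0; last first.
    by move=> K /negbTE ->; rewrite mulr0.
  rewrite -big_split /=; apply: eq_bigr => K ->; ring.
have E : delta P * (\sum_(al <- [:: electron; hole]) \sum_K
      at_cell (grid_sub (phi_grid m al) phiD_grid) K *
        (z al * m_cell K * (dens m al K - dens m.-1 al K))) =
  delta P * (\sum_(al <- [:: electron; hole]) \sum_K m_cell K *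
    (z al * (at_cell (grid_sub (phi_grid m al) phiD_grid) K - at_cell (dpsi m) K) *
      (dens m al K - dens m.-1 al K)))
  + \sum_K at_cell (dpsi m) K * (delta P * m_cell K *
     (\sum_(al <- [:: electron; hole]) z al * (dens m al K - dens m.-1 al K))).
  rewrite !big_cons !big_nil !addr0 -big_split /= -big_split /= !mulr_sumr -big_split /=.
  by apply: eq_bigr => K _; rewrite !big_cons !big_nil /charge_number; ring.
rewrite {}E.
have -> : \sum_K at_cell (dpsi m) K *
     (if K \in intr_cells M then m_cell K * z_a P * (dens_a m K - dens_a m.-1 K) else 0) =
   \sum_K at_cell (dpsi m) K *
       (delta P * m_cell K *
          (\sum_(al <- [:: electron; hole]) z al * (dens m al K - dens m.-1 al K))
        + if K \in intr_cells M then m_cell K * z_a P * (dens_a m K - dens_a m.-1 K)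
          else 0)
   - \sum_K at_cell (dpsi m) K * (delta P * m_cell K *
     (\sum_(al <- [:: electron; hole]) z al * (dens m al K - dens m.-1 al K))).
  by rewrite -sumrB; apply: eq_bigr => K _; ring.
rewrite !big_cons !big_nil !addr0.
lra.
Qed.

(** A face with a flux of vacancies has both cells in the intrinsic layer, so the
  test function may be extended by 0 to the other cells. *)
Lemma vacancy_dissipation m :
  - \sum_(K in intr_cells M) (phi_a U m K - at_cell psiD_grid K) *
      (\sum_(s | is_face_of s K) flux_a Fa P U m K s)
  + z_a P ^+ 2 / 2 * (\sum_(s | interior_intr_face s)
      tau_face s * interface_density (z_a P) (phi_a_grid m) (dens_a_grid m) s
        * abs_jump (phi_a_grid m) s ^+ 2)
  <= z_a P ^+ 2 / 2 * (\sum_(s | interior_intr_face s)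
       tau_face s * jump psiD_grid (own s) s ^+ 2).
Proof.
pose u : gridfun M := {| at_cell := fun K => if K \in intr_cells M then
    phi_a U m K - at_cell psiD_grid K else 0; at_face := fun=> 0 |}.
rewrite big_mkcond /= (eq_bigr (fun K => at_cell u K *
    (\sum_(s | is_face_of s K) flux_a Fa P U m K s))); last first.
  by move=> K _ /=; case: ifP => _; rewrite ?mul0r.
rewrite (@summation_by_parts _ _ _ _ (flux_a Fa P U m)); last 3 first.
- by move=> s L; exact: flux_a_opp.
- move=> s E _; rewrite /flux_a; case: ifPn => // /interior_intr_faceP[+ _].
  by rewrite E eqxx.
- by [].
rewrite opprK !mulr_sumr [X in X + _ <= _](bigID (@interior_intr_face _ _ _ _)) /=.
rewrite [X in _ + X + _ <= _]big1 ?addr0; last first.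
  by move=> s /negbTE ns; rewrite /flux_a ns mul0r.
rewrite -big_split /=; apply: ler_sum => s s_intr.
have [sN sK] := interior_intr_faceP s_intr.
case E : (Defs.opp s) sN => [L|] // _.
have uE : jump u (own s) s = jump (phi_a_grid m) (own s) s - jump psiD_grid (own s) s.
  by rewrite /jump E /= !(across_own _ E) /u /= !sK ?own_face ?opp_face//; ring.
rewrite uE /flux_a s_intr.
have za : z_a P != 0 by rewrite gt_eqF// z_a_gt0.
have dens01 K : 0 < dens_a m K < 1 by have := dens_a_unit m K; rewrite /open_unit /= in_itv.
have act : (Defs.opp s != None) || dirichlet_face s by rewrite E.
have /andP[a0 _] := dens01 (own s).
have b0 : 0 < across (dens_a_grid m) (own s) s.
  by rewrite (across_own _ E); have /andP[] := dens01 L.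
have H := @face_inequality _ _ _ _ (z_a P) (phi_a_grid m) (dens_a_grid m) s
  (jump psiD_grid (own s) s) za (tau_face_ge0 s) act a0 b0.
apply: (le_trans H).
rewrite ler_wpM2l ?divr_ge0 ?sqr_ge0// ler_wpM2r ?sqr_ge0// ler_piMr ?tau_face_ge0//.
rewrite ge_max (across_own _ E); apply/andP; split.
  by have /andP[_ /ltW] := dens01 (own s).
by have /andP[_ /ltW] := dens01 L.
Qed.

Lemma carrier_dissipation m al :
  - \sum_K at_cell (grid_sub (phi_grid m al) phiD_grid) K *
      (\sum_(s | is_face_of s K) flux F A U m al K s)
  + 1 / 2 * (\sum_s
      tau_face s * interface_density (z al) (phi_grid m al) (dens_grid m al) s
        * abs_jump (phi_grid m al) s ^+ 2)
  <= 1 / 2 * (\sum_s tau_face s *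
       Num.max (dens m al (own s)) (across (dens_grid m al) (own s) s)
       * jump phiD_grid (own s) s ^+ 2).
Proof.
rewrite summation_by_parts; last 3 first.
- by move=> s L; exact: flux_opp.
- by move=> s E sD; rewrite /flux E /= (negbTE sD).
- by move=> s /=; rewrite subrr.
rewrite opprK !mulr_sumr -big_split /=; apply: ler_sum => s _.
have max0 : 0 <= Num.max (dens m al (own s)) (across (dens_grid m al) (own s) s).
  by rewrite le_max (ltW (stat_gt0 _ _)).
rewrite jump_sub /flux; case: ifPn => act; last first.
  rewrite mul0r add0r /abs_jump {1}/jump (negbTE act) normr0 expr0n !mulr0.
  apply: mulr_ge0; first by rewrite divr_ge0.
  apply: mulr_ge0; last exact: sqr_ge0.
  by apply: mulr_ge0 => //; exact: tau_face_ge0.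
have zal : z al != 0 by case: al {act max0} => /=; rewrite ?oppr_eq0 oner_eq0.
have := @face_inequality _ _ _ _ (z al) (phi_grid m al) (dens_grid m al) s
  (jump phiD_grid (own s) s) zal (tau_face_ge0 s) act
  (stat_gt0 _ _ : 0 < at_cell (dens_grid m al) (own s)) (across_dens_gt0 m al (own s) s).
by rewrite z_sq.
Qed.

(** The energy inequality, with the data in the right-hand side.  As the charges
  of electrons and holes are opposite, testing the reaction terms with phi - phi^D
  leaves the difference phi_p - phi_n, and the recombination part cancels with
  the last term of the dissipation. *)
Lemma discrete_energy_inequality m : (0 < m <= nsteps T)%N ->
  (energy F Fa P A U m - energy F Fa P A U m.-1) / timestep T m
    + dissipation F Fa P A U m <=
  z_a P ^+ 2 / 2 * (\sum_(s | interior_intr_face s)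
       tau_face s * jump psiD_grid (own s) s ^+ 2)
  + delta P / nu P * (\sum_(al <- [:: electron; hole]) 1 / 2 * (\sum_s tau_face s *
       Num.max (dens m al (own s)) (across (dens_grid m al) (own s) s)
       * jump phiD_grid (own s) s ^+ 2))
  + delta P / nu P * (\sum_K m_cell K * (gamma P * cell_average (photogen A) K)
       * (phi U m hole K - phi U m electron K)).
Proof.
move=> mT; have tm := timestep_gt0 mT; have nu0 := nu_gt0 P.
have [_ _ cont cont_a _] := U_solution.
have dn0 : 0 <= delta P / nu P by rewrite divr_ge0 ?ltW// delta_gt0.
have h1 : (energy F Fa P A U m - energy F Fa P A U m.-1) / timestep T m <=
    - \sum_(K in intr_cells M) (phi_a U m K - at_cell psiD_grid K) *
      (\sum_(s | is_face_of s K) flux_a Fa P U m K s)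
    + delta P / nu P * (\sum_(al <- [:: electron; hole])
       (- (\sum_K at_cell (grid_sub (phi_grid m al) phiD_grid) K *
            (\sum_(s | is_face_of s K) flux F A U m al K s))
        + \sum_K at_cell (grid_sub (phi_grid m al) phiD_grid) K * (z al * m_cell K *
           (gamma P * cell_average (photogen A) K - recombination F P A U m K)))).
  rewrite ler_pdivrMr//; apply: (le_trans (energy_diff mT)).
  rewrite le_eqVlt; apply/orP; left; apply/eqP.
  rewrite mulrDl; congr (_ + _).
    rewrite mulNr mulr_suml -sumrN; apply: eq_bigr => K K_intr.
    have := cont_a m K mT K_intr; rewrite /continuity_a_eq => /eqP.
    by rewrite addrC addr_eq0 => /eqP ->; field; rewrite gt_eqF.
  have dnE al K : z al * m_cell K * (dens m al K - dens m.-1 al K) =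
      timestep T m / nu P * (z al * m_cell K *
        (gamma P * cell_average (photogen A) K - recombination F P A U m K)
        - \sum_(s | is_face_of s K) flux F A U m al K s).
    have <- := cont m al K mT; rewrite addrK.
    by field; rewrite !gt_eqF.
  rewrite (eq_bigr (fun al => timestep T m / nu P *
      (- (\sum_K at_cell (grid_sub (phi_grid m al) phiD_grid) K *
            (\sum_(s | is_face_of s K) flux F A U m al K s))
        + \sum_K at_cell (grid_sub (phi_grid m al) phiD_grid) K * (z al * m_cell K *
           (gamma P * cell_average (photogen A) K - recombination F P A U m K))))).
    by rewrite -mulr_sumr mulrA [RHS]mulrAC; congr (_ * _); ring.
  move=> al _; rewrite -sumrN -big_split /= mulr_sumr; apply: eq_bigr => K _.
  by rewrite dnE; ring.
have h2 := vacancy_dissipation m.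
have h3 al := ler_wpM2l dn0 (carrier_dissipation m al).
have h3e := h3 electron; have h3h := h3 hole.
have reac : \sum_(al <- [:: electron; hole]) (\sum_K
    at_cell (grid_sub (phi_grid m al) phiD_grid) K * (z al * m_cell K *
      (gamma P * cell_average (photogen A) K - recombination F P A U m K))) =
    \sum_K m_cell K * (gamma P * cell_average (photogen A) K)
       * (phi U m hole K - phi U m electron K)
    - \sum_K m_cell K * recombination F P A U m K
        * (phi U m hole K - phi U m electron K).
  rewrite !big_cons !big_nil addr0 -big_split /= -sumrB; apply: eq_bigr => K _.
  by rewrite /charge_number; ring.
have reacd := congr1 (fun x => delta P / nu P * x) reac.
move: h1 reacd; rewrite /dissipation.
have -> : delta P / (2 * nu P) = delta P / nu P * (1 / 2) by field; rewrite gt_eqF.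
rewrite !big_cons !big_nil !addr0.
lra.
Qed.

End energy_inequality.

(** * Estimates of the boundary data and conclusion *)

Section data_estimates.
Variables (R : realType) (F : carrier -> statistics (@pos_axis R))
  (Fa : statistics (@open_unit R)) (n : nat) (V : device R n)
  (M : mesh V) (xi : R) (T : timegrid R) (P : params R) (A : problem_data V)
  (U : unknowns M).
Hypotheses (dim_le3 : (n.+1 <= 3)%N) (xi_gt0 : 0 < xi)
  (M_regular : regular_mesh M xi).
Implicit Types (K : cell M) (s : face M) (al : carrier) (m : nat).

Let Om := fine (lebesgue_rV R n.+1 (Omega V)).
Let Nphi := fine (W1inf_norm (phiD A)).
Let Npsi := fine (W1inf_norm (psiD A)).
Let NG := fine (Linf_norm (Omega V) (photogen A)).
Let bd := expR (Nphi + Npsi).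

Let tau_ge0 s : 0 <= tau_face s := tau_face_ge0 xi_gt0 M_regular s.
Let d_ge0 s : 0 <= d_face s := d_face_ge0 xi_gt0 M_regular s.
Let md_ge0 s : 0 <= m_face s * d_face s.
Proof. by rewrite mulr_ge0// ltW// m_face_gt0. Qed.

Lemma Om_ge0 : 0 <= Om. Proof. by apply: fine_ge0. Qed.

Lemma charge_number_le al (x : R) : charge_number R al * x <= `|x|.
Proof. by case: al => /=; rewrite ?mulN1r ?mul1r ?ler_norm// -normrN ler_norm. Qed.

Lemma densD_cell_bound al K : at_cell (densD_grid F M A al) K <= bd.
Proof.
apply: (le_trans (stat_le_exp _ _)); rewrite ler_expR (le_trans (charge_number_le _ _))//=.
by rewrite (le_trans (ler_normB _ _))// lerD//; exact: cell_average_bound.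
Qed.

Lemma densD_face_bound al s : at_face (densD_grid F M A al) s <= bd.
Proof.
apply: (le_trans (stat_le_exp _ _)); rewrite ler_expR (le_trans (charge_number_le _ _))//=.
by rewrite (le_trans (ler_normB _ _))// lerD//; exact: face_average_bound.
Qed.

Lemma tau_jump_sq (w : W1inf (Omega V)) s (L : R) : 0 <= L ->
  {ae lebesgue_rV R n.+1, forall x, Omega V x -> enorm (wgrad w x) <= L} ->
  tau_face s * jump (W1inf_grid M w) (own s) s ^+ 2 <=
  36 * L ^+ 2 / xi ^+ 2 * (m_face s * d_face s).
Proof.
move=> L0 wL; have J := W1inf_jump s L0 xi_gt0 M_regular wL.
have dxi0 : 0 <= d_face s / xi by rewrite divr_ge0// ltW.
(* 6 = 2 * 3, where 3 bounds the dimension *)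
have J6 : `|jump (W1inf_grid M w) (own s) s| <= 6 * L * (d_face s / xi).
  apply: (le_trans J); rewrite ler_wpM2r//.
  have : n.+1%:R <= 3 :> R by rewrite ler_nat.
  move=> /(ler_wpM2l L0); lra.
have Jsq : jump (W1inf_grid M w) (own s) s ^+ 2 <= (6 * L * (d_face s / xi)) ^+ 2.
  rewrite -[leLHS]real_normK ?num_real// ler_pXn2r// nnegrE//.
  by apply: mulr_ge0 => //; exact: mulr_ge0.
apply: (le_trans (ler_wpM2l (tau_ge0 s) Jsq)).
(* if d_face s = 0 then tau_face s = m_face s / 0 = 0 *)
rewrite /tau_face; have [d0|dn0] := eqVneq (d_face s) 0.
  by rewrite d0 invr0 !mulr0 mul0r.
by rewrite le_eqVlt; apply/orP; left; apply/eqP; field; rewrite dn0 gt_eqF.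
Qed.

Lemma sum_md_weighted (h : cell M -> R) : (forall K, 0 <= h K) ->
  \sum_K \sum_(s | is_face_of s K) m_face s * d_face s * h K <=
  (\sum_K m_cell K * h K) / xi.
Proof.
move=> h0; rewrite ler_pdivlMr// mulrC mulr_sumr; apply: ler_sum => K _.
rewrite -mulr_suml mulrA ler_wpM2r//.
by have [_ ->] := M_regular.
Qed.

Lemma sum_md_le : \sum_(s : face M) m_face s * d_face s <= Om / xi.
Proof.
have := @sum_md_weighted (fun=> 1) (fun=> ler01).
rewrite (sum_faces_cells (fun K s => m_face s * d_face s * 1)).
rewrite (eq_bigr (fun K : cell M => m_cell K)) => [H|K _]; last by rewrite mulr1.
apply: (@le_trans _ _ ((\sum_(K : cell M) m_cell K) / xi)).
  apply: le_trans H; apply: ler_sum => s _; rewrite mulr1 lerDl.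
  by case: Defs.opp => [L|] //; rewrite mulr1 md_ge0.
by rewrite ler_wpM2r ?invr_ge0 ?(ltW xi_gt0)//; exact: sum_m_cell_le.
Qed.

Lemma psiD_term :
  \sum_(s | interior_intr_face s) tau_face s * jump (psiD_grid M A) (own s) s ^+ 2
  <= 36 * Npsi ^+ 2 / xi ^+ 2 * (Om / xi).
Proof.
have k0 : 0 <= 36 * Npsi ^+ 2 / xi ^+ 2 by rewrite divr_ge0 ?sqr_ge0// mulr_ge0 ?sqr_ge0.
apply: (@le_trans _ _ (\sum_(s : face M) 36 * Npsi ^+ 2 / xi ^+ 2 * (m_face s * d_face s))).
  rewrite [leRHS](bigID (@interior_intr_face _ _ _ _)) /=.
  apply: (@le_trans _ _ (\sum_(s : face M | interior_intr_face s)
      36 * Npsi ^+ 2 / xi ^+ 2 * (m_face s * d_face s))).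
    apply: ler_sum => s _; apply: tau_jump_sq; first exact: W1inf_norm_ge0.
    exact: W1inf_grad_ae.
  by rewrite lerDl; apply: sumr_ge0 => s _; rewrite mulr_ge0.
by rewrite -mulr_sumr ler_wpM2l// sum_md_le.
Qed.

(** The largest of the two densities at a face is at most their sum, and densities
  on boundary faces are at most bd. *)
Lemma phiD_term m al :
  \sum_s tau_face s *
    Num.max (dens F A U m al (own s)) (across (dens_grid F A U m al) (own s) s)
    * jump (phiD_grid M A) (own s) s ^+ 2
  <= 36 * Nphi ^+ 2 / xi ^+ 2 * ((\sum_K m_cell K * dens F A U m al K) / xi + bd * (Om / xi)).
Proof.
have k0 : 0 <= 36 * Nphi ^+ 2 / xi ^+ 2 by rewrite divr_ge0 ?sqr_ge0// mulr_ge0 ?sqr_ge0.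
pose h K := dens F A U m al K.
have h0 K : 0 < h K by exact: stat_gt0.
have bd0 : 0 <= bd by exact: expR_ge0.
apply: (@le_trans _ _ (\sum_s 36 * Nphi ^+ 2 / xi ^+ 2 *
    ((m_face s * d_face s * h (own s) +
      if Defs.opp s is Some L then m_face s * d_face s * h L else 0)
      + bd * (m_face s * d_face s)))).
  apply: ler_sum => s _; rewrite -mulrA mulrCA mulrC.
  apply: (@le_trans _ _ (36 * Nphi ^+ 2 / xi ^+ 2 * (m_face s * d_face s) *
    Num.max (h (own s)) (across (dens_grid F A U m al) (own s) s))).
    rewrite ler_wpM2r ?le_max ?(ltW (h0 _))//.
    apply: tau_jump_sq; first exact: W1inf_norm_ge0.
    exact: W1inf_grad_ae.
  rewrite -mulrA ler_wpM2l//.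
  have md := md_ge0 s.
  have md_bd := mulr_ge0 bd0 md.
  case E : (Defs.opp s) => [L|].
    rewrite (across_own _ E) -[at_cell _ L]/(h L).
    have h1 := mulr_ge0 md (ltW (h0 (own s))).
    have h2 := mulr_ge0 md (ltW (h0 L)).
    by rewrite maxEle; case: ifP => _; lra.
  have h1 := mulr_ge0 md (ltW (h0 (own s))).
  have h2 : m_face s * d_face s * at_face (dens_grid F A U m al) s <=
     m_face s * d_face s * bd by rewrite ler_wpM2l// densD_face_bound.
  rewrite (across_face _ E).
  move: (at_face _ _) h2 => nf h2 /=.
  by rewrite maxEle; case: ifP => _; lra.
rewrite -mulr_sumr ler_wpM2l// big_split /= -mulr_sumr.
rewrite -(sum_faces_cells (fun K s => m_face s * d_face s * h K)).
apply: lerD; first by apply: sum_md_weighted => K; exact: ltW.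
by rewrite ler_wpM2l// sum_md_le.
Qed.

Lemma photogen_bound K : 0 <= cell_average (photogen A) K <= NG.
Proof.
have NG0 : 0 <= NG by apply: fine_ge0; exact: Linf_norm_ge0.
have : `|cell_average (photogen A) K - NG / 2| <= NG / 2.
  apply: cell_average_ae; first exact: (photogen_Linf A).1.
    by rewrite divr_ge0.
  apply: filterS2 (photogen_ge0 A) (Linf_norm_ae (photogen_Linf A).2).
  move=> x G0 GN Dx; have := GN Dx; have := G0 Dx.
  rewrite -/NG => h1; rewrite (ger0_norm h1) => h2.
  by rewrite ler_norml; apply/andP; split; lra.
by rewrite ler_norml => /andP[h1 h2]; apply/andP; split; lra.
Qed.

Lemma quasi_fermi_gap m K : phi U m hole K - phi U m electron K =
  \sum_(al <- [:: electron; hole]) stat_inv (F al) (dens F A U m al K).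
Proof. by rewrite !big_cons big_nil /dens /= !statK /charge_number; ring. Qed.

Section with_entropy_constants.
Variables (C : carrier -> R) (e : R) (m : nat).
Hypotheses (e0 : 0 < e) (C0 : forall al, 0 <= C al)
  (HC : forall al x y, 0 < x -> 0 < y -> y <= bd ->
    x <= C al + e * rel_entropy (F al) x y /\
    stat_inv (F al) x <= C al + e * rel_entropy (F al) x y).

Local Notation H al K :=
  (rel_entropy (F al) (dens F A U m al K) (at_cell (densD_grid F M A al) K)).

Let H_ge0 al K : 0 <= H al K.
Proof. by apply: (@rel_entropy_ge0 _ _ (F al) (@pos_axis_itv R)); exact: stat_range. Qed.

Let domin al K : dens F A U m al K <= C al + e * H al K /\
  stat_inv (F al) (dens F A U m al K) <= C al + e * H al K.
Proof.
by apply: HC; [exact: stat_gt0|exact: stat_gt0|exact: densD_cell_bound].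
Qed.

Let sum_domin al :
  \sum_K m_cell K * (C al + e * H al K) <= C al * Om + e * (\sum_K m_cell K * H al K).
Proof.
under eq_bigr do rewrite mulrDr mulrCA.
rewrite big_split /= -mulr_suml -mulr_sumr lerD2r mulrC ler_wpM2l//.
exact: sum_m_cell_le.
Qed.

Lemma density_term al :
  \sum_K m_cell K * dens F A U m al K <= C al * Om + e * (\sum_K m_cell K * H al K).
Proof.
apply: le_trans (sum_domin al); apply: ler_sum => K _.
by rewrite ler_wpM2l ?(domin al K).1// ltW// m_cell_gt0.
Qed.

Lemma photogen_term :
  \sum_K m_cell K * (gamma P * cell_average (photogen A) K)
       * (phi U m hole K - phi U m electron K)
  <= gamma P * NG * (\sum_(al <- [:: electron; hole])
        (C al * Om + e * (\sum_K m_cell K * H al K))).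
Proof.
have NG0 : 0 <= NG by apply: fine_ge0; exact: Linf_norm_ge0.
have g0 := ltW (gamma_gt0 P).
apply: (@le_trans _ _ (\sum_K gamma P * NG * (\sum_(al <- [:: electron; hole])
    m_cell K * (C al + e * H al K)))).
  apply: ler_sum => K _; rewrite quasi_fermi_gap.
  have mK := ltW (m_cell_gt0 K); have /andP[G0 GN] := photogen_bound K.
  rewrite -mulr_sumr -[leRHS]mulrA (mulrCA (m_cell K)) -!(mulrA (gamma P)).
  rewrite (mulrC (m_cell K)) -mulrA.
  rewrite ler_wpM2l//.
  have sum0 : 0 <= \sum_(al <- [:: electron; hole]) (C al + e * H al K).
    by apply: sumr_ge0 => al _; rewrite addr_ge0// mulr_ge0// ltW.
  apply: (@le_trans _ _ (cell_average (photogen A) K *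
     (m_cell K * \sum_(al <- [:: electron; hole]) (C al + e * H al K)))).
    rewrite ler_wpM2l// ler_wpM2l//; apply: ler_sum => al _; exact: (domin al K).2.
  by rewrite ler_wpM2r// mulr_ge0.
rewrite -mulr_sumr ler_wpM2l ?mulr_ge0// exchange_big /=.
by apply: ler_sum => al _.
Qed.

End with_entropy_constants.

Lemma energy_ge (m : nat) : normalized_antider Fa ->
  delta P * (\sum_(al <- [:: electron; hole]) \sum_K
      m_cell K * rel_entropy (F al) (dens F A U m al K) (at_cell (densD_grid F M A al) K))
  <= energy F Fa P A U m.
Proof.
move=> [Fa0 _]; rewrite /energy lerDr addr_ge0//.
  rewrite mulr_ge0 ?divr_ge0 ?sqr_ge0//; apply: sumr_ge0 => s _.
  by rewrite mulr_ge0 ?sqr_ge0.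
by apply: sumr_ge0 => K _; rewrite mulr_ge0 ?(ltW (m_cell_gt0 K))// Fa0//; exact: stat_range.
Qed.

End data_estimates.

Theorem theorem4p4 (R : realType)
    (F : carrier -> statistics (@pos_axis R))
    (Fa : statistics (@open_unit R))
    (F_superlinear : forall al, superlinear_entropy (F al))
    (Fa_normalized : normalized_antider Fa) :
  exists c : forall eps measOmega xi normG normphiD normpsiD za dl gm nn : R, R,
  forall (n : nat) (dim_le3 : (n.+1 <= 3)%N) (V : device R n) (M : mesh V)
    (xi : R) (xi_gt0 : 0 < xi) (M_regular : regular_mesh M xi)
    (T : timegrid R) (P : params R) (A : problem_data V) (U : unknowns M)
    (U_solution : scheme_solution F Fa T P A U),
  let E := energy F Fa P A U in
  let D := dissipation F Fa P A U in
  (forall eps : R, 0 < eps ->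
    let c_eps := c eps (fine (lebesgue_rV R n.+1 (Omega V))) xi
      (fine (Linf_norm (Omega V) (photogen A)))
      (fine (W1inf_norm (phiD A))) (fine (W1inf_norm (psiD A)))
      (z_a P) (delta P) (gamma P) (nu P) in
    0 < c_eps /\
    forall m : nat, (0 < m <= nsteps T)%N ->
      (E m - E m.-1) / timestep T m + D m <= c_eps + eps * E m) /\
  ({ae lebesgue_rV R n.+1, forall x, Omega V x -> photogen A x = 0} ->
   {ae lebesgue_rV R n.+1, forall x, Omega V x -> wgrad (phiD A) x = 0} ->
   {ae lebesgue_rV R n.+1, forall x, Omega V x -> wgrad (psiD A) x = 0} ->
   forall m : nat, (0 < m <= nsteps T)%N ->
     (E m - E m.-1) / timestep T m + D m <= 0).
Proof.
have /choice[C HC] : forall p : carrier * R * R, exists C : R,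
    0 < p.1.2 -> 0 < p.2 -> 0 <= C /\ forall x y, 0 < x -> 0 < y -> y <= p.1.2 ->
      x <= C + p.2 * rel_entropy (F p.1.1) x y /\
      stat_inv (F p.1.1) x <= C + p.2 * rel_entropy (F p.1.1) x y.
  move=> [[al b] e] /=; have [[b0 e0]|nbe] := pselect (0 < b /\ 0 < e).
    by have [C C0 HC] := entropy_dominates (F_superlinear al) b0 e0; exists C.
  by exists 0 => b0 e0; case: nbe.
(* the coefficient with which bounds of the densities and of the inverse
   statistics enter the remainder *)
pose A1 (xi NG Nphi dl gm nn : R) : R :=
  dl / nn * (18 * Nphi ^+ 2 / xi ^+ 2 / xi + gm * NG).
(* e is chosen such that a * e <= eps * dl *)
exists (fun eps Om xi NG Nphi Npsi za dl gm nn =>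
  let b := expR (Nphi + Npsi) in
  let a := A1 xi NG Nphi dl gm nn in
  let e := eps * dl / (a + 1) in
  za ^+ 2 / 2 * (36 * Npsi ^+ 2 / xi ^+ 2 * (Om / xi))
  + dl / nn * (36 * Nphi ^+ 2 / xi ^+ 2 * (b * (Om / xi)))
  + a * (C (electron, b, e) * Om + C (hole, b, e) * Om) + 1).
move=> n dim_le3 V M xi xi0 M_regular T P A U U_solution E D; split; last first.
  move=> G0 phi0 psi0 m mT.
  apply: (le_trans (discrete_energy_inequality xi0 M_regular U_solution mT)).
  have jump0 (w : W1inf (Omega V)) (s : face M) :
      {ae lebesgue_rV R n.+1, forall x, Omega V x -> wgrad w x = 0} ->
      jump (W1inf_grid M w) (own s) s = 0.
    move=> w0; apply/eqP; rewrite -normr_le0.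
    have := W1inf_jump s (lexx 0) xi0 M_regular (w := w); rewrite mul0r mulr0 mul0r.
    apply; apply: filterS w0 => x + Dx => -> //.
    by rewrite /enorm /dot big1 ?sqrtr0// => i _; rewrite !mxE mul0r.
  rewrite big1 => [|s _]; last by rewrite (jump0 _ s psi0) expr0n mulr0.
  rewrite big1 => [|al _]; last first.
    by rewrite big1 ?mulr0// => s _; rewrite (jump0 _ s phi0) expr0n mulr0.
  rewrite big1 => [|K _]; first by rewrite !mulr0 !addr0.
  have -> : cell_average (photogen A) K = 0.
    apply/eqP; rewrite -normr_le0 -[cell_average _ _]subr0.
    apply: cell_average_ae => //; first exact: (photogen_Linf A).1.
    by apply: filterS G0 => x + Dx => ->//; rewrite subr0 normr0.
  by rewrite !mulr0 mul0r.
move=> eps eps0 /=.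
set Om := fine (lebesgue_rV R n.+1 (Omega V)).
set NG := fine (Linf_norm _ _); set Nphi := fine (W1inf_norm (phiD A)).
set Npsi := fine (W1inf_norm (psiD A)); set b := expR (Nphi + Npsi).
set a := A1 xi NG Nphi (delta P) (gamma P) (nu P).
set e := eps * delta P / (a + 1).
have NG0 : 0 <= NG by apply: fine_ge0; exact: Linf_norm_ge0.
have dl0 := delta_gt0 P; have nu0 := nu_gt0 P; have gm0 := gamma_gt0 P.
have Om0 : 0 <= Om := Om_ge0 V.
have dn0 : 0 < delta P / nu P by rewrite divr_gt0.
have k0 (N : R) : 0 <= N ^+ 2 / xi ^+ 2.
  by rewrite divr_ge0 ?sqr_ge0.
have a0 : 0 <= a.
  apply: mulr_ge0; first exact: ltW.
  apply: addr_ge0; last by rewrite mulr_ge0// ltW.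
  by rewrite divr_ge0 ?(ltW xi0)// -mulrA mulr_ge0.
have a10 : 0 < a + 1 by rewrite ltr_wpDl.
have e0 : 0 < e by rewrite divr_gt0// mulr_gt0.
have b0 : 0 < b by exact: expR_gt0.
pose Cal al := C (al, b, e).
have C0 al : 0 <= Cal al by have [] := HC (al, b, e) b0 e0.
have HCal al : forall x y, 0 < x -> 0 < y -> y <= b ->
    x <= Cal al + e * rel_entropy (F al) x y /\
    stat_inv (F al) x <= Cal al + e * rel_entropy (F al) x y.
  by have [] := HC (al, b, e) b0 e0.
have Oxi0 : 0 <= Om / xi by rewrite divr_ge0// ltW.
have kk0 (N : R) : 0 <= 36 * N ^+ 2 / xi ^+ 2 by rewrite -mulrA mulr_ge0.
have t1 : 0 <= z_a P ^+ 2 / 2 * (36 * Npsi ^+ 2 / xi ^+ 2 * (Om / xi)).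
  by apply: mulr_ge0; [rewrite divr_ge0 ?sqr_ge0|exact: mulr_ge0].
have t2 : 0 <= delta P / nu P * (36 * Nphi ^+ 2 / xi ^+ 2 * (b * (Om / xi))).
  apply: mulr_ge0; first exact: ltW.
  by apply: mulr_ge0 => //; apply: mulr_ge0 => //; exact: ltW.
have t3 : 0 <= a * (Cal electron * Om + Cal hole * Om).
  by apply: mulr_ge0 => //; apply: addr_ge0; exact: mulr_ge0.
split; first by rewrite ltr_wpDl// !addr_ge0.
move=> m mT.
apply: (le_trans (discrete_energy_inequality xi0 M_regular U_solution mT)).
have p1 := psiD_term A dim_le3 xi0 M_regular.
have p2 al := phiD_term F A U dim_le3 xi0 M_regular m al.
have p3 al := density_term U m C0 HCal al.
have p4 := photogen_term P U m e0 C0 HCal.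
have p5 := energy_ge F P A U xi0 M_regular m Fa_normalized.
have := p2 electron; have := p2 hole; have := p3 electron; have := p3 hole.
have H0 al : 0 <= \sum_K m_cell K *
    rel_entropy (F al) (dens F A U m al K) (at_cell (densD_grid F M A al) K).
  apply: sumr_ge0 => K _; apply: mulr_ge0; first by rewrite ltW// m_cell_gt0.
  by apply: (@rel_entropy_ge0 _ _ (F al) (@pos_axis_itv R)); exact: stat_range.
move: p1 p4 p5 (H0 electron) (H0 hole); rewrite !big_cons !big_nil !addr0.
rewrite -/Om -/NG -/Nphi -/Npsi -/b -/(E m).
set X1 := \sum_(s | interior_intr_face s) _.
set X3 := \sum_K m_cell K * _ * _.
set Se := \sum_K m_cell K * rel_entropy (F electron) _ _.
set Sh := \sum_K m_cell K * rel_entropy (F hole) _ _.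
set Xe := \sum_s _ * Num.max (dens _ _ _ _ electron _) _ * _.
set Xh := \sum_s _ * Num.max (dens _ _ _ _ hole _) _ * _.
set ne := \sum_K m_cell K * dens _ _ _ _ electron K.
set nh := \sum_K m_cell K * dens _ _ _ _ hole K.
set k := 36 * Nphi ^+ 2 / xi ^+ 2.
move=> p1 p4 p5 Se0 Sh0 nhW neW XhW XeW.
pose We := Cal electron * Om + e * Se; pose Wh := Cal hole * Om + e * Sh.
have kxi : 0 <= k / xi by rewrite divr_ge0 ?(ltW xi0)//; exact: kk0.
have q1 := ler_wpM2l (divr_ge0 (sqr_ge0 (z_a P)) (ler0n R 2)) p1.
have carrier_bound X d W : X <= k * (d / xi + b * (Om / xi)) -> d <= W ->
    X <= k / xi * W + k * (b * (Om / xi)).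
  move=> XW dW; apply: (le_trans XW); rewrite mulrDr lerD2r mulrA mulrAC.
  exact: ler_wpM2l.
have {XeW}qe : Xe <= k / xi * We + k * (b * (Om / xi)) := carrier_bound _ _ _ XeW neW.
have {XhW}qh : Xh <= k / xi * Wh + k * (b * (Om / xi)) := carrier_bound _ _ _ XhW nhW.
have q2 := ler_wpM2l (ltW dn0) (lerD qe qh).
have q3 := ler_wpM2l (ltW dn0) p4.
have aE : a = delta P / nu P * (1 / 2 * (k / xi) + gamma P * NG).
  by rewrite /a /A1 /k; congr (_ * (_ + _)); field; rewrite gt_eqF.
have ae : a * e <= eps * delta P.
  by rewrite /e mulrCA ger_pMr ?mulr_gt0// ler_pdivrMr// mul1r lerDl.
have q5 : a * e * (Se + Sh) <= eps * E m.
  apply: (le_trans (ler_wpM2r (addr_ge0 Se0 Sh0) ae)).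
  by rewrite -mulrA ler_wpM2l// ltW.
have aW : a * (We + Wh) =
    a * (Cal electron * Om + Cal hole * Om) + a * e * (Se + Sh).
  by rewrite /We /Wh; ring.
have aW' : a * (We + Wh) = delta P / nu P * (1 / 2 * (k / xi * We + k / xi * Wh))
    + delta P / nu P * (gamma P * NG * (We + Wh)).
  by rewrite aE; ring.
rewrite -/We -/Wh in q3; rewrite -/(Cal electron) -/(Cal hole) /=.
move: (delta P / nu P) q2 q3 aW' => dn q2 q3 aW'.
lra.
Qed.
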